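(* Let $F$ and $G=F\circ K$ satisfy the standard set-up with densities $f$ and $g$. Let $c_n,b_n$ be defined by $1-F_0(c_n)=1-G_0(b_n)=1/n$. There exists a d.f. $\tilde F$ on $\mathbb{R}^d$ with density $\tilde f$ and meta d.f. $\tilde G=\tilde F\circ K$ with density $\tilde g$ with the following properties: (1) $\tilde f\le f$ outside the unit ball, and hence $\tilde g\le g$ outside a bounded set; (2) $\tilde f\equiv f$ on the $d$ coordinate planes $\{z_i=0\}$, and hence $\tilde g\equiv g$ on the coordinate planes; (3) for any unit vector $\zeta$ with nonzero components and any sequence ${\mathbf z}_n=r_n\zeta_n$ with $r_n\to\infty$ and $\zeta_n\to\zeta$, eventually $\tilde f({\mathbf z}_n)=f({\mathbf z}_n)$; (4) for any unit vector $\xi$ with nonzero components which does not lie on one of the $2^d$ diagonal rays, and any sequence ${\mathbf x}_n=r_n\xi_n$ with $r_n\to\infty$ and $\xi_n\to\xi$, eventually $\tilde g({\mathbf x}_n)=0$; (5) the sample clouds from $\tilde F$ scaled by $c_n$ converge to a Poisson point process with intensity $c_0h$; (6) the sample clouds from $\tilde G$ scaled by $b_n$ converge onto the diagonal cross $E_\times=\{r\delta : 0\le r\le1,\ \delta\in\{-1,1\}^d\}$.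
   Context: **Class $\mathcal F_\lambda$ ($\lambda>0$).** It consists of all positive continuous probability densities $f$ on $\mathbb{R}^d$ with $f({\mathbf z})/f_*(n_D({\mathbf z}))\to1$ as $\|{\mathbf z}\|\to\infty$, where $f_*(r)=L(r)/r^{\lambda+d}$ is a continuous decreasing function on $[0,\infty)$, $L$ is slowly varying at infinity, $D$ is a bounded open star-shaped set containing the origin (star-shaped: ${\mathbf z}\in D$ implies $t{\mathbf z}\in D$ for $0\le t<1$), and its gauge function $n_D$ is continuous. The gauge function is determined by $n_D({\mathbf z})>0$ for ${\mathbf z}\ne{\mathbf 0}$, $D=\{n_D<1\}$, $n_D(c{\mathbf z})=c\,n_D({\mathbf z})$ for $c\ge0$. **Standard set-up.** $F$ is a d.f. on $\mathbb{R}^d$ with density $f\in\mathcal F_\lambda$ for some $\lambda>0$, whose margins are all equal to a positive continuous symmetric density $f_0$ with d.f. $F_0$. $g_0$ is a continuous positive symmetric density on $\mathbb{R}$ with d.f. $G_0$, and $g_0(s)\sim e^{-\psi(s)}$ as $s\to\infty$, where $\psi$ is $C^2$ with positive derivative, $\psi(s)\to\infty$, $a=1/\psi'$ satisfies $a'(s)\to0$ as $s\to\infty$, and $\psi$ varies regularly at infinity with exponent $\theta>0$. The meta transformation is $K({\mathbf x})=(K_0(x_1),\ldots,K_0(x_d))$ with $K_0=F_0^{-1}\circ G_0$. The meta d.f. is $G=F\circ K$, with density $g$ and margins $g_0$. For a d.f. $\tilde F$ with density $\tilde f$, $\tilde G=\tilde F\circ K$ is the d.f. of $K^{-1}(\tilde{\mathbf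 Z})$ with $\tilde{\mathbf Z}\sim\tilde F$, and $\tilde g({\mathbf x})/g({\mathbf x})=\tilde f(K({\mathbf x}))/f(K({\mathbf x}))$. **$h$ and $c_0$.** $h({\mathbf w})=\lim_{r\to\infty}f(r{\mathbf w})/f(r{\mathbf e})$, ${\mathbf e}=(1,\ldots,1)$, which is of the form $c/n_D({\mathbf w})^{\lambda+d}$ with $c>0$ a constant; $c_0>0$ is the constant such that the sample clouds from $F$ scaled by $c_n$ converge to the Poisson point process with intensity $c_0h$ (equivalently, $c_0\int_{\{w_d\ge1\}}h({\mathbf w})\,d{\mathbf w}=1$). **Diagonal rays.** The rays $\{r\delta : r>0\}$, $\delta\in\{-1,1\}^d$. **Sample clouds.** The $n$-point sample cloud from a d.f. scaled by $a_n>0$ is the point process $\{{\mathbf Z}_1/a_n,\ldots,{\mathbf Z}_n/a_n\}$, with ${\mathbf Z}_1,{\mathbf Z}_2,\ldots$ independent with that d.f. Convergence to a Poisson point process on $\mathbb{R}^d\setminus\{{\mathbf 0}\}$ means convergence in distribution weakly on the complement of centered balls (test functions: bounded continuous functions vanishing on a neighbourhood of ${\mathbf 0}$). The $n$-point processes $N_n$ *converge onto* a compact set $E$ if $P\{N_n(U^c)>0\}\to0$ for every open $U\supset E$, and $P\{N_n({\mathbf p}+\varepsilon B)>m\}\to1$ for all $m\ge1$, $\varepsilon>0$, ${\mathbf p}\in E$, where $B$ is the open Euclidean unit ball. *)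

(* Defs.v *)
From HB Require Import structures.
From mathcomp Require Import all_boot all_order all_algebra.
From mathcomp Require Import all_classical all_reals all_analysis measurable_realfun.

Set Implicit Arguments.
Unset Strict Implicit.
Unset Printing Implicit Defensive.

Import Order.TTheory GRing.Theory Num.Theory.
Import numFieldNormedType.Exports.

Local Open Scope classical_set_scope.
Local Open Scope ring_scope.

(* R^d is 'rV[R]_d. Its library topology comes from the sup norm and is the
   Euclidean one. Like the library's sigma-algebra on n.-tuple T, the one below
   is generated by the coordinate maps; it is the Borel sigma-algebra. *)
Section measurable_rV.
Variables (R : realType) (n : nat).

Let coors : 'I_n -> 'rV[R]_n -> R := fun i x => x ord0 i.

Let rV_set0 : g_sigma_preimage coors set0.
Proof. exact: sigma_algebra0. Qed.

Let rV_setC A : g_sigma_preimage coors A -> g_sigma_preimage coors (~` A).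
Proof. exact: sigma_algebraC. Qed.

Let rV_bigcup (F : (set 'rV[R]_n)^nat) :
  (forall i, g_sigma_preimage coors (F i)) ->
  g_sigma_preimage coors (\bigcup_i (F i)).
Proof. exact: sigma_algebra_bigcup. Qed.

HB.instance Definition _ := @isMeasurable.Build default_measure_display
  'rV[R]_n (g_sigma_preimage coors) rV_set0 rV_setC rV_bigcup.

End measurable_rV.

Section lebesgue_rV.
Variable R : realType.

Definition rV_cons n (p : measurableTypeR R * 'rV[R]_n) : 'rV[R]_n.+1 :=
  \row_i oapp (p.2 ord0) p.1 (unlift ord0 i).

Lemma measurable_coord n (i : 'I_n) :
  measurable_fun [set: 'rV[R]_n] (fun x : 'rV[R]_n => x ord0 i).
Proof.
move=> _ Y mY; rewrite setTI; apply: sub_sigma_algebra => /=.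
rewrite -bigcup_seq/=; exists i => /=; first by rewrite mem_index_enum.
by exists Y => //; rewrite setTI.
Qed.

Lemma measurable_rV_cons n : measurable_fun setT (@rV_cons n).
Proof.
suff mcoor : g_sigma_preimage
    (fun i => (fun x : 'rV[R]_n.+1 => x ord0 i) \o @rV_cons n) `<=` measurable.
  move=> _ A mA; rewrite setTI; apply: mcoor.
  by rewrite g_sigma_preimage_comp; exists A => //; rewrite setTI.
apply: smallest_sub; first exact: sigma_algebra_measurable.
move=> B; rewrite -bigcup_seq => -[i _ [Y mY <-]].
rewrite (_ : _ \o _ =
  fun p : measurableTypeR R * 'rV[R]_n => oapp (p.2 ord0) p.1 (unlift ord0 i)).
  case: (unlift ord0 i) => [j|] /=.
    exact: (measurableT_comp (@measurable_coord n j) measurable_snd).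
  exact: (@measurable_fst _ _ (measurableTypeR R) _).
by apply/funext => p /=; rewrite mxE.
Qed.

(* n-dimensional Lebesgue measure, as an iterated product of the library's
   one-dimensional one. *)
Fixpoint lebesgue_rV n : {measure set 'rV[R]_n -> \bar R} :=
  if n is m.+1 then
    measure_function_pushforward__canonical__measure_function_Measure
      ((@lebesgue_measure R \x^ lebesgue_rV m)%E) (@measurable_rV_cons m)
  else dirac (0 : 'rV[R]_0).

End lebesgue_rV.

Section densities.
Variable R : realType.
Local Notation mu := (@lebesgue_measure R).

Definition is_pdf1 (f : R -> R) : Prop :=
  [/\ measurable_fun setT f, (forall t, 0 <= f t) &
      (\int[mu]_t (f t)%:E = 1)%E].

Definition has_density1 (F f : R -> R) : Prop :=
  is_pdf1 f /\ forall t, (\int[mu]_(s in `]-oo, t]) (f s)%:E = (F t)%:E)%E.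

Definition is_pdf d (f : 'rV[R]_d -> R) : Prop :=
  [/\ measurable_fun setT f, (forall z, 0 <= f z) &
      (\int[lebesgue_rV R d]_z (f z)%:E = 1)%E].

Definition orthant d (x : 'rV[R]_d) : set 'rV[R]_d :=
  [set y | forall i, y ord0 i <= x ord0 i].

Definition has_density d (F f : 'rV[R]_d -> R) : Prop :=
  is_pdf f /\
  forall x, (\int[lebesgue_rV R d]_(z in orthant x) (f z)%:E = (F x)%:E)%E.

Definition has_margins d (f : 'rV[R]_d -> R) (F0 : R -> R) : Prop :=
  forall (i : 'I_d) (t : R),
    (\int[lebesgue_rV R d]_(z in [set z : 'rV[R]_d | (z ord0 i <= t)%R])
       (f z)%:E = (F0 t)%:E)%E.

Definition symmetric1 (f : R -> R) : Prop := forall t, f (- t) = f t.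

(* The library norm on row vectors is the sup norm. *)
Definition enorm d (x : 'rV[R]_d) : R := Num.sqrt (\sum_i (x ord0 i) ^+ 2).

End densities.

Section asymptotics.
Variable R : realType.

Definition regularly_varying (rho : R) (f : R -> R) : Prop :=
  (exists A : R, (forall r : R, A < r -> 0 < f r) /\ measurable_fun `]A, +oo[ f) /\
  forall t : R, 0 < t -> f (t * r) / f r @[r --> +oo] --> t `^ rho.

Definition slowly_varying : (R -> R) -> Prop := regularly_varying 0.

Definition star_shaped d (D : set 'rV[R]_d) : Prop :=
  forall z (t : R), D z -> 0 <= t < 1 -> D (t *: z).

Definition is_gauge d (D : set 'rV[R]_d) (nD : 'rV[R]_d -> R) : Prop :=
  [/\ (forall z, z != 0 -> 0 < nD z), D = [set z | nD z < 1] &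
      forall (c : R) z, 0 <= c -> nD (c *: z) = c * nD z].

Definition class_F d (lambda : R) (f : 'rV[R]_d -> R) : Prop :=
  [/\ is_pdf f, (forall z, 0 < f z), continuous f &
   exists (fs L : R -> R) (D : set 'rV[R]_d) (nD : 'rV[R]_d -> R),
    [/\ {within `[0, +oo[, continuous fs},
        (forall r s : R, 0 <= r -> r <= s -> fs s <= fs r),
        slowly_varying L /\
        (forall r : R, 0 < r -> fs r = L r / r `^ (lambda + d%:R)),
        [/\ bounded_set D, open D, D 0 & star_shaped D] /\
        (is_gauge D nD /\ continuous nD) &
        forall eps : R, 0 < eps -> \forall M \near +oo,
          forall z, M <= enorm z -> `|f z / fs (nD z) - 1| < eps]].

(* The conditions on psi only concern a neighbourhood of infinity, so that for
   instance psi s = s ^+ 2 / 2 is included. *)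
Definition von_mises (psi : R -> R) : Prop :=
  [/\ (\forall s \near +oo, derivable psi s 1 /\ derivable (psi^`())%classic s 1),
      (\forall s \near +oo, {for s, continuous (psi^`(2))%classic}),
      (\forall s \near +oo, 0 < (psi^`())%classic s),
      psi s @[s --> +oo] --> +oo &
      ((fun s => ((psi^`())%classic s)^-1)^`())%classic s @[s --> +oo] --> (0 : R)].

Definition light_tailed (g0 : R -> R) : Prop :=
  exists (psi : R -> R) (theta : R),
    [/\ von_mises psi, 0 < theta, regularly_varying theta psi &
        g0 s / expR (- psi s) @[s --> +oo] --> (1 : R)].

Definition meta_marginal (F0 G0 : R -> R) : R -> R :=
  'pinv_(fun=> 0) setT F0 \o G0.

Definition meta d (F0 G0 : R -> R) (x : 'rV[R]_d) : 'rV[R]_d :=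
  map_mx (meta_marginal F0 G0) x.

Record standard_setup d (F f : 'rV[R]_d -> R) (F0 f0 G0 g0 : R -> R)
    (G g : 'rV[R]_d -> R) : Prop := StandardSetup {
  F_density : has_density F f;
  F_class : exists2 lambda, 0 < lambda & class_F lambda f;
  F0_density : has_density1 F0 f0;
  f0_continuous : continuous f0;
  f0_gt0 : forall t, 0 < f0 t;
  f0_symmetric : symmetric1 f0;
  F_margins : has_margins f F0;
  G0_density : has_density1 G0 g0;
  g0_continuous : continuous g0;
  g0_gt0 : forall t, 0 < g0 t;
  g0_symmetric : symmetric1 g0;
  g0_tail : light_tailed g0;
  G_meta : forall x, G x = F (meta F0 G0 x);
  G_density : has_density G g
}.

(* For f in class_F the limit exists at every w != 0, but not at 0. *)
Definition tail_limit d (f : 'rV[R]_d -> R) (w : 'rV[R]_d) : R :=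
  lim (f (r *: w) / f (r *: const_mx 1) @[r --> +oo]).

End asymptotics.

Section point_processes.
Variables (R : realType) (d : nat).

Definition iid_sample dT (T : measurableType dT) (P : probability T R)
    (F : 'rV[R]_d -> R) (Z : nat -> {RV P >-> 'rV[R]_d}) : Prop :=
  (forall i x, P [set w | orthant x (Z i w)] = (F x)%:E) /\
  forall n (A : nat -> set 'rV[R]_d), (forall i, measurable (A i)) ->
    P [set w | forall i, (i < n)%N -> A i (Z i w)] =
    (\prod_(i < n) P [set w | A i (Z i w)])%E.

Definition sample_cloud (T : Type) (Z : nat -> T -> 'rV[R]_d) (a : nat -> R)
    (n : nat) (w : T) : seq 'rV[R]_d :=
  [seq (a n)^-1 *: Z i w | i <- iota 0 n].

Definition num_points (s : seq 'rV[R]_d) (A : set 'rV[R]_d) : nat :=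
  count (fun z => z \in A) s.

(* The library's poisson_pmf is constantly 1 at rate 0. *)
Definition poisson_weight (rate : R) (m : nat) : R :=
  rate ^+ m / m`!%:R * expR (- rate).

(* Poisson process on the complement of 0 with intensity rho: the Borel sets
   considered are those bounded away from 0, where the realizations are finite
   and integer-valued. *)
Record poisson_process dT (T : measurableType dT) (P : probability T R)
    (rho : 'rV[R]_d -> R) (N : T -> {measure set 'rV[R]_d -> \bar R}) : Prop :=
  PoissonProcess {
    pp_intensity : forall A, measurable A -> nbhs (0 : 'rV[R]_d) (~` A) ->
      (\int[lebesgue_rV R d]_(z in A) (rho z)%:E < +oo)%E;
    pp_count : forall w A, measurable A -> nbhs (0 : 'rV[R]_d) (~` A) ->
      exists m : nat, N w A = (m%:R)%:E;
    pp_measurable : forall A, measurable A -> nbhs (0 : 'rV[R]_d) (~` A) ->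
      measurable_fun setT (fun w => N w A);
    pp_law : forall k (A : 'I_k -> set 'rV[R]_d) (m : 'I_k -> nat),
      (forall i, measurable (A i) /\ nbhs (0 : 'rV[R]_d) (~` A i)) ->
      trivIset setT A ->
      P [set w | forall i, N w (A i) = ((m i)%:R)%:E] =
      (\prod_(i < k)
         (poisson_weight
            (fine (\int[lebesgue_rV R d]_(z in A i) (rho z)%:E)) (m i))%:E)%E
  }.

Definition bounded_continuous (U : topologicalType) (u : U -> R) : Prop :=
  continuous u /\ exists M, forall x, `|u x| <= M.

Definition cvg_in_distribution dT (T : measurableType dT) (P : probability T R)
    (X : nat -> T -> R) dT' (T' : measurableType dT') (Q : probability T' R)
    (Y : T' -> R) : Prop :=
  forall u : R -> R, bounded_continuous u ->
    ('E_P[u \o X n])%E @[n --> \oo] --> ('E_Q[u \o Y])%E.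

(* Only the distributions of the samples and of the Poisson process matter,
   so these are quantified over all their realizations. *)
Definition clouds_cvg_to_poisson (F : 'rV[R]_d -> R) (a : nat -> R)
    (rho : 'rV[R]_d -> R) : Prop :=
  forall dT (T : measurableType dT) (P : probability T R)
    (Z : nat -> {RV P >-> 'rV[R]_d}), iid_sample F Z ->
  forall dT' (T' : measurableType dT') (Q : probability T' R)
    (N : T' -> {measure set 'rV[R]_d -> \bar R}), poisson_process Q rho N ->
  forall phi : 'rV[R]_d -> R, bounded_continuous phi ->
    (\forall x \near (0 : 'rV[R]_d), phi x = 0) ->
  cvg_in_distribution P
    (fun n w => \sum_(z <- sample_cloud Z a n w) phi z)
    Q (fun w => \int[N w]_z phi z).

Definition clouds_cvg_onto (F : 'rV[R]_d -> R) (a : nat -> R)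
    (E : set 'rV[R]_d) : Prop :=
  forall dT (T : measurableType dT) (P : probability T R)
    (Z : nat -> {RV P >-> 'rV[R]_d}), iid_sample F Z ->
  (forall U : set 'rV[R]_d, open U -> E `<=` U ->
    P [set w | (0 < num_points (sample_cloud Z a n w) (~` U))%N]
      @[n --> \oo] --> 0%E) /\
  (forall (m : nat) (eps : R) p, (1 <= m)%N -> 0 < eps -> E p ->
    P [set w | (m < num_points (sample_cloud Z a n w)
                     [set x | (enorm (x - p) < eps)%R])%N]
      @[n --> \oo] --> 1%E).

Definition sign_vector (delta : 'rV[R]_d) : Prop :=
  forall i, delta ord0 i = 1 \/ delta ord0 i = -1.

Definition diagonal_cross : set 'rV[R]_d :=
  [set x | exists r delta, [/\ 0 <= r <= 1, sign_vector delta & x = r *: delta]].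

End point_processes.

(* Main.v *)
(* Replace f by ft = f * w, where w = 1 on the coordinate planes and, outside
   the unit ball, w is the indicator of K(C) for a region C shrinking onto the
   2^d diagonals; inside the ball w is a constant restoring total mass 1.

   C can be chosen so that K(C) contains, far out, every cone avoiding the
   coordinate planes: light tails of g0 and regular variation of f give, for
   all A > 0 and 0 < t < 1, A K0(t s) <= K0(s) for s large, so coordinates that
   are comparable in z-space have ratios tending to 1 in x-space. Hence ft = f
   along such cones and gt = 0 off the diagonals. As K0(b_n) = c_n, the n-point
   clouds only see f at scale c_n; a Potter-type bound on f(t w)/f(t e) and
   dominated convergence give n P(Z/c_n in A) -> c0 * int_A h for Borel A
   bounded away from 0. Poisson convergence then follows from the multinomial
   law of the counts on a partition by the level sets of the test function. *)
Require Import Defs.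
From HB Require Import structures.
From mathcomp Require Import all_boot all_order all_algebra.
From mathcomp Require Import ring lra zify.
From mathcomp Require Import all_classical all_reals all_analysis measurable_realfun.

Set Implicit Arguments.
Unset Strict Implicit.
Unset Printing Implicit Defensive.

Import Order.TTheory GRing.Theory Num.Theory.
Import numFieldNormedType.Exports.

Local Open Scope classical_set_scope.
Local Open Scope ring_scope.

(** Properties (3) and (4) pull in opposite directions: in z-space the kept region must contain, far
    out, every cone off the coordinate planes, while in x-space it must close up on the diagonals.
    It is therefore cut out in x-space by countably many tolerances [shrink m], each enforced only
    from a threshold [a m] on. No Jacobian of [K] appears: masses under [gt] are transported to
    masses under [ft] by comparing measures on orthants. The margins of [ft] need not be [F0], so
    masses under [ft] are compared with half-space masses under the original [f], which are values
    of [1 - F0]. This comparison, [mass_ratio_cvg], allows any scale tending to infinity, because it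
    serves twice: at [c n] for the Poisson limit, and at [K (r * b n)] with [r < 1] for the cross.
    In the second use a box of fixed shape in z-space becomes, in x-space, a set of small relative
    size near a diagonal, and yet carries mass of order [1 - G0 (r * b n)], which the light tail
    makes much larger than [1 / n]. *)

Section norms.
Variables (R : realType) (n : nat).
Implicit Types (z : 'rV[R]_n).

Lemma rV_norm_leP z (r : R) : 0 <= r ->
  (`|z| <= r) <-> (forall i, `|z ord0 i| <= r).
Proof.
move=> r0; rewrite (_ : `|z| = mx_norm z)// mx_normrE; split.
  by move=> /bigmax_leP[_ h] i; exact: (h (ord0, i)).
by move=> h; apply/bigmax_leP; split => // k _; rewrite (ord1 k.1); exact: h.
Qed.

Lemma rV_norm_ltP z (r : R) : 0 < r ->
  (`|z| < r) <-> (forall i, `|z ord0 i| < r).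
Proof.
move=> r0; rewrite (_ : `|z| = mx_norm z)// mx_normrE; split.
  by move=> /bigmax_ltP[_ h] i; exact: (h (ord0, i)).
by move=> h; apply/bigmax_ltP; split => // k _; rewrite (ord1 k.1); exact: h.
Qed.

Lemma rV_norm_coord z i : `|z ord0 i| <= `|z|.
Proof. exact: (proj1 (rV_norm_leP z (normr_ge0 z)) (lexx _) i). Qed.

Lemma enorm_ge0 z : 0 <= enorm z.
Proof. exact: sqrtr_ge0. Qed.

Lemma le_norm_enorm z : `|z| <= enorm z.
Proof.
apply/(rV_norm_leP _ (enorm_ge0 z)) => i; rewrite -sqrtr_sqr ler_wsqrtr//.
by rewrite (bigD1 i)//= lerDl sumr_ge0// => j _; exact: sqr_ge0.
Qed.

(** The crude constant [n] comes from [n <= n ^ 2] and avoids a square root; only the equivalence of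
    the two norms is used later. *)
Lemma le_enorm_norm z : enorm z <= n%:R * `|z|.
Proof.
rewrite -[leRHS]ger0_norm ?mulr_ge0// -sqrtr_sqr ler_wsqrtr//.
rewrite exprMn; apply: (@le_trans _ _ (\sum_(i < n) `|z| ^+ 2)).
  apply: ler_sum => i _; rewrite -real_normK ?num_real//.
  by rewrite lerXn2r ?nnegrE// rV_norm_coord.
rewrite sumr_const card_ord -[leLHS]mulr_natl ler_wpM2r ?sqr_ge0//.
by rewrite -natrX ler_nat; case: (n) => // m; rewrite -{1}(expn1 m.+1) leq_pexp2l.
Qed.

End norms.

(** * Generators of the Borel sets of row vectors *)

Section borel_rV.
Variables (R : realType) (n : nat).
Implicit Types (A : 'I_n -> set R) (x : 'rV[R]_n).

Definition rect A : set 'rV[R]_n := [set z | forall i, A i (z ord0 i)].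

Lemma measurable_coord_preimage i (Y : set R) : measurable Y ->
  measurable [set z : 'rV[R]_n | Y (z ord0 i)].
Proof.
by move=> mY; rewrite -[X in measurable X]setTI; exact: measurable_coord.
Qed.

Lemma measurable_forall_ord d (T : measurableType d) m (P : 'I_m -> set T) :
  (forall i, measurable (P i)) -> measurable [set t | forall i, P i t].
Proof.
move=> mP; rewrite (_ : [set t | _] = \big[setI/setT]_(i < m) P i).
  exact: bigsetI_measurable.
rewrite -bigcap_seq; apply/seteqP; split => t /= h i; first by move=> _; exact: h.
by apply: h; rewrite /= mem_index_enum.
Qed.

Lemma measurable_rect A : (forall i, measurable (A i)) -> measurable (rect A).
Proof.
by move=> mA; apply: measurable_forall_ord => i; exact: measurable_coord_preimage.
Qed.

Lemma measurable_fun_rV d (T : measurableType d) (f : T -> 'rV[R]_n) :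
  (forall i, measurable_fun setT (fun t => f t ord0 i)) -> measurable_fun setT f.
Proof.
move=> mf.
suff h : g_sigma_preimage (fun i => (fun x : 'rV[R]_n => x ord0 i) \o f)
   `<=` measurable.
  move=> _ A mA; rewrite setTI; apply: h.
  by rewrite g_sigma_preimage_comp; exists A => //; rewrite setTI.
apply: smallest_sub; first exact: sigma_algebra_measurable.
move=> B; rewrite -bigcup_seq => -[i _ [Y mY <-]].
exact: mf.
Qed.

Lemma measurable_rV_rect : @measurable _ 'rV[R]_n =
  <<s [set rect A | A in [set A | forall i, measurable (A i)]] >>.
Proof.
apply/seteqP; split; last first.
  apply: smallest_sub; first exact: sigma_algebra_measurable.
  by move=> _ [A mA <-]; exact: measurable_rect.
apply: smallest_sub; first exact: smallest_sigma_algebra.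
move=> B; rewrite -bigcup_seq => -[i _ [Y mY <-]].
apply: sub_sigma_algebra; exists (fun j => if j == i then Y else setT).
  by move=> j; case: ifP.
apply/seteqP; split => z /=.
  by move=> /(_ i); rewrite eqxx.
by move=> [_ Yz] j; case: ifP => [/eqP->|].
Qed.

Lemma rectI A B : rect A `&` rect B = rect (fun i => A i `&` B i).
Proof.
apply/seteqP; split => z; first by move=> [ha hb] i; split; [exact: ha|exact: hb].
by move=> h; split=> i; have [] := h i.
Qed.

Definition box (r : R) : set 'rV[R]_n := rect (fun=> `[- r, r]%classic).

Lemma rect_box_cover : \bigcup_(k in [set: nat]) box k%:R = setT.
Proof.
rewrite -subTset => z _; exists (Num.truncn `|z|).+1 => // i /=.
rewrite in_itv/= -ler_norml (le_trans (rV_norm_coord _ _))// ltW//.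
by rewrite truncnS_gt.
Qed.

Lemma measurable_orthant x : measurable (orthant x).
Proof.
rewrite (_ : orthant x = rect (fun i => `]-oo, x ord0 i]%classic)).
  by apply: measurable_rect => i; exact: measurable_itv.
by apply/seteqP; split => z h i; move: (h i); rewrite /= in_itv.
Qed.

Lemma orthantI x y : orthant x `&` orthant y =
  orthant (\row_i Num.min (x ord0 i) (y ord0 i)).
Proof.
apply/seteqP; split => z.
  by move=> [hx hy] i; rewrite mxE le_min hx hy.
by move=> h; split=> i; move: (h i); rewrite mxE le_min => /andP[].
Qed.

Lemma bigcup_orthant : \bigcup_k orthant (const_mx k%:R : 'rV[R]_n) = setT.
Proof.
rewrite -subTset => z _; exists (Num.truncn `|z|).+1 => // i /=.
rewrite mxE (le_trans (ler_norm _))// (le_trans (rV_norm_coord _ _))// ltW//.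
by rewrite truncnS_gt.
Qed.

(** A d.f. prescribes only the masses of orthants. As these generate the sigma-algebra and are
    stable under intersection ([orthantI]), it determines the whole law. *)
Lemma measurable_rV_orthant : @measurable _ 'rV[R]_n = <<s range (@orthant R n) >>.
Proof.
apply/seteqP; split; last first.
  apply: smallest_sub; first exact: sigma_algebra_measurable.
  by move=> _ [x _ <-]; exact: measurable_orthant.
apply: smallest_sub; first exact: smallest_sigma_algebra.
move=> B; rewrite -bigcup_seq => -[i _ [Y mY <-]].
pose T := g_sigma_algebraType (range (@orthant R n)).
suff mi : measurable_fun setT (fun z : T => (z : 'rV[R]_n) ord0 i) by exact: mi.
apply: (measurability _ (RGenOInfty.measurableE R)) => _ [_ [t ->] <-].
(* A closed half-space is the union of orthants whose remaining corner coordinates [k] go to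
   infinity. *)
rewrite setTI (_ : _ @^-1` _ = ~` \bigcup_k (orthant
   (\row_j (if j == i then t else k%:R)) : set T)).
  apply: measurableC; apply: bigcupT_measurable => k.
  by apply: sub_sigma_algebra; eexists.
apply/seteqP; split => z /=.
  rewrite in_itv/= andbT => tz [k _ /(_ i)]; rewrite mxE eqxx.
  by rewrite leNgt tz.
rewrite in_itv/= andbT ltNge; apply: contra_notN => zt.
have [k _ hk] : (\bigcup_k orthant (const_mx k%:R : 'rV[R]_n)) z.
  by rewrite bigcup_orthant.
exists k => // j; rewrite mxE; case: ifPn => [/eqP->//|_].
by have := hk j; rewrite mxE.
Qed.

Lemma measure_eq_orthant (m1 m2 : {measure set 'rV[R]_n -> \bar R}) :
  (forall x, m1 (orthant x) = m2 (orthant x)) ->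
  (forall x, (m1 (orthant x) < +oo)%E) ->
  forall E, measurable E -> m1 E = m2 E.
Proof.
move=> m12 m1y E mE.
apply: (measure_unique (range (@orthant R n)) (fun k => orthant (const_mx k%:R))) => //.
- exact: measurable_rV_orthant.
- by move=> _ _ [x _ <-] [y _ <-]; rewrite orthantI; eexists.
- exact: bigcup_orthant.
- by move=> _ [x _ <-].
Qed.

Lemma measure_eq_rect (m1 m2 : {measure set 'rV[R]_n -> \bar R}) :
  (forall A, (forall i, measurable (A i)) -> m1 (rect A) = m2 (rect A)) ->
  (forall k : nat, (m1 (box k%:R) < +oo)%E) ->
  forall E, measurable E -> m1 E = m2 E.
Proof.
move=> m12 m1y E mE; apply: (measure_unique
  [set rect A | A in [set A | forall i, measurable (A i)]]
  (fun k => box k%:R)) => //.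
- exact: measurable_rV_rect.
- move=> _ _ [X mX <-] [Y mY <-]; exists (fun i => X i `&` Y i); last by rewrite rectI.
  by move=> i; exact: measurableI.
- by move=> k; eexists; [|reflexivity] => i; exact: measurable_itv.
- exact: rect_box_cover.
- by move=> _ [x ? <-]; exact: m12.
Qed.

Lemma measurable_rV_ball x (r : R) : measurable [set z : 'rV[R]_n | `|z - x| < r].
Proof.
have [r0|r0] := ltP 0 r; last first.
  rewrite (_ : mkset _ = set0)//; apply/seteqP; split => z //=.
  by move=> /(le_lt_trans (normr_ge0 _)); rewrite ltNge r0.
rewrite (_ : mkset _ = rect (fun i => `]x ord0 i - r, x ord0 i + r[%classic)).
  by apply: measurable_rect => i; exact: measurable_itv.
apply/seteqP; split => z /=.
  move=> /(rV_norm_ltP _ r0) h i; have := h i.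
  by rewrite !mxE /= in_itv/= ltr_distl.
move=> h; apply/(rV_norm_ltP _ r0) => i; have := h i.
by rewrite !mxE /= in_itv/= ltr_distl.
Qed.

(** An open set is the union of those sup-norm balls with rational centre and radius [1 / k.+1] that
    it contains, and these are countably many. *)
Lemma open_measurable_rV (U : set 'rV[R]_n) : open U -> measurable U.
Proof.
move=> oU; pose c (p : 'rV[rat]_n * nat) : set 'rV[R]_n :=
  [set z | `|z - map_mx ratr p.1| < p.2.+1%:R^-1].
rewrite (_ : U = \bigcup_p (if `[< c p `<=` U >] then c p else set0)).
  apply: countable_bigcupT_measurable => // p.
  by case: ifP => // _; exact: measurable_rV_ball.
apply/seteqP; split => [z Uz|z [p _]]; last by case: asboolP => // + cz; exact.
have /nbhs_ballP[e /= e0 he] : nbhs z U by exact: open_nbhs_nbhs.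
(* The factor 2 pays for two distances: from [z] to the rational centre and from the centre to any
   [y] of the small ball. *)
have [k hk] : exists k : nat, 2 * k.+1%:R^-1 < e.
  exists (Num.truncn (2 / e)); rewrite ltr_pdivrMr// -ltr_pdivrMl//.
  by rewrite mulrC truncnS_gt.
have hq i : exists q : rat, `|z ord0 i - ratr q| < k.+1%:R^-1.
  have [|q] := @rat_in_itvoo R (z ord0 i - k.+1%:R^-1) (z ord0 i + k.+1%:R^-1).
    by rewrite ltrD2l gtrN ?invr_gt0.
  by rewrite in_itv/= -ltr_distl distrC => ?; exists q.
pose q := \row_i projT1 (cid (hq i)).
have zq : c (q, k) z.
  apply/rV_norm_ltP => [|i]; first by rewrite invr_gt0.
  by rewrite !mxE; exact: (projT2 (cid (hq i))).
exists (q, k) => //; case: asboolP => // -[] y cy; apply: he.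
rewrite -ball_normE /ball_/= (le_lt_trans _ hk)//.
rewrite (_ : z - y = (z - map_mx ratr q) - (y - map_mx ratr q)); last first.
  by rewrite opprB addrA subrK.
by rewrite (le_trans (ler_normB _ _))// mulr_natl mulr2n lerD// ltW.
Qed.

Lemma continuous_measurable_rV (f : 'rV[R]_n -> R) : continuous f -> measurable_fun setT f.
Proof.
move=> cf; apply: (measurability _ (RGenOInfty.measurableE R)) => _ [_ [t ->] <-].
by rewrite setTI; apply: open_measurable_rV; apply: open_comp.
Qed.

End borel_rV.

(** * Lebesgue measure on row vectors: scaling and hyperplanes *)

Section lebesgue_rV_theory.
Variable R : realType.
Local Notation mu := (@lebesgue_measure R).

Lemma lebesgue_rV_rect n (A : 'I_n -> set R) : (forall i, measurable (A i)) ->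
  lebesgue_rV R n (rect A) = (\prod_(i < n) mu (A i))%E.
Proof.
elim: n A => [|n IH] A mA.
  rewrite big_ord0 /= diracE mem_set//; by case.
rewrite big_ord_recl.
have E : @rV_cons R n @^-1` rect A = A ord0 `*` rect (fun i => A (lift ord0 i)).
  apply/seteqP; split => -[x z] /=.
    move=> h; split=> /=.
      by have := h ord0; rewrite mxE unlift_none.
    by move=> i; have := h (lift ord0 i); rewrite mxE liftK.
  by move=> [hx hz] i; rewrite mxE; case: unliftP => [j|] ->.
rewrite /= /pushforward E.
rewrite product_measure2E; [by rewrite IH|exact: mA|exact: measurable_rect].
Qed.

(** Uniqueness of Lebesgue measure: its image under multiplication by [s], weighted by [s], still
    gives half-open intervals their length. *)
Lemma lebesgue_measure_scale (s : R) (A : set R) : 0 < s -> measurable A ->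
  mu [set t | A (s * t)] = (s^-1%:E * mu A)%E.
Proof.
move=> s0 mA.
have ms : measurable_fun setT (fun t : measurableTypeR R => s * t : measurableTypeR R).
  exact: (@measurable_funM _ _ R setT (cst s) id).
pose m : {measure set (measurableTypeR R) -> \bar R} := mscale (NngNum (ltW s0))
  (measure_function_pushforward__canonical__measure_function_Measure mu ms).
have -> : mu A = m A.
  apply: (@lebesgue_measure_unique R m) => // _ [[a b] _ <-].
  pose B := [set t | `]a, b]%classic (s * t)].
  rewrite (_ : m _ = (s%:E * mu B)%E)// (_ : B = `]s^-1 * a, s^-1 * b]%classic); last first.
    apply/seteqP; split => t /=; rewrite !in_itv/=;
    by rewrite [_ * a]mulrC [_ * b]mulrC ltr_pdivrMr// ler_pdivlMr// mulrC.
  rewrite !lebesgue_measure_itv/= !lte_fin ltr_pM2l ?invr_gt0//.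
  case: ifPn => ab; last by rewrite mule0.
  by rewrite -!EFinB -EFinM -mulrBr mulrA divff ?gt_eqF// mul1r.
by rewrite /m /mscale/= muleA -EFinM mulVf ?gt_eqF// mul1e.
Qed.

Lemma measurable_scale n (s : R) : measurable_fun setT (fun z : 'rV[R]_n => s *: z).
Proof.
apply: measurable_fun_rV => i.
under eq_fun do rewrite mxE.
by apply: measurable_funM => //; exact: measurable_coord.
Qed.

Lemma measurable_scale_set n (s : R) (A : set 'rV[R]_n) : measurable A ->
  measurable [set z | A (s *: z)].
Proof. by move=> mA; rewrite -[X in measurable X]setTI; exact: measurable_scale. Qed.

Lemma lebesgue_rV_box n (r : R) : 0 <= r ->
  lebesgue_rV R n (box r) = ((2 * r) ^+ n)%:E.
Proof.
move=> r0; rewrite lebesgue_rV_rect; last by move=> i; exact: measurable_itv.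
rewrite (eq_bigr (fun=> (2 * r)%:E)); first by rewrite prodEFin prodr_const card_ord.
move=> i _; rewrite lebesgue_measure_itv/= lte_fin; case: ifPn => [_|].
  by rewrite -EFinB opprK mulr2n mulrDl mul1r.
rewrite -leNgt => h; have r00 : r = 0 by lra.
by rewrite r00 mulr0.
Qed.

(** Both sides are measures in [A], so rectangles suffice; there the one-dimensional factors [s^-1]
    multiply up. *)
Lemma lebesgue_rV_scale n (s : R) (A : set 'rV[R]_n) : 0 < s -> measurable A ->
  lebesgue_rV R n [set z | A (s *: z)] = ((s ^- n)%:E * lebesgue_rV R n A)%E.
Proof.
move=> s0 mA.
pose m := measure_function_pushforward__canonical__measure_function_Measure
  (lebesgue_rV R n) (@measurable_scale n s).
have sn0 : 0 <= s ^- n by rewrite invr_ge0 exprn_ge0// ltW.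
pose m' : {measure set 'rV[R]_n -> \bar R} := mscale (NngNum sn0) (lebesgue_rV R n).
suff h : m A = m' A by exact: h.
apply: measure_eq_rect => // [B mB|k].
  pose B' i := [set t | B i (s * t)].
  have mB' i : measurable (B' i).
    rewrite -[X in measurable X]setTI.
    by apply: (@measurable_funM _ _ R setT (cst s) id).
  transitivity (lebesgue_rV R n (rect B')).
    rewrite /m /= /pushforward; congr (lebesgue_rV R n _).
    by apply/seteqP; split => z h i; have := h i; rewrite ?mxE.
  transitivity ((s ^- n)%:E * lebesgue_rV R n (rect B))%E; last by [].
  rewrite !lebesgue_rV_rect//.
  under eq_bigr do rewrite lebesgue_measure_scale//.
  by rewrite big_split/= prodEFin prodr_const card_ord exprVn.
rewrite (_ : m _ = lebesgue_rV R n (box (s^-1 * k%:R))); last first.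
  rewrite /m /= /pushforward; congr (lebesgue_rV R n _).
  apply/seteqP; split => z h i; have := h i; rewrite /= !in_itv/= ?mxE -!ler_norml;
  by rewrite normrM gtr0_norm// [_^-1 * _]mulrC ler_pdivlMr// mulrC.
by rewrite lebesgue_rV_box ?ltry// mulr_ge0// invr_ge0 ltW.
Qed.

Lemma integral_rV_scale n (s : R) (A : set 'rV[R]_n) (f : 'rV[R]_n -> \bar R) :
  0 < s -> measurable A -> measurable_fun setT f -> (forall z, (0 <= f z)%E) ->
  (\int[lebesgue_rV R n]_(z in A) f z =
   (s ^+ n)%:E * \int[lebesgue_rV R n]_(w in [set w | A (s *: w)]) f (s *: w))%E.
Proof.
move=> s0 mA mf f0.
rewrite -(@ge0_integral_pushforward _ _ _ _ R _ (@measurable_scale n s)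
   (lebesgue_rV R n) A f)//; last exact: measurable_funTS.
have sn0 : 0 <= s ^- n by rewrite invr_ge0 exprn_ge0// ltW.
rewrite (_ : (\int[pushforward _ _]_(z in A) f z)%E =
   (\int[mscale (NngNum sn0) (lebesgue_rV R n)]_(z in A) f z)%E).
  rewrite ge0_integral_mscale//=; last exact: measurable_funTS.
  by rewrite muleA -EFinM divff ?mul1e// expf_neq0// gt_eqF.
apply: (@eq_measure_integral _ _ _ _ (mscale (NngNum sn0) (lebesgue_rV R n))
  (measure_function_pushforward__canonical__measure_function_Measure
  (lebesgue_rV R n) (@measurable_scale n s))) => B mB _.
exact: lebesgue_rV_scale.
Qed.

Lemma lebesgue_rV_hyperplane n (i : 'I_n) (t : R) :
  lebesgue_rV R n [set z | z ord0 i = t] = 0.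
Proof.
transitivity (lebesgue_rV R n (rect (fun j => if j == i then [set t] else setT))).
  congr (lebesgue_rV R n _); apply/seteqP; split => z /=.
    by move=> zt j; case: ifP => // /eqP ->.
  by move=> /(_ i); rewrite eqxx.
rewrite lebesgue_rV_rect; last by move=> j; case: ifP => // _; exact: measurable_set1.
by rewrite (bigD1 i)//= eqxx lebesgue_measure_set1 mul0e.
Qed.

End lebesgue_rV_theory.

(** * Densities and distribution functions *)

Section density_measure.
Context d (T : measurableType d) (R : realType).
Variable mu : {measure set T -> \bar R}.

(** A positive function with zero integral would vanish almost everywhere on [A], which would make
    [A] null. *)
Lemma integral_EFin_gt0 (f : T -> R) (A : set T) : measurable A ->
  measurable_fun A f -> (forall x, A x -> 0 < f x) -> (0 < mu A)%E ->
  (0 < \int[mu]_(x in A) (f x)%:E)%E.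
Proof.
move=> mA mf f0 muA; rewrite lt0e integral_ge0 ?andbT; last first.
  by move=> x /f0 fx; rewrite lee_fin ltW.
apply/negP => /eqP int0.
have /(ae_eq_integral_abs mu mA) : measurable_fun A (EFin \o f).
  exact/measurable_EFinP.
move=> [h _]; have {}h : ae_eq mu A (EFin \o f) (cst 0%E).
  apply: h; rewrite -[RHS]int0; apply: eq_integral => x /[!inE] Ax /=.
  by rewrite gtr0_norm// f0.
case: h => N [mN N0 hN]; suff : (mu A <= mu N)%E by rewrite N0 leNgt muA.
apply: le_measure; rewrite ?inE// => x Ax; apply: hN => /= /(_ Ax) [fx0].
by have := f0 _ Ax; rewrite fx0 ltxx.
Qed.

Variable f : T -> R.

(** The two proofs are arguments so that the measure structure declared below can be inferred from
    the term itself. *)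
Definition density_measure of measurable_fun setT f & (forall x, 0 <= f x) :=
  fun A => (\int[mu]_(x in A) (f x)%:E)%E.

Variables (mf : measurable_fun setT f) (f0 : forall x, 0 <= f x).
Local Notation nu := (density_measure mf f0).

Let nu0 : nu set0 = 0%E. Proof. exact: integral_set0. Qed.

Let nu_ge0 A : (0 <= nu A)%E.
Proof. by apply: integral_ge0 => x _; rewrite lee_fin. Qed.

Let nu_sigma_additive : semi_sigma_additive nu.
Proof.
move=> F mF tF mUF; rewrite /density_measure ge0_integral_bigcup//.
- by apply: is_cvg_ereal_nneg_natsum_cond => n _ _; exact: nu_ge0.
- by apply/measurable_EFinP; exact: measurable_funTS.
- by move=> x _; rewrite lee_fin.
Qed.

HB.instance Definition _ := isMeasure.Build _ _ _ nu nu0 nu_ge0 nu_sigma_additive.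

Lemma density_measureE A : nu A = (\int[mu]_(x in A) (f x)%:E)%E.
Proof. by []. Qed.

End density_measure.

Section cdf_facts.
Variables (R : realType) (F f : R -> R).
Hypotheses (Ff : has_density1 F f) (cf : continuous f) (f_gt0 : forall t, 0 < f t).
Hypothesis f_sym : symmetric1 f.
Local Notation mu := (@lebesgue_measure R).

Let mf : measurable_fun setT f. Proof. by case: Ff => -[]. Qed.
Let f0 t : 0 <= f t. Proof. by case: Ff => -[]. Qed.
Let nu := density_measure mu mf f0.

Let nuT : nu setT = 1%E. Proof. by case: Ff => -[]. Qed.

Let nu_cdf t : nu `]-oo, t] = (F t)%:E. Proof. by case: Ff => _; exact. Qed.

Lemma integral_ccdf t : (\int[mu]_(s in `]t, +oo[) (f s)%:E = (1 - F t)%:E)%E.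
Proof.
have : nu setT = (nu `]-oo, t] + nu `]t, +oo[)%E.
  rewrite -measureU ?setUv//; last by rewrite -setCitvl setICr.
  by rewrite -setCitvl setUv.
rewrite nuT nu_cdf /nu density_measureE => h.
by rewrite EFinB h addeAC subee// add0e.
Qed.

Lemma cdf_itv s t : s <= t -> nu `]s, t] = (F t - F s)%:E.
Proof.
move=> st; have : nu `]-oo, t] = (nu `]-oo, s] + nu `]s, t])%E.
  rewrite -measureU//; last first.
    apply/seteqP; split => x //= -[]; rewrite !in_itv/= => xs /andP[sx _].
    by move: (lt_le_trans sx xs); rewrite ltxx.
  by rewrite -itv_bndbnd_setU// bnd_simp.
by rewrite !nu_cdf EFinB => ->; rewrite addeAC subee// add0e.
Qed.

Lemma cdf_increasing : {homo F : s t / s < t}.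
Proof.
move=> s t st; rewrite -subr_gt0 -lte_fin -cdf_itv ?(ltW st)//.
rewrite /nu density_measureE; apply: integral_EFin_gt0 => //.
  exact: measurable_funTS.
by rewrite [X in (_ < X)%E]lebesgue_measure_itv/= lte_fin st -EFinB lte_fin subr_gt0.
Qed.

Lemma cdf_lt : {mono F : s t / s < t}.
Proof. exact: leW_mono (le_mono cdf_increasing). Qed.

Lemma cdf_le : {mono F : s t / s <= t}.
Proof. exact: (le_mono cdf_increasing). Qed.

(** Reflection preserves the density and Lebesgue measure. It yields a closed endpoint at [t] where
    [integral_ccdf] has an open one; the single point is null. *)
Lemma cdfN t : F (- t) = 1 - F t.
Proof.
apply: EFin_inj; rewrite -integral_ccdf -nu_cdf /nu density_measureE.
rewrite (_ : `]-oo, - t]%classic = (-%R : _ -> measurableTypeR R) @^-1` `[t, +oo[); last first.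
  by rewrite opp_preimage_itvbndy.
transitivity (\int[mu]_(x in (-%R : _ -> measurableTypeR R) @^-1` `[t, +oo[)
   ((EFin \o f) \o (-%R : measurableTypeR R -> measurableTypeR R)) x)%E.
  by apply: eq_integral => x _ /=; rewrite f_sym.
rewrite -ge0_integral_pushforward//; last first.
- by move=> x _; rewrite /= lee_fin.
- by apply/measurable_EFinP; exact: measurable_funTS.
rewrite (@eq_measure_integral _ _ _ _ mu); last first.
  by move=> A mA _; exact: lebesgue_measureN.
rewrite [RHS]integral_itv_obnd_cbnd//.
by apply/measurable_EFinP; exact: measurable_funTS.
Qed.

Lemma cdf_continuous : continuous F.
Proof.
move=> x.
(* The fundamental theorem of calculus makes [F] differentiable at [x]; the bound [x + 1] keeps [x]
   interior. *)
have intf : mu.-integrable `]-oo, x + 1] (EFin \o f).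
  apply: integrableS (_ : _.-integrable setT _) => //.
  apply/integrableP; split; first exact/measurable_EFinP.
  under eq_integral do rewrite /= ger0_norm//.
  by case: Ff => -[_ _ ->] _; rewrite ltry.
have xx1 : x < x + 1 by rewrite ltrDl.
have fx : {for x, continuous f} by exact: cf.
have [] := continuous_FTC1 xx1 intf (ltNyr _) fx.
move=> /derivable1_diffP/differentiable_continuous + _.
rewrite (_ : (fun _ => _) = F)//; apply/funext => t.
by rewrite /Rintegral -[X in fine X]/(nu `]-oo, t]) nu_cdf.
Qed.

Lemma cdf_lt1 t : F t < 1.
Proof.
rewrite -subr_gt0 -lte_fin -integral_ccdf; apply: integral_EFin_gt0 => //.
  exact: measurable_funTS.
by rewrite [X in (_ < X)%E]lebesgue_measure_itv/= !ltry.
Qed.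

Lemma cdf_gt0 t : 0 < F t.
Proof. by have := cdf_lt1 (- t); rewrite cdfN; lra. Qed.

Lemma cdf_near1 y : y < 1 -> exists t, y < F t.
Proof.
move=> y1.
have h : nu `]-oo, n%:R] @[n --> \oo] --> nu (\bigcup_n `]-oo, n%:R]%classic).
  apply: (nondecreasing_cvg_mu (mu := nu)) => //.
    exact: bigcup_measurable.
  move=> m n mn; rewrite subsetEset; apply: subset_itvl; rewrite bnd_simp.
  by rewrite ler_nat.
rewrite (_ : \bigcup_n _ = setT) in h; last first.
  rewrite -subTset => x _; exists (Num.truncn x).+1 => //=.
  by rewrite in_itv/= ltW// truncnS_gt.
rewrite nuT in h.
have /fine_cvgP[_ h2] : (F n%:R)%:E @[n --> \oo] --> 1%:E.
  by under eq_fun do rewrite -nu_cdf.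
have [n _ hn] := cvgr_gt _ h2 _ y1.
by exists n%:R; exact: (hn n (leqnn n)).
Qed.

Lemma cdf_surj y : 0 < y < 1 -> exists t, F t = y.
Proof.
move=> /andP[y0 y1]; have [t ht] := cdf_near1 y1.
(* By symmetry, reflecting a point where [F] exceeds [1 - y] gives a point where [F] is below
   [y]. *)
have [|s hs] := @cdf_near1 (1 - y); first by lra.
have sy : F (- s) < y by rewrite cdfN; lra.
have st : - s <= t by rewrite -cdf_le ltW// (lt_trans sy).
have cF : {within `[- s, t], continuous F}.
  by apply: continuous_subspaceT => x; exact: cdf_continuous.
have yst : Num.min (F (- s)) (F t) <= y <= Num.max (F (- s)) (F t).
  by rewrite min_l ?max_r ?cdf_le// !ltW.
by have [x _ <-] := IVT st cF yst; exists x.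
Qed.

End cdf_facts.

(** * The meta transformation of the margins *)

Section tails.
Variable R : realType.
Local Notation mu := (@lebesgue_measure R).

Lemma near_pinfty_scale (t : R) (P : R -> Prop) : 0 < t ->
  (\forall s \near +oo, P s) -> \forall s \near +oo, P (t * s).
Proof.
move=> t0 [M [_ hM]]; exists (t^-1 * M); split; first exact: num_real.
by move=> s Ms; apply: hM; rewrite -ltr_pdivrMl.
Qed.

Lemma integral_scale1 (s : R) (A : set R) (f : R -> \bar R) :
  0 < s -> measurable A -> measurable_fun setT f -> (forall z, (0 <= f z)%E) ->
  (\int[mu]_(z in A) f z =
   s%:E * \int[mu]_(w in [set w | A (s * w)%R]) f (s * w)%R)%E.
Proof.
move=> s0 mA mf f0.
have ms : measurable_fun setT (fun t : measurableTypeR R => s * t : measurableTypeR R).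
  exact: (@measurable_funM _ _ R setT (cst s) id).
rewrite -(@ge0_integral_pushforward _ _ _ _ R _ ms mu A f)//; last exact: measurable_funTS.
have sn0 : 0 <= s^-1 by rewrite invr_ge0 ltW.
transitivity (s%:E * \int[mscale (NngNum sn0) mu]_(z in A) f z)%E.
  rewrite ge0_integral_mscale//=; last exact: measurable_funTS.
  by rewrite muleA -EFinM divff ?mul1e// gt_eqF.
congr (_ * _)%E.
apply: (@eq_measure_integral _ _ _ _ 
  (measure_function_pushforward__canonical__measure_function_Measure mu ms)) => B mB _.
by rewrite /= /pushforward /mscale/= -lebesgue_measure_scale.
Qed.

(** Regular variation gives [psi (t * s) <= q * psi s] with [q < 1]. Hence [psi s - psi (t * s)] is
    at least [(1 - q) * psi s], which tends to infinity, and the exponentials separate by any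
    prescribed factor. *)
Lemma light_tailed_ratio (g : R -> R) (t eps : R) : light_tailed g ->
  0 < t < 1 -> 0 < eps -> \forall s \near +oo, g s <= eps * g (t * s).
Proof.
move=> [psi [theta [[_ _ _ psiy _] theta0 [_ psit] gpsi]]] /andP[t0 t1] eps0.
have tth : t `^ theta < 1.
  by rewrite /powR gt_eqF// -expR0 ltr_expR pmulr_rlt0// ln_lt0// t0.
(* The midpoint lies strictly above the limit of [psi (t * s) / psi s] and strictly below 1. *)
pose q := (t `^ theta + 1) / 2.
have tq : t `^ theta < q by rewrite /q; lra.
have q1 : q < 1 by rewrite /q; lra.
(* The 4 absorbs the two factors 2 lost in comparing [g] with [expR (- psi _)] at [s] and at
   [t * s]. *)
pose B := ln (4 / eps).
have h1 : \forall s \near +oo, psi (t * s) / psi s < q.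
  exact: (cvgr_lt _ (psit t t0) _ tq).
have h2 : \forall s \near +oo, Num.max 1 (B / (1 - q)) < psi s.
  by move/cvgryPgt : psiy => /(_ (Num.max 1 (B / (1 - q)))).
have h3 : \forall s \near +oo, g s / expR (- psi s) < 2.
  by apply: (cvgr_lt _ gpsi); rewrite ltr1n.
have h4 : \forall s \near +oo, 2^-1 < g (t * s) / expR (- psi (t * s)).
  apply: (near_pinfty_scale t0 (P := fun s => 2^-1 < g s / expR (- psi s))).
  by apply: (cvgr_gt _ gpsi); lra.
near=> s.
have : psi (t * s) / psi s < q by near: s.
have : Num.max 1 (B / (1 - q)) < psi s by near: s.
rewrite gt_max => /andP[psi1 Bpsi].
rewrite ltr_pdivrMr; last by lra.
move=> psiq.
have : g s / expR (- psi s) < 2 by near: s.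
rewrite ltr_pdivrMr ?expR_gt0// => gs.
have : 2^-1 < g (t * s) / expR (- psi (t * s)) by near: s.
rewrite ltr_pdivlMr ?expR_gt0// => gts.
have e4 : expR (- psi s) <= eps / 4 * expR (- psi (t * s)).
  have -> : eps / 4 = expR (- B).
    by rewrite expRN lnK ?invf_div// posrE divr_gt0.
  rewrite -expRD ler_expR.
  have : B <= psi s * (1 - q) by rewrite -ler_pdivrMr ?ltW//; lra.
  by lra.
apply: (le_trans (ltW gs)).
apply: (@le_trans _ _ (2 * (eps / 4 * expR (- psi (t * s))))).
  by rewrite ler_wpM2l.
rewrite (_ : 2 * _ = eps * (2^-1 * expR (- psi (t * s)))); last by field.
by rewrite ler_wpM2l ?ltW.
Unshelve. all: by end_near. Qed.

Lemma light_tailed_ccdf (G g : R -> R) (t eps : R) :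
  has_density1 G g -> light_tailed g ->
  0 < t < 1 -> 0 < eps -> \forall s \near +oo, 1 - G s <= eps * (1 - G (t * s)).
Proof.
move=> Gg lg t01 eps0; have t0 : 0 < t by case/andP: t01.
have [[mg g0 _] _] := Gg.
(* The pointwise bound is taken with [eps * t]: the substitution turning the tail from [t * s] into
   a tail from [s] brings the Jacobian [t]. *)
have [M [Mr hM]] := light_tailed_ratio lg t01 (mulr_gt0 eps0 t0).
exists M; split => // s Ms.
rewrite -lee_fin EFinM -!(integral_ccdf Gg).
rewrite (@integral_scale1 t `]t * s, +oo[%classic)//; last first.
  exact/measurable_EFinP.
have E : [set w | `]t * s, +oo[%classic (t * w)] = `]s, +oo[%classic.
  by apply/seteqP; split => w /=; rewrite !in_itv/= !andbT ltr_pM2l.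
rewrite E muleA -EFinM -ge0_integralZl//; last 3 first.
- apply/measurable_EFinP; apply: measurable_funTS.
  by apply: measurableT_comp => //; exact: measurable_funM.
- by move=> *; rewrite lee_fin.
- by rewrite lee_fin mulr_ge0// ltW.
apply: ge0_le_integral => //.
- by move=> *; rewrite lee_fin.
- by apply/measurable_EFinP; exact: measurable_funTS.
- apply: emeasurable_funM => //; apply/measurable_EFinP; apply: measurable_funTS.
  by apply: measurableT_comp => //; exact: measurable_funM.
move=> x /=; rewrite in_itv/= andbT => sx.
by rewrite -EFinM lee_fin hM// (lt_trans Ms).
Qed.

End tails.

Section meta_marginal_facts.
Variable R : realType.

Definition regular_cdf (F f : R -> R) : Prop :=
  [/\ has_density1 F f, continuous f, (forall t, 0 < f t) & symmetric1 f].

(** The values of [G] lie in the open unit interval, which is the range of [F], so the default value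
    of the partial inverse is never taken. *)
Lemma meta_marginal_cdf (F f G g : R -> R) s :
  regular_cdf F f -> regular_cdf G g -> F (meta_marginal F G s) = G s.
Proof.
move=> [Ff cf f0 fs] [Gg cg g0 gs]; rewrite /meta_marginal /= pinvK// inE.
have [|t <-] := cdf_surj Ff cf f0 fs (y := G s); last by exists t.
by rewrite (cdf_gt0 Gg g0 gs) (cdf_lt1 Gg g0).
Qed.

Variables (F f G g : R -> R).
Hypotheses (rF : regular_cdf F f) (rG : regular_cdf G g).
Local Notation K := (meta_marginal F G).
Local Notation L := (meta_marginal G F).

Let Fle : {mono F : s t / s <= t}.
Proof. by case: rF => Ff _ f0 _; exact: (cdf_le Ff f0). Qed.

Let Gle : {mono G : s t / s <= t}.
Proof. by case: rG => Ff _ f0 _; exact: (cdf_le Ff f0). Qed.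

Lemma meta_marginal_le : {mono K : s t / s <= t}.
Proof.
by move=> s t; rewrite -Fle !(meta_marginal_cdf _ rF rG) Gle.
Qed.

Lemma meta_marginal_lt : {mono K : s t / s < t}.
Proof. exact: (leW_mono meta_marginal_le). Qed.

(** The inverse of the marginal transformation is the same construction with the two d.f.s
    exchanged, so every lemma on [K] also holds for [L]. *)
Lemma meta_marginalK : cancel K L.
Proof.
move=> s; apply: (inc_inj Gle).
by rewrite (meta_marginal_cdf _ rG rF) (meta_marginal_cdf _ rF rG).
Qed.

Lemma meta_marginalN s : K (- s) = - K s.
Proof.
apply: (inc_inj Fle); rewrite (meta_marginal_cdf _ rF rG).
have [Ff cf f0 fs] := rF; have [Gg cg g0 gs] := rG.
by rewrite (cdfN Ff fs) (cdfN Gg gs) (meta_marginal_cdf _ rF rG).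
Qed.

Lemma meta_marginal0 : K 0 = 0.
Proof. by have := meta_marginalN 0; rewrite oppr0 => h; lra. Qed.

Lemma meta_marginal_norm s : `|K s| = K `|s|.
Proof.
have [s0|s0] := leP 0 s; first by rewrite !ger0_norm// -meta_marginal0 meta_marginal_le.
by rewrite !ltr0_norm ?meta_marginalN// -meta_marginal0 meta_marginal_lt.
Qed.

Lemma measurable_meta_marginal : measurable_fun setT K.
Proof.
apply: nondecreasing_measurable => // s t; by rewrite meta_marginal_le.
Qed.

End meta_marginal_facts.

Section meta_marginal_tail.
Variables (R : realType) (F f G g : R -> R).
Hypotheses (rF : regular_cdf F f) (rG : regular_cdf G g).
Local Notation K := (meta_marginal F G).
Local Notation L := (meta_marginal G F).

Lemma meta_marginal_cvgy : K s @[s --> +oo] --> +oo.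
Proof.
apply/cvgryPge => A; exists (L A); split; first exact: num_real.
by move=> s /ltW; rewrite -(meta_marginal_le rF rG) (meta_marginalK rG rF).
Qed.

(** The tail of [F] at [K s] is that of [G] at [s], eventually at most [c] times that of [G] at
    [t * s], i.e. of [F] at [K (t * s)]. The hypothesis on [F] bounds this by its tail at
    [A * K (t * s)], and [F] is increasing. *)
Lemma meta_marginal_rapid (A t : R) : light_tailed g -> 0 < t < 1 ->
  (exists2 c, 0 < c & \forall s \near +oo, c * (1 - F s) <= 1 - F (A * s)) ->
  \forall s \near +oo, A * K (t * s) <= K s.
Proof.
move=> lg t01 [c c0 hc]; have t0 : 0 < t by case/andP: t01.
have [Ff _ f0 _] := rF; have [Gg _ _ _] := rG.
have h1 := light_tailed_ccdf Gg lg t01 c0.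
have h2 : \forall s \near +oo, c * (1 - F (K (t * s))) <= 1 - F (A * K (t * s)).
  apply: (near_pinfty_scale t0
    (P := fun s => c * (1 - F (K s)) <= 1 - F (A * K s))).
  exact: (meta_marginal_cvgy hc).
near=> s.
rewrite -(cdf_le Ff f0) (meta_marginal_cdf _ rF rG).
have : 1 - G s <= c * (1 - G (t * s)) by near: s.
have : c * (1 - F (K (t * s))) <= 1 - F (A * K (t * s)) by near: s.
rewrite (meta_marginal_cdf _ rF rG) => h3 h4.
by have := le_trans h4 h3; lra.
Unshelve. all: by end_near. Qed.

End meta_marginal_tail.

(** * Counts of a sample and their Poisson limit *)

Lemma bigcup_ord (T : Type) n (B : 'I_n -> set T) :
  \bigcup_j B j = \big[setU/set0]_(j < n) B j.
Proof.
rewrite -bigcup_seq; apply/seteqP; split => t [j _ Bj]; exists j => //=.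
by rewrite mem_index_enum.
Qed.

Section multinomial.
Variables (R : realType) (J : nat).
Implicit Types (m : 'I_J -> nat) (p : 'I_J -> R).

(** The multinomial probability written with a falling factorial: it vanishes when the [m j] sum to
    more than [n], so the truncated exponent is harmless, and each factor has its own limit in the
    Poisson regime. *)
Definition multinomial_weight p (q : R) n m : R :=
  (n ^_ (\sum_j m j))%:R * (\prod_j (p j ^+ m j / (m j)`!%:R)) * q ^+ (n - \sum_j m j).

Definition decr m (j : 'I_J) : 'I_J -> nat := fun i => (m i - (i == j))%N.

Lemma sum_decr m j : (0 < m j)%N -> (\sum_i decr m j i = (\sum_i m i).-1)%N.
Proof.
move=> mj; rewrite (bigD1 j)//= [in RHS](bigD1 j)//= /decr eqxx.
rewrite (eq_bigr m); last by move=> i /negbTE->; rewrite subn0.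
by case: (m j) mj => // k _; rewrite subn1 addSn.
Qed.

Lemma prod_decr p m j : (0 < m j)%N ->
  p j * \prod_i (p i ^+ decr m j i / (decr m j i)`!%:R) =
  (m j)%:R * \prod_i (p i ^+ m i / (m i)`!%:R).
Proof.
move=> mj; rewrite (bigD1 j)//= [in RHS](bigD1 j)//= /decr eqxx.
rewrite (eq_bigr (fun i => p i ^+ m i / (m i)`!%:R)); last first.
  by move=> i /negbTE->; rewrite subn0.
rewrite !mulrA; congr (_ * _); case: (m j) mj => // k _.
rewrite subn1/= factS natrM exprS.
have k0 : k`!%:R != 0 :> R by rewrite pnatr_eq0 -lt0n fact_gt0.
have k1 : k.+1%:R != 0 :> R by rewrite pnatr_eq0.
by field; rewrite k0 nat1r k1.
Qed.

(** This mirrors conditioning on one further point, which falls either outside all cells or in some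
    cell [j]. Algebraically it is the recursion of falling factorials in [n]. *)
Lemma multinomial_weightS p q n m :
  multinomial_weight p q n.+1 m = q * multinomial_weight p q n m +
  \sum_(j | (0 < m j)%N) p j * multinomial_weight p q n (decr m j).
Proof.
rewrite /multinomial_weight; set k := (\sum_j m j)%N.
set W := \prod_j (p j ^+ m j / _).
rewrite (eq_bigr (fun j => (m j)%:R * ((n ^_ k.-1)%:R * W * q ^+ (n - k.-1)))); last first.
  move=> j mj; rewrite sum_decr// -/k; have := prod_decr p mj; rewrite -/W.
  set Y := \prod_i (_ / (decr m j i)`!%:R) => h.
  by rewrite mulrA mulrCA h; ring.
rewrite -mulr_suml (_ : \sum_(j | (0 < m j)%N) (m j)%:R = k%:R); last first.
  rewrite /k natr_sum [RHS](bigID (fun j => (0 < m j)%N))/= [X in _ + X]big1 ?addr0//.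
  by move=> j; rewrite -eqn0Ngt => /eqP ->.
case: k => [|k] /=.
  by rewrite !ffactn0 mul0r addr0 !subn0 exprS; ring.
rewrite subSS.
have [nk|kn] := ltnP n k.
  by rewrite !ffact_small ?mul0r ?mulr0 ?mul0r ?addr0// ltnW.
rewrite ffactSS ffactnSr !natrM natrB// -[n.+1%:R]natr1 -[k.+1%:R]natr1.
(* For [k = n] the exponent [n - k.+1] is truncated, but the term carrying it has the vanishing
   factor [n - k]. *)
have [->|kn'] := eqVneq k n.
  by rewrite subrr !mulr0 !mul0r mulr0 add0r subnn; ring.
have {}kn : (k < n)%N by rewrite ltn_neqAle kn' kn.
by rewrite (_ : (n - k = (n - k.+1).+1)%N) ?exprS; [ring|lia].
Qed.

End multinomial.

Section counts.
Context dT (T : measurableType dT) (R : realType) (P : probability T R).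
Context dX (X : measurableType dX) (Z : nat -> {RV P >-> X}).
Variable nu : set X -> R.
Hypothesis law : forall i A, measurable A -> P [set w | A (Z i w)] = (nu A)%:E.
Hypothesis indep : forall n (A : nat -> set X), (forall i, measurable (A i)) ->
    P [set w | forall i, (i < n)%N -> A i (Z i w)] =
    (\prod_(i < n) P [set w | A i (Z i w)])%E.

Definition counts (B : set X) n w := count (fun i => Z i w \in B) (iota 0 n).

Lemma countsS B n w : counts B n.+1 w = (counts B n w + (Z n w \in B))%N.
Proof. by rewrite /counts -addn1 iotaD count_cat/= add0n addn0. Qed.

Lemma measurable_RV_preimage i A : measurable A -> measurable [set w | A (Z i w)].
Proof. by move=> mA; rewrite -[X in measurable X]setTI; exact: measurable_funPT. Qed.

Lemma measurable_counts B n k : measurable B -> measurable [set w | counts B n w = k].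
Proof.
move=> mB; elim: n k => [|n IH] k.
  case: k => [|k]; first by rewrite (_ : mkset _ = setT)//; apply/seteqP; split.
  by rewrite (_ : mkset _ = set0)//; apply/seteqP; split.
rewrite (_ : mkset _ = ([set w | B (Z n w)] `&` \bigcup_(i in [set i | i.+1 = k]) [set w | counts B n w = i])
   `|` ([set w | (~` B) (Z n w)] `&` [set w | counts B n w = k])).
  apply: measurableU; apply: measurableI => //.
  - exact: measurable_RV_preimage.
  - by apply: bigcup_measurable => i _; exact: IH.
  - by apply: measurable_RV_preimage; exact: measurableC.
apply/seteqP; split => w /=.
  rewrite countsS; have [/set_mem Bw <-|/negP Bw <-] := boolP (Z n w \in B).
    by left; split => //; exists (counts B n w) => //=; rewrite addn1.
  by right; rewrite addn0; split => //; move: Bw; rewrite inE.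
rewrite countsS => -[[Bw [i <- <-]]|[Bw <-]].
  by rewrite mem_set// addn1.
by rewrite memNset// addn0.
Qed.

Let nuT : nu setT = 1.
Proof. by apply: EFin_inj; rewrite -(law 0)// -(probability_setT P). Qed.

Definition tail_event n N (A : nat -> set X) : set T :=
  [set w | forall i, (n <= i < N)%N -> A i (Z i w)].

Lemma tail_eventE n N A : (forall i, measurable (A i)) ->
  P (tail_event n N A) = (\prod_(n <= i < N) nu (A i))%:E.
Proof.
move=> mA; pose A' i := if (n <= i)%N then A i else setT.
have mA' i : measurable (A' i) by rewrite /A'; case: ifP.
rewrite (_ : tail_event n N A = [set w | forall i, (i < N)%N -> A' i (Z i w)]).
  rewrite indep//.
  rewrite (eq_bigr (fun i : 'I_N => (nu (A' i))%:E)); last by move=> i _; exact: law.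
  rewrite prodEFin; congr EFin.
  rewrite [RHS]big_geq_mkord [RHS]big_mkcond/=; apply: eq_bigr => i _; rewrite /A'.
  by case: ifP.
apply/seteqP; split => w /= h i.
  by move=> iN; rewrite /A'; case: ifPn => // ni; apply: h; rewrite ni.
by move=> /andP[ni iN]; have := h i iN; rewrite /A' ni.
Qed.

Lemma measurable_tail_event n N A : (forall i, measurable (A i)) ->
  measurable (tail_event n N A).
Proof.
move=> mA; rewrite (_ : tail_event n N A =
  \bigcap_(i in [set i | (n <= i < N)%N]) [set w | A i (Z i w)])//.
by apply: bigcap_measurableType => // i _; exact: measurable_RV_preimage.
Qed.

Variables (J : nat) (B : 'I_J -> set X).
Hypotheses (mB : forall j, measurable (B j)) (tB : trivIset setT B).
Let p j := nu (B j).
Let C := ~` \bigcup_j B j.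
Let mC : measurable C.
Proof.
by apply: measurableC; rewrite bigcup_ord; apply: bigsetU_measurable.
Qed.

Definition counts_event n (m : 'I_J -> nat) : set T :=
  [set w | forall j, counts (B j) n w = m j].

Lemma measurable_counts_event n m : measurable (counts_event n m).
Proof. by apply: measurable_forall_ord => j; exact: measurable_counts. Qed.

(* Independence is a product rule over an initial block of the sample, so the
   induction on [n] keeps the constraints on the points from [n] on. *)
Lemma counts_tail n N m A : (n <= N)%N -> (forall i, measurable (A i)) ->
  P (counts_event n m `&` tail_event n N A) =
  (multinomial_weight p (nu C) n m * \prod_(n <= i < N) nu (A i))%:E.
Proof.
elim: n m A => [|n IH] m A nN mA.
  rewrite /multinomial_weight ffact0n sub0n expr0 mulr1.
  have [m0|m0] := eqVneq (\sum_j m j)%N 0%N.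
    have {}m0 j : m j = 0%N.
      by move/eqP: m0; rewrite sum_nat_eq0 => /forallP/(_ j)/eqP.
    rewrite (_ : counts_event 0 m = setT); last first.
      by apply/seteqP; split => w // _ j; rewrite m0.
    rewrite setTI tail_eventE// [X in true%:R * X]big1 ?mulr1 ?mul1r// => j _.
    by rewrite m0 expr0 fact0 divr1.
  rewrite !mul0r (_ : counts_event 0 m = set0) ?set0I ?measure0//.
  apply/seteqP; split => // w /= h; move/eqP: m0; apply; apply: big1 => j _.
  by rewrite -(h j).
(* A condition [D] on point [n] becomes one more tail constraint, to which the induction hypothesis
   applies. *)
pose upd D i := if i == n then D else A i.
have mupd D i : measurable D -> measurable (upd D i).
  by move=> mD; rewrite /upd; case: ifP.
have updE D : measurable D -> tail_event n N (upd D) =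
    [set w | D (Z n w)] `&` tail_event n.+1 N A.
  move=> mD; apply/seteqP; split => w /=.
    move=> h; split; first by have := h n; rewrite leqnn nN /upd eqxx; exact.
    move=> i /andP[ni iN]; have := h i; rewrite (ltnW ni) iN /upd gtn_eqF//.
    exact.
  move=> [Dw h] i /andP[ni iN]; rewrite /upd; case: eqP => [->//|/eqP ni'].
  by apply: h; rewrite iN ltn_neqAle eq_sym ni' ni.
have prodE D : \prod_(n <= i < N) nu (upd D i) = nu D * \prod_(n.+1 <= i < N) nu (A i).
  rewrite big_ltn// /upd eqxx; congr (_ * _); rewrite !big_nat.
  by apply: eq_bigr => i /andP[ni _]; rewrite gtn_eqF.
pose E := counts_event n.+1 m `&` tail_event n.+1 N A.
have mE : measurable E.
  by apply: measurableI; [exact: measurable_counts_event|exact: measurable_tail_event].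
have mZ D : measurable D -> measurable [set w | D (Z n w)].
  by move=> mD; exact: measurable_RV_preimage.
have -> : P E = (P (E `&` [set w | C (Z n w)]) +
    \sum_j P (E `&` [set w | B j (Z n w)]))%E.
  rewrite -measure_bigsetU_ord//; last 2 first.
  - by move=> j; apply: measurableI => //; exact: mZ.
  - apply/trivIsetP => i j _ _ ij; rewrite setIACA setIid.
    rewrite (_ : [set w | B i (Z n w)] `&` _ = set0) ?setI0//.
    apply/seteqP; split => // w /= [Bi Bj].
    by move/trivIsetP : tB => /(_ i j I I ij)/seteqP[/(_ (Z n w)) + _]; exact.
  rewrite -big_distrr/= -measureU; last 3 first.
  - by apply: measurableI => //; exact: mZ.
  - by apply: measurableI => //; apply: bigsetU_measurable => j _; exact: mZ.
  - rewrite setIACA setIid -bigcup_ord.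
    rewrite (_ : [set w | C (Z n w)] `&` _ = set0) ?setI0//.
    apply/seteqP; split => // w /= [Cw [j _ Bw]]; apply: Cw; by exists j.
  rewrite -setIUr -bigcup_ord (_ : _ `|` _ = setT) ?setIT//.
  rewrite -subTset => w _ /=; have [[j _ Bj]|h] := pselect ((\bigcup_j B j) (Z n w)).
    by right; exists j.
  by left.
have EC : E `&` [set w | C (Z n w)] = counts_event n m `&` tail_event n N (upd C).
  rewrite updE// /E; apply/seteqP; split => w /=.
    move=> [[h tw] Cw]; split=> // j; rewrite -(h j) countsS memNset ?addn0// => Bw.
    by apply: Cw; exists j.
  move=> [h [Cw tw]]; split=> //; split => // j; rewrite countsS h memNset ?addn0// => Bw.
  by apply: Cw; exists j.
have EB j : E `&` [set w | B j (Z n w)] = if (0 < m j)%N then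
    counts_event n (decr m j) `&` tail_event n N (upd (B j)) else set0.
  have hij w i : B j (Z n w) -> (Z n w \in B i) = (i == j).
    move=> Bj; apply/idP/eqP => [/set_mem Bi|->]; last by rewrite inE.
    apply/eqP/negPn/negP => ij.
    by move/trivIsetP : tB => /(_ i j I I ij)/seteqP[/(_ (Z n w)) + _]; apply.
  case: ifPn => mj; apply/seteqP; split => w //=.
  - move=> [[h tw] Bw]; rewrite updE//; split=> // i.
    by rewrite /decr -(h i) countsS (hij w i Bw) addnK.
  - rewrite updE// => -[h [Bw tw]]; split=> //; split=> // i.
    rewrite countsS (hij w i Bw) h /decr subnK//.
    by case: eqP => // ->.
  - move=> [[h _] Bw]; have := h j.
    by rewrite countsS (hij w j Bw) eqxx; move: mj; rewrite -eqn0Ngt => /eqP ->; rewrite addn1.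
rewrite EC IH//; [|exact: ltnW|by move=> i; exact: mupd].
rewrite multinomial_weightS mulrDl EFinD prodE; congr (_ + _)%E.
  by congr EFin; ring.
rewrite mulr_suml -sumEFin [RHS]big_mkcond/=; apply: eq_bigr => j _; rewrite EB.
case: ifPn => mj; last by rewrite measure0.
rewrite IH//; [|exact: ltnW|by move=> i; exact: mupd].
by rewrite prodE; congr EFin; rewrite /p; ring.
Qed.

Lemma counts_eventE n m :
  P (counts_event n m) = (multinomial_weight p (nu C) n m)%:E.
Proof.
have := @counts_tail n n m (fun=> setT) (leqnn n) (fun=> measurableT).
rewrite big_geq// mulr1 (_ : tail_event _ _ _ = setT) ?setIT//.
by apply/seteqP; split.
Qed.

End counts.

(** * Poisson limit of the multinomial weights *)

Section poisson_limit.
Variable R : realType.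

Lemma cvgn_inv : (n%:R^-1 : R) @[n --> \oo] --> (0 : R).
Proof.
apply/gtr0_cvgV0; last exact: cvgr_idn.
by near=> n; rewrite ltr0n; near: n; exact: nbhs_infty_gt.
Unshelve. all: by end_near. Qed.

Lemma cvg_subn_ratio k : ((n - k)%:R / n%:R : R) @[n --> \oo] --> (1 : R).
Proof.
have h : (1 - k%:R * n%:R^-1 : R) @[n --> \oo] --> (1 : R).
  rewrite -[X in _ --> X]subr0 -[X in _ - X](mulr0 k%:R).
  by apply: cvgB; [exact: cvg_cst|apply: cvgM; [exact: cvg_cst|exact: cvgn_inv]].
apply: cvg_trans h; apply: near_eq_cvg; near=> n.
have n0 : (0 < n)%N by near: n; exact: nbhs_infty_gt.
rewrite natrB; last by near: n; exact: nbhs_infty_ge.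
by rewrite mulrBl divff// pnatr_eq0 -lt0n.
Unshelve. all: by end_near. Qed.

Lemma cvg_ffact_ratio k : ((n ^_ k)%:R / n%:R ^+ k : R) @[n --> \oo] --> (1 : R).
Proof.
elim: k => [|k IH].
  by under eq_fun do rewrite ffactn0 expr0 divr1; exact: cvg_cst.
rewrite -[X in _ --> X]mulr1.
under eq_fun do rewrite ffactnSr natrM exprSr invfM mulrACA.
by apply: cvgM => //; exact: cvg_subn_ratio.
Qed.

(** Squeeze: [1 + x <= expR x] at [x = - s n] bounds [1 - s n] from above, and at
    [x = s n / (1 - s n)] bounds its inverse. A fixed shift [k] of the exponent does not matter
    because [s n] tends to 0. *)
Lemma cvg_expr_expR (s : nat -> R) (lam : R) k : (forall n, 0 <= s n <= 1) ->
  n%:R * s n @[n --> \oo] --> lam ->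
  (1 - s n) ^+ (n - k) @[n --> \oo] --> expR (- lam).
Proof.
move=> s01 hs.
have s0 : s n @[n --> \oo] --> (0 : R).
  have h : (n%:R * s n) * n%:R^-1 @[n --> \oo] --> (0 : R).
    by rewrite -(mulr0 lam); apply: cvgM => //; exact: cvgn_inv.
  apply: cvg_trans h; apply: near_eq_cvg; near=> n.
  by rewrite mulrAC divff ?mul1r// pnatr_eq0 -lt0n; near: n; exact: nbhs_infty_gt.
have hk : (n - k)%:R * s n @[n --> \oo] --> lam.
  have h : n%:R * s n - k%:R * s n @[n --> \oo] --> lam.
    rewrite -[X in _ --> X]subr0 -[X in _ - X](mulr0 k%:R).
    by apply: cvgB => //; apply: cvgM => //; exact: cvg_cst.
  apply: cvg_trans h; apply: near_eq_cvg; near=> n.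
  by rewrite natrB ?mulrBl//; near: n; exact: nbhs_infty_ge.
have s1 : \forall n \near \oo, s n < 1 by apply: (cvgr_lt _ s0).
apply: (@squeeze_cvgr _ _ _ _ (fun n => expR (- ((n - k)%:R * s n / (1 - s n))))
   (fun n => expR (- ((n - k)%:R * s n)))).
- near=> n.
  have sn1 : s n < 1 by near: n.
  have sn0 : 0 < 1 - s n by rewrite subr_gt0.
  apply/andP; split.
    rewrite -mulrA -mulrN expRM_natl; apply: lerXn2r; rewrite ?nnegrE ?expR_ge0 ?(ltW sn0)//.
    rewrite expRN -[leRHS]invrK lef_pV2 ?posrE ?invr_gt0 ?expR_gt0//.
    apply: le_trans (expR_ge1Dx _).
    by rewrite (_ : 1 + s n / (1 - s n) = (1 - s n)^-1)//; field; exact: lt0r_neq0.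
  rewrite -mulrN expRM_natl; apply: lerXn2r; rewrite ?nnegrE ?expR_ge0 ?(ltW sn0)//.
  exact: expR_ge1Dx.
- apply: continuous_cvg; first exact: continuous_expR.
  apply: cvgN; rewrite -[X in _ --> X]divr1 -[X in _ / X]subr0.
  by apply: cvgM => //; apply: cvgV; [rewrite subr0|apply: cvgB => //; exact: cvg_cst].
- by apply: continuous_cvg; [exact: continuous_expR|exact: cvgN].
Unshelve. all: by end_near. Qed.

Lemma cvg_exprn (u : nat -> R) (l : R) k :
  u n @[n --> \oo] --> l -> u n ^+ k @[n --> \oo] --> l ^+ k.
Proof.
move=> ul; elim: k => [|k IH]; first by under eq_fun do rewrite expr0; exact: cvg_cst.
by under eq_fun do rewrite exprS; rewrite exprS; exact: cvgM.
Qed.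

Lemma cvg_sum_fin (I : finType) (u : nat -> I -> R) (l : I -> R) :
  (forall i, u n i @[n --> \oo] --> l i) ->
  \sum_i u n i @[n --> \oo] --> \sum_i l i.
Proof.
move=> ul; elim: (index_enum I) => [|i s IH].
  by rewrite big_nil; under eq_fun do rewrite big_nil; exact: cvg_cst.
by rewrite big_cons; under eq_fun do rewrite big_cons; exact: cvgD.
Qed.

Lemma cvg_prod_fin (I : finType) (u : nat -> I -> R) (l : I -> R) :
  (forall i, u n i @[n --> \oo] --> l i) ->
  \prod_i u n i @[n --> \oo] --> \prod_i l i.
Proof.
move=> ul; elim: (index_enum I) => [|i s IH].
  by rewrite big_nil; under eq_fun do rewrite big_nil; exact: cvg_cst.
by rewrite big_cons; under eq_fun do rewrite big_cons; exact: cvgM.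
Qed.

(** Move a power of [n] from the falling factorial to the [p n j]: the falling factorial ratio tends
    to 1, the monomials to those in [r j], and the last factor to an exponential that splits over
    the cells. *)
Lemma multinomial_weight_cvg J (p : nat -> 'I_J -> R) (r : 'I_J -> R) m :
  (forall n j, 0 <= p n j) -> (forall n, \sum_j p n j <= 1) ->
  (forall j, n%:R * p n j @[n --> \oo] --> r j) ->
  multinomial_weight (p n) (1 - \sum_j p n j) n m @[n --> \oo] -->
    \prod_j poisson_weight (r j) (m j).
Proof.
move=> p0 p1 hp; rewrite /multinomial_weight; set k := (\sum_j m j)%N.
have hsum : n%:R * (\sum_j p n j) @[n --> \oo] --> \sum_j r j.
  under eq_fun do rewrite mulr_sumr.
  exact: (@cvg_sum_fin _ (fun n j => n%:R * p n j)).
have he := @cvg_expr_expR _ _ k (fun n => _) hsum.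
have hprod : \prod_j ((n%:R * p n j) ^+ m j / (m j)`!%:R) @[n --> \oo] -->
    \prod_j (r j ^+ m j / (m j)`!%:R).
  apply: (@cvg_prod_fin _ (fun n j => (n%:R * p n j) ^+ m j / (m j)`!%:R)) => j; apply: cvgM; last exact: cvg_cst.
  by apply: cvg_exprn; exact: hp.
have h : (n ^_ k)%:R / n%:R ^+ k * \prod_j ((n%:R * p n j) ^+ m j / (m j)`!%:R) *
    (1 - \sum_j p n j) ^+ (n - k) @[n --> \oo] -->
    1 * \prod_j (r j ^+ m j / (m j)`!%:R) * expR (- \sum_j r j).
  apply: cvgM; last by apply: he => n; rewrite sumr_ge0/=.
  by apply: cvgM => //; exact: cvg_ffact_ratio.
rewrite /poisson_weight big_split/= -expR_sum sumrN.
rewrite mul1r in h; apply: cvg_trans h; apply: near_eq_cvg; near=> n.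
congr (_ * _); rewrite -mulrA; congr (_ * _).
under eq_bigr do rewrite exprMn -mulrA.
rewrite big_split/= -expr_sum -/k mulrA mulVf ?mul1r// expf_neq0// pnatr_eq0 -lt0n.
by near: n; exact: nbhs_infty_gt.
Unshelve. all: by end_near. Qed.

(** Heine-Cantor on the segment, except that only [x] is confined to it: [y] may lie slightly
    outside, as the sum over a cloud may. *)
Lemma continuous_segment_uniform (u : R -> R) (B eps : R) :
  continuous u -> 0 < eps -> exists2 del, 0 < del &
    forall x y, `|x| <= B -> `|x - y| < del -> `|u x - u y| < eps.
Proof.
move=> cu eps0.
have := @segment_compact R (- B) B; rewrite compact_near_coveringP => /(_ R
  (0^'+) (fun del x => forall y, `|x - y| < del -> `|u x - u y| < eps) _).
case.
  move=> x _; have e2 : 0 < eps / 2 by rewrite divr_gt0.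
  have /cvgr_dist_lt/(_ _ e2)/nbhs_ballP[r /= r0 hr] := cu x.
  exists (ball x (r / 2), [set del | del < r / 2]).
    split => /=; first by apply: nbhsx_ballx; rewrite divr_gt0.
    by apply: nbhs_right_lt; rewrite divr_gt0.
  move=> [x' del] /= [xx' delr] y x'y.
  have hx' : `|u x - u x'| < eps / 2.
    apply: hr; apply: le_ball xx'; lra.
  have hy : `|u x - u y| < eps / 2.
    apply: hr; rewrite /ball/=; rewrite /ball/= in xx'.
    rewrite (_ : x - y = (x - x') + (x' - y)); last by rewrite addrA subrK.
    by rewrite (le_lt_trans (ler_normD _ _))//; lra.
  rewrite (_ : u x' - u y = (u x - u y) - (u x - u x')); last by ring.
  by rewrite (le_lt_trans (ler_normB _ _))//; lra.
move=> r /= r0 hr; exists (r / 2); first by rewrite divr_gt0.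
move=> x y xB xy; apply: (hr (r / 2)) => //=.
- by rewrite sub0r normrN gtr0_norm ?divr_gt0//; lra.
- by rewrite divr_gt0.
- by rewrite in_itv/= -ler_norml.
Qed.

End poisson_limit.

(** * Approximation of integrals and expectations by finite sums *)

Section step_integrals.
Context d (T : measurableType d) (R : realType) (mu : {measure set T -> \bar R}).

Lemma step_integral (I : finType) (v : I -> R) (E : I -> set T) :
  (forall i, measurable (E i)) -> (forall i, (mu (E i) < +oo)%E) ->
  mu.-integrable setT (EFin \o (fun t => \sum_i v i * \1_(E i) t)) /\
  \int[mu]_t (\sum_i v i * \1_(E i) t) = \sum_i v i * fine (mu (E i)).
Proof.
move=> mE muE.
have h1 i : mu.-integrable setT (fun t => (\1_(E i) t)%:E).
  apply/integrableP; split; first exact/measurable_EFinP.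
  under eq_integral do rewrite gee0_abs ?lee_fin//.
  by rewrite integral_indic// setIT.
have hi i : mu.-integrable setT (EFin \o (fun t => v i * \1_(E i) t)).
  rewrite (_ : _ \o _ = (fun t => (v i)%:E * (\1_(E i) t)%:E)%E)//.
  exact: integrableZl.
have h2 i : \int[mu]_t (v i * \1_(E i) t) = v i * fine (mu (E i)).
  rewrite RintegralZl//; last exact: h1.
  by rewrite /Rintegral integral_indic// setIT.
elim: (index_enum I) => [|i s [IH1 IH2]].
  rewrite big_nil; under eq_fun do rewrite big_nil; split.
    exact: integrable0.
  by rewrite /Rintegral integral0.
rewrite big_cons; under eq_fun do rewrite big_cons; split.
  rewrite (_ : _ \o _ = (fun t => (v i * \1_(E i) t)%:E +
    (\sum_(i <- s) v i * \1_(E i) t)%:E)%E)//.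
  exact: (integrableD measurableT (hi i) IH1).
by rewrite RintegralD// IH2 h2.
Qed.

Lemma approx_integral (f g k : T -> R) : measurable_fun setT f ->
  mu.-integrable setT (EFin \o g) -> mu.-integrable setT (EFin \o k) ->
  (forall t, `|f t - g t| <= k t) ->
  mu.-integrable setT (EFin \o f) /\
  `|\int[mu]_t f t - \int[mu]_t g t| <= \int[mu]_t k t.
Proof.
move=> mf ig ik fgk.
have ifg : mu.-integrable setT (EFin \o (fun t => f t - g t)).
  apply: le_integrable ik => //.
    apply/measurable_EFinP; apply: measurable_funB => //.
    exact/measurable_EFinP/(measurable_int mu ig).
  by move=> t _; rewrite /= lee_fin (le_trans (fgk t))// ler_norm.
have if_ : mu.-integrable setT (EFin \o f).
  rewrite (_ : _ \o _ = (fun t => (f t - g t)%:E + (g t)%:E)%E).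
    exact: integrableD.
  by apply/funext => t /=; rewrite -EFinD subrK.
split=> //; rewrite -RintegralB//.
apply: le_trans (le_normr_Rintegral _ _) _ => //.
apply: le_Rintegral => //.
exact: integrable_norm.
Qed.

End step_integrals.

(** On each [E i] the function is within [eps] of [v i]; on the remaining event, of probability one
    minus the sum, only the bound [M] is used. *)
Lemma expectation_events dT (T : measurableType dT) (R : realType)
    (P : probability T R) (I : finType) (E : I -> set T) (v : I -> R)
    (f : T -> R) (eps M : R) :
  (forall i, measurable (E i)) -> trivIset setT E ->
  measurable_fun setT f -> (forall t, `|f t| <= M) -> 0 <= eps ->
  (forall i t, E i t -> `|f t - v i| <= eps) ->
  'E_P[f]%E = (\int[P]_t f t)%:E /\
  `|\int[P]_t f t - \sum_i v i * fine (P (E i))| <=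
     eps + M * (1 - \sum_i fine (P (E i))).
Proof.
move=> mE tE mf fM eps0 fv.
have Pfin A : measurable A -> (P A < +oo)%E.
  by move=> mA; rewrite (le_lt_trans (probability_le1 P mA))// ltry.
have [ig eg] := step_integral (mu := P) v mE (fun i => Pfin _ (mE i)).
have [i2 e2] := step_integral (mu := P) (fun=> - M) mE (fun i => Pfin _ (mE i)).
(* This equals [eps] on the union of the events and [eps + M] off it. *)
pose k t := (eps + M) + \sum_i - M * \1_(E i) t.
have ic : P.-integrable setT (EFin \o cst (eps + M)).
  exact: finite_measure_integrable_cst.
have ik : P.-integrable setT (EFin \o k).
  rewrite (_ : _ \o _ = (fun t => (eps + M)%:E + (\sum_i - M * \1_(E i) t)%:E)%E)//.
  exact: integrableD.
have ek : \int[P]_t k t = eps + M * (1 - \sum_i fine (P (E i))).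
  rewrite /k RintegralD// e2 Rintegral_cst//= probability_setT mulr1 -mulr_sumr; ring.
have h t : `|f t - \sum_i v i * \1_(E i) t| <= k t.
  rewrite /k; have [[i Eit]|nE] := pselect (exists i, E i t).
    have E1 (w : I -> R) : \sum_i w i * \1_(E i) t = w i.
      rewrite (bigD1 i)//= indicE mem_set// mulr1 big1 ?addr0//.
      move=> j ji; rewrite indicE memNset ?mulr0// => Ejt.
      by move/trivIsetP : tE => /(_ j i Logic.I Logic.I ji)/seteqP[/(_ t) + _]; exact.
    by rewrite !E1 addrK; exact: fv.
  have E0 (w : I -> R) : \sum_i w i * \1_(E i) t = 0.
    by rewrite big1// => i _; rewrite indicE memNset ?mulr0// => Eit; apply: nE; exists i.
  by rewrite !E0 subr0 addr0 (le_trans (fM t))// lerDr.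
have [if_ hf] := approx_integral mf ig ik h; split.
  by rewrite unlock /Rintegral fineK//; exact: integrable_fin_num.
by rewrite -eg -ek.
Qed.

Section level_partition.
Variables (R : realType) (d : nat) (phi : 'rV[R]_d -> R) (M rho : R).
Hypotheses (cphi : continuous phi) (phiM : forall x, `|phi x| <= M).
Hypotheses (rho0 : 0 < rho) (phi0 : forall x, `|x| < rho -> phi x = 0).

Lemma nbhs0_far (A : set 'rV[R]_d) (r : R) : 0 < r -> (forall z, A z -> r <= `|z|) ->
  nbhs (0 : 'rV[R]_d) (~` A).
Proof.
move=> r0 Ar; apply/nbhs_ballP; exists r => //= z.
rewrite -ball_normE /ball_/= sub0r normrN => zr /Ar.
by rewrite leNgt zr.
Qed.

(** The cells are slices of height [del] of [phi], cut off from the origin. The error vanishes where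
    [phi] is known to vanish, so summing it over a cloud costs [del] per far point only. *)
Lemma level_partition (del : R) : 0 < del ->
  exists (J : nat) (A : 'I_J -> set 'rV[R]_d) (a : 'I_J -> R),
  [/\ (forall j, measurable (A j)), (forall j z, A j z -> rho <= `|z|),
      trivIset setT A, (forall j, `|a j| <= M) &
      forall z, `|phi z - \sum_j a j * \1_(A j) z| <= \sum_j del * \1_(A j) z].
Proof.
move=> del0.
have M0 : 0 <= M by exact: le_trans (normr_ge0 _) (phiM 0).
have mphi : measurable_fun setT phi by exact: continuous_measurable_rV.
(* The values of [phi + M] lie between 0 and [2 * M], which [J] levels of height [del] cover. *)
pose J := (Num.truncn ((M + M) / del)).+1.
pose lev z := Num.truncn ((phi z + M) / del).
have phiM0 z : 0 <= phi z + M.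
  by have := phiM z; rewrite ler_norml => /andP[h _]; lra.
have levP z : (lev z)%:R * del <= phi z + M < (lev z).+1%:R * del.
  rewrite -ler_pdivlMr// -ltr_pdivrMr//; apply: truncn_itv.
  by rewrite divr_ge0// ltW.
have levJ z : (lev z < J)%N.
  rewrite ltnS; apply: le_truncn; rewrite ler_pM2r ?invr_gt0// lerD2r.
  by have := phiM z; rewrite ler_norml => /andP[].
have mfar : measurable [set z : 'rV[R]_d | rho <= `|z|].
  rewrite (_ : mkset _ = ~` [set z | `|z - 0| < rho]).
    by apply: measurableC; exact: measurable_rV_ball.
  by apply/seteqP; split => z /=; rewrite subr0 leNgt => /negP.
pose A (j : 'I_J) := [set z | rho <= `|z|] `&`
  phi @^-1` `[j%:R * del - M, j.+1%:R * del - M[.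
have AP j z : A j z -> lev z = j.
  move=> [_]; rewrite /= in_itv/= => /andP[h1 h2].
  apply/eqP; rewrite /lev truncn_eq ?divr_ge0//; last exact: ltW.
  by rewrite ler_pdivlMr// ltr_pdivrMr//; lra.
have A_lev z : rho <= `|z| -> A (Ordinal (levJ z)) z.
  move=> rz; split => //=; rewrite in_itv/=.
  by have /andP[] := levP z; lra.
have tA : trivIset setT A.
  by move=> i j _ _ [z [/AP Ai /AP Aj]]; apply: val_inj => /=; rewrite -Ai -Aj.
exists J, A, (fun j => j%:R * del - M); split => //.
- move=> j; apply: measurableI => //.
  by rewrite -[X in measurable X]setTI; apply: mphi => //; exact: measurable_itv.
- by move=> j z [].
- move=> j; rewrite ler_norml; apply/andP; split.
    by rewrite lerBDr addrC subrr mulr_ge0// ltW.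
  have : j%:R <= (M + M) / del.
    have := ltn_ord j; rewrite /J ltnS => jJ.
    have /truncn_itv/andP[h _] : 0 <= (M + M) / del.
      by rewrite divr_ge0 ?addr_ge0// ltW.
    by apply: le_trans h; rewrite ler_nat.
  by rewrite ler_pdivlMr//; lra.
move=> z; have [rz|zr] := leP rho `|z|; last first.
  rewrite phi0// !big1 ?subrr ?normr0// => j _; rewrite indicE memNset ?mulr0// => -[/=];
  by rewrite leNgt zr.
have E1 (w : 'I_J -> R) : \sum_i w i * \1_(A i) z = w (Ordinal (levJ z)).
  rewrite (bigD1 (Ordinal (levJ z)))//= indicE mem_set ?mulr1; last exact: A_lev.
  rewrite big1 ?addr0// => j jz; rewrite indicE memNset ?mulr0// => /AP Aj.
  by move/eqP: jz; apply; exact: val_inj.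
rewrite !E1 /= ler_norml; have /andP[] := levP z.
by rewrite -natr1 mulrDl mul1r; lra.
Qed.

End level_partition.

Section clouds.
Variables (R : realType) (d : nat).
Context dT (T : measurableType dT) (P : probability T R).
Variables (Z : nat -> {RV P >-> 'rV[R]_d}) (nu : set 'rV[R]_d -> R).
Hypothesis law : forall i A, measurable A -> P [set w | A (Z i w)] = (nu A)%:E.
Hypothesis indep : forall n (A : nat -> set 'rV[R]_d), (forall i, measurable (A i)) ->
    P [set w | forall i, (i < n)%N -> A i (Z i w)] =
    (\prod_(i < n) P [set w | A i (Z i w)])%E.
Variable a : nat -> R.

Let law_ge0 A : measurable A -> 0 <= nu A.
Proof. by move=> mA; rewrite -lee_fin -(law 0). Qed.

Lemma num_points_counts n w (A : set 'rV[R]_d) :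
  num_points (sample_cloud Z a n w) A =
  counts Z [set z | A ((a n)^-1 *: z)] n w.
Proof.
rewrite /num_points /sample_cloud /counts count_map; apply: eq_count => i /=.
by apply/idP/idP => /set_mem ?; exact: mem_set.
Qed.

Lemma cloud_counts_cvg J (A : 'I_J -> set 'rV[R]_d) (r : 'I_J -> R) m :
  (forall j, measurable (A j)) -> trivIset setT A ->
  (forall j, n%:R * nu [set z | A j ((a n)^-1 *: z)] @[n --> \oo] --> r j) ->
  fine (P [set w | forall j, num_points (sample_cloud Z a n w) (A j) = m j])
    @[n --> \oo] --> \prod_j poisson_weight (r j) (m j).
Proof.
move=> mA tA hr.
pose B n j := [set z | A j ((a n)^-1 *: z)].
have mB n j : measurable (B n j) by exact: measurable_scale_set.
have tB n : trivIset setT (B n).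
  by move=> i j _ _ [z [Ai Aj]]; apply: tA => //; exists ((a n)^-1 *: z).
have mU n : measurable (\bigcup_j B n j).
  by rewrite bigcup_ord; apply: bigsetU_measurable.
have nuU n : \sum_j nu (B n j) = fine (P [set w | (\bigcup_j B n j) (Z 0 w)]).
  rewrite (_ : [set w | _] = \big[setU/set0]_j [set w | B n j (Z 0 w)]).
    rewrite measure_bigsetU_ord//.
    - by rewrite (eq_bigr (fun j => (nu (B n j))%:E)) ?sumEFin// => j _; exact: law.
    - by move=> j; exact: measurable_RV_preimage.
    - by move=> i j _ _ [w [Ai Aj]]; apply: (tB n) => //; exists (Z 0 w).
  rewrite -bigcup_ord; apply/seteqP; split => w [j _ Bj]; by exists j.
have nuC n : nu (~` \bigcup_j B n j) = 1 - \sum_j nu (B n j).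
  apply: EFin_inj; rewrite -(law 0); last exact: measurableC.
  rewrite (_ : [set w | _] = ~` [set w | (\bigcup_j B n j) (Z 0 w)])//.
  rewrite probability_setC; last exact: measurable_RV_preimage.
  by rewrite EFinB nuU fineK// (law 0).
have nu1 n : \sum_j nu (B n j) <= 1.
  rewrite nuU -lee_fin fineK ?law//; rewrite -(law 0)//.
  by apply: probability_le1; exact: measurable_RV_preimage.
have := @multinomial_weight_cvg R J (fun n j => nu (B n j)) r m
  (fun n j => law_ge0 (mB n j)) nu1 hr.
apply: cvg_trans; apply: near_eq_cvg; near=> n.
rewrite -nuC -[LHS]/(fine (_)%:E) -(counts_eventE law indep (mB n) (tB n)).
congr (fine (P _)); apply/seteqP; split => w h j; have := h j;
by rewrite num_points_counts.
Unshelve. all: by end_near. Qed.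

(** With [x = n * nu A], the weight is at most [x ^+ k * expR k * expR (- x)], where [expR k] pays
    for the exponent [n - k] in place of [n]. The exponential then beats [x ^+ k.+1], leaving a
    decay [x^-1]. *)
Lemma binomial_bound (A : set 'rV[R]_d) n k : measurable A -> (0 < n)%N -> 0 < nu A ->
  fine (P [set w | counts Z A n w = k]) <=
  expR k%:R * k.+1`!%:R * (n%:R * nu A)^-1.
Proof.
move=> mA n0 A0.
have -> : [set w | counts Z A n w = k] =
    counts_event Z (fun _ : 'I_1 => A) n (fun=> k).
  by apply/seteqP; split => w; [move=> h j|move=> /(_ ord0)].
rewrite (counts_eventE law indep) => //; last first.
  by move=> i j _ _ _; rewrite !ord1.
have -> : ~` (\bigcup_(_ in [set: 'I_1]) A) = ~` A.
  by congr (~` _); apply/seteqP; split => z; [move=> []|exists ord0].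
have PA0 : P [set w | A (Z 0 w)] = (nu A)%:E by exact: law.
have A1 : nu A <= 1.
  by rewrite -lee_fin -PA0; apply: probability_le1; exact: (@measurable_RV_preimage _ _ _ P _ _ Z 0%N A mA).
have -> : nu (~` A) = 1 - nu A.
  apply: EFin_inj; rewrite -(law 0); last exact: measurableC.
  rewrite (_ : [set w | _] = ~` [set w | A (Z 0 w)])// probability_setC ?PA0//.
  exact: (@measurable_RV_preimage _ _ _ P _ _ Z 0%N A mA).
rewrite /multinomial_weight !big_ord1 /=; set x := n%:R * nu A.
have x0 : 0 < x by rewrite mulr_gt0// ltr0n.
have h1 : (n ^_ k)%:R * (nu A ^+ k / k`!%:R) <= x ^+ k.
  rewrite /x exprMn mulrA -[leRHS]mulr1; apply: ler_pM => //.
  - by rewrite mulr_ge0// exprn_ge0// ltW.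
  - rewrite ler_wpM2r ?exprn_ge0 ?(ltW A0)// -natrX ler_nat.
    by rewrite ffact_prod -[in leqRHS](card_ord k) -prod_nat_const leq_prod// => i _; exact: leq_subr.
  - by rewrite invf_le1 ?ltr0n ?fact_gt0// ler1n fact_gt0.
have h2 : (1 - nu A) ^+ (n - k) <= expR k%:R * expR (- x).
  apply: (@le_trans _ _ (expR (- nu A) ^+ (n - k))).
    apply: lerXn2r; rewrite ?nnegrE ?expR_ge0 ?subr_ge0//; exact: expR_ge1Dx.
  rewrite -expRM_natl -expRD ler_expR mulrN /x.
  (* For [n <= k] the exponent is truncated to 0, and the bound reduces to [n * nu A <= n <= k]. *)
  have [nk|kn] := leqP n k.
    rewrite (eqP nk) mul0r oppr0 subr_ge0.
    by apply: (@le_trans _ _ n%:R); rewrite ?ler_nat// ler_piMr.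
  rewrite natrB; last exact: ltnW.
  by rewrite mulrBl opprB lerB// ler_piMr.
have h3 : x ^+ k * expR (- x) <= k.+1`!%:R * x^-1.
  rewrite expRN ler_pdivrMr ?expR_gt0// mulrAC ler_pdivlMr// -exprSr.
  have := expR_ge1Dxn k (ltW x0); rewrite -ler_pdivrMl ?ltr0n ?fact_gt0// => h.
  by rewrite mulrC; lra.
rewrite /=; apply: (@le_trans _ _ (x ^+ k * (expR k%:R * expR (- x)))).
  apply: ler_pM => //; last by rewrite exprn_ge0// subr_ge0.
  by rewrite mulr_ge0// divr_ge0// exprn_ge0// ltW.
by rewrite mulrCA -mulrA ler_wpM2l// expR_ge0.
Qed.

Lemma binomial_cvg0 (A : nat -> set 'rV[R]_d) (m : nat) :
  (forall n, measurable (A n)) ->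
  n%:R * nu (A n) @[n --> \oo] --> +oo ->
  fine (P [set w | (counts Z (A n) n w <= m)%N]) @[n --> \oo] --> 0.
Proof.
move=> mA hA; pose C : R := \sum_(k < m.+1) expR k%:R * k.+1`!%:R.
have h0 : C * (n%:R * nu (A n))^-1 @[n --> \oo] --> 0.
  rewrite -(mulr0 C); apply: cvgM; first exact: cvg_cst.
  apply/gtr0_cvgV0 => //.
  by move/cvgryPgt : hA => /(_ 0).
apply: (squeeze_cvgr _ (cvg_cst 0) h0); near=> n.
rewrite fine_ge0//=.
rewrite (_ : [set w | _] = \big[setU/set0]_(k < m.+1) [set w | counts Z (A n) n w = k]).
  rewrite measure_bigsetU_ord.
  - rewrite -sum_fine; last first.
      move=> k _; rewrite fin_num_measure//; exact: measurable_counts.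
    rewrite /C mulr_suml; apply: ler_sum => k _; apply: binomial_bound => //.
      by near: n; exact: nbhs_infty_gt.
    have : 0 < n%:R * nu (A n) by near: n; move/cvgryPgt : hA => /(_ 0).
    by apply: contraTT; rewrite -!leNgt => h; rewrite mulr_ge0_le0.
  - by move=> k; exact: measurable_counts.
  - by move=> i j _ _ [w [/= Ai Aj]]; apply: val_inj => /=; rewrite -Ai -Aj.
rewrite -bigcup_ord; apply/seteqP; split => w /=.
  by rewrite -ltnS => h; exists (Ordinal h).
by move=> [k _ /= ->]; rewrite -ltnS.
Unshelve. all: by end_near. Qed.

(** First-moment bound, by adding the points one at a time. *)
Lemma counts_gt0_le (A : set 'rV[R]_d) n : measurable A ->
  (P [set w | (0 < counts Z A n w)%N] <= (n%:R * nu A)%:E)%E.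
Proof.
move=> mA; elim: n => [|n IH].
  by rewrite (_ : [set w | _] = set0) ?measure0 ?mul0r//; apply/seteqP; split.
have mc k : measurable [set w | (0 < counts Z A k w)%N].
  rewrite (_ : mkset _ = ~` [set w | counts Z A k w = 0%N]).
    by apply: measurableC; exact: measurable_counts.
  by apply/seteqP; split => w /=; rewrite lt0n => /eqP.
rewrite -natr1 mulrDl mul1r EFinD.
apply: (@le_trans _ _ (P ([set w | (0 < counts Z A n w)%N] `|` [set w | A (Z n w)]))).
  apply: le_measure; rewrite ?inE; [exact: mc| |].
    apply: measurableU; [exact: mc|exact: (@measurable_RV_preimage _ _ _ P _ _ Z n A mA)].
  move=> w /=; rewrite countsS addn_gt0 lt0b => /orP[|/set_mem]; by [left|right].
apply: (le_trans (measureU2 _ _ _)) => //; first exact: (@measurable_RV_preimage _ _ _ P _ _ Z n A mA).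
by apply: leeD => //; rewrite -(law n mA).
Qed.

End clouds.

(** * Convergence of sample clouds to a Poisson process *)

Section poisson_convergence.
Variables (R : realType) (d : nat).

Lemma cloud_step_approx (phi : 'rV[R]_d -> R) J (A : 'I_J -> set 'rV[R]_d)
    (a : 'I_J -> R) (del : R) (s : seq 'rV[R]_d) :
  (forall z, `|phi z - \sum_j a j * \1_(A j) z| <= \sum_j del * \1_(A j) z) ->
  `|\sum_(z <- s) phi z - \sum_j a j * (num_points s (A j))%:R| <=
    \sum_j del * (num_points s (A j))%:R.
Proof.
move=> h; have E (w : 'I_J -> R) : \sum_j w j * (num_points s (A j))%:R =
    \sum_(z <- s) \sum_j w j * \1_(A j) z.
  rewrite exchange_big/=; apply: eq_bigr => j _; rewrite -mulr_sumr; congr (_ * _).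
  rewrite /num_points -sum1_count natr_sum [RHS](bigID (fun z => z \in A j))/=.
  rewrite [X in _ = _ + X]big1 ?addr0; last by move=> z /negbTE zA; rewrite indicE zA.
  by apply: eq_bigr => z zA; rewrite indicE zA.
rewrite !E -sumrB; apply: le_trans (ler_norm_sum _ _ _) _.
by apply: ler_sum => z _; exact: h.
Qed.

Lemma measure_step_approx (N : {measure set 'rV[R]_d -> \bar R})
    (phi : 'rV[R]_d -> R) J (A : 'I_J -> set 'rV[R]_d) (a : 'I_J -> R) (del : R) :
  measurable_fun setT phi -> (forall j, measurable (A j)) ->
  (forall j, (N (A j) < +oo)%E) ->
  (forall z, `|phi z - \sum_j a j * \1_(A j) z| <= \sum_j del * \1_(A j) z) ->
  `|\int[N]_z phi z - \sum_j a j * fine (N (A j))| <= \sum_j del * fine (N (A j)).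
Proof.
move=> mphi mA NA h.
have [ig eg] := step_integral a mA NA.
have [ik ek] := step_integral (fun=> del) mA NA.
have [_] := approx_integral mphi ig ik h.
by rewrite eg ek.
Qed.

(** With an empty family of events, [expectation_events] still turns the expectation into a real
    integral. *)
Lemma bounded_expectation dT (T : measurableType dT) (P : probability T R)
    (f : T -> R) (M : R) : measurable_fun setT f -> (forall t, `|f t| <= M) ->
  'E_P[f]%E = (\int[P]_t f t)%:E.
Proof.
move=> mf fM.
apply: (proj1 (@expectation_events _ T R P 'I_0 (fun=> set0) (fun=> 0) f 0 M
  _ _ mf fM (lexx 0) _)) => //; by move=> [].
Qed.

Context dT (T : measurableType dT) (P : probability T R).
Variables (Z : nat -> {RV P >-> 'rV[R]_d}) (nu : set 'rV[R]_d -> R).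
Hypothesis law : forall i A, measurable A -> P [set w | A (Z i w)] = (nu A)%:E.
Hypothesis indep : forall n (A : nat -> set 'rV[R]_d), (forall i, measurable (A i)) ->
    P [set w | forall i, (i < n)%N -> A i (Z i w)] =
    (\prod_(i < n) P [set w | A i (Z i w)])%E.
Variables (a : nat -> R) (rho : 'rV[R]_d -> R).
Hypothesis intensity : forall A, measurable A -> nbhs (0 : 'rV[R]_d) (~` A) ->
  n%:R * nu [set z | A ((a n)^-1 *: z)] @[n --> \oo] -->
  fine (\int[lebesgue_rV R d]_(z in A) (rho z)%:E)%E.
Context dT' (T' : measurableType dT') (Q : probability T' R).
Variable N : T' -> {measure set 'rV[R]_d -> \bar R}.
Hypothesis ppN : poisson_process Q rho N.
Variables (phi : 'rV[R]_d -> R) (M r : R).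
Hypotheses (cphi : continuous phi) (phiM : forall x, `|phi x| <= M).
Hypotheses (r0 : 0 < r) (phi0 : forall x, `|x| < r -> phi x = 0).

Let S n w := \sum_(z <- sample_cloud Z a n w) phi z.
Let Y w := \int[N w]_z phi z.
Let mphi : measurable_fun setT phi. Proof. exact: continuous_measurable_rV. Qed.
Let M0 : 0 <= M. Proof. exact: le_trans (normr_ge0 _) (phiM 0). Qed.

Let far : set 'rV[R]_d := [set z | r <= `|z|].

Let mfar : measurable far.
Proof.
rewrite (_ : far = ~` [set z | `|z - 0| < r]).
  by apply: measurableC; exact: measurable_rV_ball.
by apply/seteqP; split => z /=; rewrite subr0 /far/= leNgt => /negP.
Qed.

Let nfar : nbhs (0 : 'rV[R]_d) (~` far).
Proof. exact: nbhs0_far r0 _. Qed.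

Let Nfin A w : measurable A -> nbhs (0 : 'rV[R]_d) (~` A) -> (N w A < +oo)%E.
Proof. by move=> mA nA; have [m ->] := pp_count ppN w mA nA; rewrite ltry. Qed.

Let mS n : measurable_fun setT (S n).
Proof.
rewrite /S; under eq_fun do rewrite big_map.
apply: measurable_sum => i; apply: measurableT_comp => //.
by apply: measurableT_comp; [exact: measurable_scale|exact: measurable_funPT].
Qed.

(** The integral against a random measure is a pointwise limit of combinations of the measurable
    counts: for mesh [1 / n.+1] the error is at most the mesh times the finite number of points in
    [far]. *)
Let mY : measurable_fun setT Y.
Proof.
have /choice[g hg] n : exists g : T' -> R, measurable_fun setT g /\
    forall w, `|Y w - g w| <= n.+1%:R^-1 * fine (N w far).
  have del0 : 0 < n.+1%:R^-1 :> R by rewrite invr_gt0.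
  have [J [A [c [mA farA tA _ hphi]]]] := level_partition cphi phiM phi0 del0.
  have nA j : nbhs (0 : 'rV[R]_d) (~` A j) by apply: nbhs0_far r0 _; exact: farA.
  exists (fun w => \sum_j c j * fine (N w (A j))); split.
    apply: measurable_sum => j; apply: measurable_funM => //.
    by apply: (measurableT_comp (fine_measurable measurableT)); exact: (pp_measurable ppN).
  move=> w.
  have NA j : (N w (A j) < +oo)%E by exact: Nfin.
  apply: le_trans (measure_step_approx mphi mA NA hphi) _.
  rewrite -mulr_sumr ler_wpM2l ?(ltW del0)// sum_fine; last first.
    by move=> j _; rewrite ge0_fin_numE.
  rewrite fine_le//.
  - by apply/sum_fin_numP => j _ _; rewrite ge0_fin_numE.
  - by rewrite ge0_fin_numE// Nfin.
  rewrite -measure_bigsetU_ord//; apply: le_measure; rewrite ?inE//.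
    exact: bigsetU_measurable.
  by rewrite -bigcup_ord => z [j _]; exact: farA.
apply: (@measurable_fun_cvg _ _ _ _ g) => [n|w _]; first by have [] := hg n.
apply/cvgrPdist_le => e e0.
have he : harmonic n * fine (N w far) @[n --> \oo] --> (0 : R).
  by rewrite -(mul0r (fine (N w far))); apply: cvgM; [exact: cvg_harmonic|exact: cvg_cst].
have /cvgr_lt/(_ _ e0) := he; apply: filterS => n hn.
by apply: le_trans ((hg n).2 w) _; exact: ltW.
Qed.

(** Both expectations are compared with one finite sum over count vectors. Only the Poisson side
    needs a truncation estimate: the total probability of the retained count vectors converges, so
    the clouds inherit it. *)
Lemma cloud_cvg_in_distribution : cvg_in_distribution P S Q Y.
Proof.
move=> u [cu [Mu uM]].
have Mu0 : 0 <= Mu by exact: le_trans (normr_ge0 _) (uM 0).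
have mu : measurable_fun setT u by exact: continuous_measurable_fun.
have muS n : measurable_fun setT (u \o S n) by exact: measurableT_comp.
have muY : measurable_fun setT (u \o Y) by exact: measurableT_comp.
rewrite (bounded_expectation Q muY (fun=> uM _)).
under eq_fun do rewrite (bounded_expectation P (muS _) (fun=> uM _)).
apply: cvg_EFin; first exact: nearW.
apply/cvgrPdist_le => e e0 /=.
(* Three errors [eps] come from the oscillation of [u] on the two sides and the convergence of the
   sums; the leftover probabilities, [eps] for the Poisson process and [2 * eps] for the cloud, are
   weighted by [Mu]. *)
pose eps := e / (3 + 3 * Mu).
have eps0 : 0 < eps by rewrite divr_gt0//; lra.
pose F K := [set w | (N w far <= K%:R%:E)%E].
have mF K : measurable (F K).
  rewrite -[F K]setTI; apply: emeasurable_fun_infty_c => //.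
  exact: (pp_measurable ppN).
(* Realizations have finitely many points in [far], so the events [F K] exhaust the space. *)
have [K hK] : exists K : nat, 1 - eps < fine (Q (F K)).
  have h : Q (F n) @[n --> \oo] --> Q (\bigcup_n F n).
    apply: nondecreasing_cvg_mu => //; first exact: bigcupT_measurable.
    move=> i j ij; rewrite subsetEset => w /= /le_trans; apply.
    by rewrite lee_fin ler_nat.
  rewrite (_ : \bigcup_n _ = setT) in h; last first.
    rewrite -subTset => w _; have [m hm] := pp_count ppN w mfar nfar.
    by exists m => //=; rewrite /F/= hm.
  rewrite probability_setT in h.
  have /fine_cvgP[_ h2] := h.
  have e1 : 1 - eps < 1 by rewrite gtrBl.
  have [n _ hn] := cvgr_gt _ h2 _ e1.
  by exists n; exact: (hn n (leqnn n)).
have [del0 del00 hdel0] := continuous_segment_uniform (M * K%:R) cu eps0.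
(* With at most [K] far points the accumulated error stays strictly below [del0], even for
   [K = 0]. *)
pose del := del0 / K.+1%:R.
have del_gt0 : 0 < del by rewrite divr_gt0.
have delK (m : nat) : (m <= K)%N -> del * m%:R < del0.
  move=> mK; rewrite /del mulrAC ltr_pdivrMr// ltr_pM2l// ltr_nat.
  by rewrite ltnS.
have [J [A [c [mA farA tA cM hphi]]]] := level_partition cphi phiM phi0 del_gt0.
have nA j : nbhs (0 : 'rV[R]_d) (~` A j) by apply: nbhs0_far r0 _; exact: farA.
have NA j w : (N w (A j) < +oo)%E by exact: Nfin.
(* A finite type, so that the limit may be taken term by term; the bound on the sum also keeps the
   step values inside the segment where [u] is uniformly continuous. *)
pose I := {m : {ffun 'I_J -> 'I_K.+1} | (\sum_j m j <= K)%N}.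
pose v (i : I) := u (\sum_j c j * (val i j)%:R).
have hclose (i : I) y : `|y - \sum_j c j * (val i j)%:R| <= \sum_j del * (val i j)%:R ->
    `|u y - v i| <= eps.
  move=> hy; rewrite distrC ltW//; apply: hdel0.
    apply: le_trans (ler_norm_sum _ _ _) _.
    apply: (@le_trans _ _ (\sum_j M * (val i j)%:R)).
      by apply: ler_sum => j _; rewrite normrM normr_nat ler_wpM2r.
    by rewrite -mulr_sumr ler_wpM2l// -natr_sum ler_nat (valP i).
  rewrite distrC (le_lt_trans hy)// -mulr_sumr -natr_sum delK//.
  exact: (valP i).
pose E n (i : I) := [set w | forall j, num_points (sample_cloud Z a n w) (A j) = val i j].
pose E' (i : I) := [set w | forall j, N w (A j) = ((val i j)%:R)%:E].
have mE n i : measurable (E n i).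
  apply: measurable_forall_ord => j.
  rewrite [X in measurable X](_ : _ =
    [set w | counts Z [set z | A j ((a n)^-1 *: z)] n w = val i j]).
    by apply: measurable_counts; exact: measurable_scale_set.
  by apply/seteqP; split => w /=; rewrite num_points_counts.
have mE' i : measurable (E' i).
  apply: measurable_forall_ord => j; rewrite -[X in measurable X]setTI.
  exact: (pp_measurable ppN (mA j) (nA j) measurableT (emeasurable_set1 ((val i j)%:R)%:E)).
have tE n : trivIset setT (E n).
  move=> i i' _ _ [w [Ei Ei']]; apply: val_inj; apply/ffunP => j.
  by apply: val_inj; rewrite /= -Ei -Ei'.
have tE' : trivIset setT E'.
  move=> i i' _ _ [w [Ei Ei']]; apply: val_inj; apply/ffunP => j.
  apply: val_inj => /=; apply/eqP; rewrite -(eqr_nat R); apply/eqP.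
  by apply: EFin_inj; rewrite -Ei -Ei'.
have hcvg i : fine (P (E n i)) @[n --> \oo] --> fine (Q (E' i)).
  have hr j := intensity (mA j) (nA j).
  rewrite (pp_law ppN (fun j => val i j : nat) (fun j => conj (mA j) (nA j)) tA).
  rewrite prodEFin /=; exact: (cloud_counts_cvg law indep mA tA hr).
have hS n : `|\int[P]_t (u \o S n) t - \sum_i v i * fine (P (E n i))| <=
    eps + Mu * (1 - \sum_i fine (P (E n i))).
  apply: (@expectation_events _ T R P I (E n) v (u \o S n) eps Mu (mE n) (tE n) (muS n)
    (fun=> uM _) (ltW eps0) _).2 => i w Ei.
  apply: hclose.
  have Ej (x : 'I_J -> R) : \sum_j x j * (num_points (sample_cloud Z a n w) (A j))%:R =
      \sum_j x j * (val i j)%:R.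
    by apply: eq_bigr => j _; rewrite Ei.
  by have := cloud_step_approx (sample_cloud Z a n w) hphi; rewrite !Ej.
have hY : `|\int[Q]_t (u \o Y) t - \sum_i v i * fine (Q (E' i))| <=
    eps + Mu * (1 - \sum_i fine (Q (E' i))).
  apply: (@expectation_events _ T' R Q I E' v (u \o Y) eps Mu mE' tE' muY
    (fun=> uM _) (ltW eps0) _).2 => i w Ei.
  apply: hclose.
  have Ej (x : 'I_J -> R) : \sum_j x j * fine (N w (A j)) = \sum_j x j * (val i j)%:R.
    by apply: eq_bigr => j _; rewrite Ei.
  by have := measure_step_approx mphi mA (fun j => NA j w) hphi; rewrite !Ej.
(* Every realization in [F K] has its count vector in [I], because the cells are disjoint subsets of
   [far]. *)
have hQ : 1 - \sum_i fine (Q (E' i)) < eps.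
  suff : fine (Q (F K)) <= \sum_i fine (Q (E' i)) by lra.
  have Qfin B : measurable B -> (Q B < +oo)%E.
    by move=> mB; rewrite (le_lt_trans (probability_le1 Q mB))// ltry.
  have [i1 e1] := step_integral (fun=> 1) mE' (fun i => Qfin _ (mE' i)).
  have [i2 e2] := step_integral (fun _ : 'I_1 => 1) (fun=> mF K) (fun=> Qfin _ (mF K)).
  rewrite big_ord1 mul1r in e2; rewrite -e2.
  have -> : \sum_i fine (Q (E' i)) = \sum_i 1 * fine (Q (E' i)).
    by apply: eq_bigr => i _; rewrite mul1r.
  rewrite -e1; apply: le_Rintegral => // w _; rewrite big_ord1 mul1r.
  have S0 (s : pred I) : 0 <= \sum_(i | s i) 1 * \1_(E' i) w :> R.
    by apply: sumr_ge0 => i _; rewrite mul1r.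
  have [Fw|nFw] := pselect (F K w); last by rewrite indicE memNset.
  have /choice[m hm] j := pp_count ppN w (mA j) (nA j).
  have sm : (\sum_j m j <= K)%N.
    rewrite -(ler_nat R) -lee_fin natr_sum -sumEFin.
    apply: le_trans Fw; rewrite (eq_bigr (fun j => N w (A j))); last by move=> j _; rewrite hm.
    rewrite -measure_bigsetU_ord//; apply: le_measure; rewrite ?inE//.
      exact: bigsetU_measurable.
    by rewrite -bigcup_ord => z [j _]; exact: farA.
  have mj j : (m j < K.+1)%N.
    by rewrite ltnS (leq_trans _ sm)// (bigD1 j)//= leq_addr.
  have hi : (\sum_j [ffun j => Ordinal (mj j)] j <= K)%N.
    by under eq_bigr do rewrite ffunE.
  pose i : I := exist _ [ffun j => Ordinal (mj j)] hi.
  rewrite (bigD1 i)//= !indicE !mem_set//; first by rewrite mul1r lerDl.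
  by move=> j /=; rewrite hm ffunE.
have h1 : \sum_i v i * fine (P (E n i)) @[n --> \oo] --> \sum_i v i * fine (Q (E' i)).
  apply: (@cvg_sum_fin _ _ (fun n i => v i * fine (P (E n i)))) => i.
  by apply: cvgM; [exact: cvg_cst|exact: hcvg].
have h2 : \sum_i fine (P (E n i)) @[n --> \oo] --> \sum_i fine (Q (E' i)).
  by apply: (@cvg_sum_fin _ _ (fun n i => fine (P (E n i)))) => i; exact: hcvg.
near=> n.
have h1n : `|\sum_i v i * fine (Q (E' i)) - \sum_i v i * fine (P (E n i))| <= eps.
  by near: n; move/cvgrPdist_le : h1; exact.
have h2n : `|\sum_i fine (Q (E' i)) - \sum_i fine (P (E n i))| <= eps.
  by near: n; move/cvgrPdist_le : h2; exact.
have -> : e = eps + eps + eps + Mu * eps + Mu * (eps + eps).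
  by rewrite /eps; field; lra.
have {}hS := hS n.
have h3 : Mu * (1 - \sum_i fine (P (E n i))) <= Mu * (eps + eps).
  rewrite ler_wpM2l//; move: h2n; rewrite ler_norml => /andP[_]; lra.
have h4 : Mu * (1 - \sum_i fine (Q (E' i))) <= Mu * eps by rewrite ler_wpM2l// ltW.
move: hS hY h1n; rewrite !ler_norml => /andP[? ?] /andP[? ?] /andP[? ?].
by apply/andP; split; lra.
Unshelve. all: by end_near. Qed.

End poisson_convergence.

(** * Regular variation of the density *)

Section regular_variation.
Variables (R : realType) (d : nat) (f : 'rV[R]_d -> R) (lambda : R).
Hypotheses (lambda0 : 0 < lambda) (Ff : class_F lambda f).
Local Notation p := (lambda + d%:R).
Local Notation e1 := (const_mx 1 : 'rV[R]_d).

Lemma near_pinfty_ge (P : R -> Prop) : (\forall x \near +oo, P x) ->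
  exists2 M, 0 < M & forall x, M <= x -> P x.
Proof.
move=> [M [_ hM]]; exists (`|M| + 1); first by rewrite ltr_pwDr.
by move=> x Mx; apply: hM; rewrite (le_lt_trans (ler_norm _))// (lt_le_trans _ Mx)// ltrDl.
Qed.

(** Collects what later arguments use of the class: [fs] varies regularly with exponent [- p], and
    boundedness of [D] makes the gauge dominate a multiple of the norm. *)
Lemma class_F_profile : exists (fs : R -> R) (nD : 'rV[R]_d -> R) (c : R),
  [/\ (forall r, 0 <= r -> 0 < fs r),
      (forall r s, 0 <= r -> r <= s -> fs s <= fs r),
      (forall t, 0 < t -> fs (t * r) / fs r @[r --> +oo] --> t `^ (- p)),
      [/\ 0 < c, (forall z, c * `|z| <= nD z), (forall z, z != 0 -> 0 < nD z) &
          (forall k z, 0 <= k -> nD (k *: z) = k * nD z)] &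
      (forall eps, 0 < eps -> exists2 M, 0 < M &
         forall z, M <= `|z| -> `|f z / fs (nD z) - 1| < eps)].
Proof.
have [pf f0 cf [fs [L [D [nD [cfs fsd [rvL fsL] [[bD oD D0 sD] [[nD0 DE nDZ] cnD]] lim]]]]]] := Ff.
have [[A [L0 _]] hL] := rvL.
have p0 : 0 < p by rewrite ltr_pwDl// ler0n.
have fs0 r : 0 <= r -> 0 < fs r.
  (* Positivity of [L] is only known beyond [A]; monotonicity of [fs] carries it back from [s] to
     [r]. *)
  move=> r0; pose s := Num.max r (Num.max A 0 + 1).
  have As : A < s by rewrite /s lt_max; apply/orP; right; rewrite ltr_pwDr// le_max lexx.
  have s0 : 0 < s by rewrite /s lt_max; apply/orP; right; rewrite ltr_pwDr// le_max lexx orbT.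
  apply: (@lt_le_trans _ _ (fs s)); last by apply: fsd => //; rewrite /s le_max lexx.
  by rewrite fsL// divr_gt0// ?L0// powR_gt0.
have [M [Mr hM]] := bD.
pose B := `|M| + 1.
have B0 : 0 < B by rewrite ltr_pwDr.
have DB z : D z -> `|z| <= B.
  by move=> Dz; apply: (hM B) => //; rewrite (le_lt_trans (ler_norm _))// ltrDl.
(* [D] lies in the ball of radius [B]; a point violating the gauge bound could be rescaled into [D]
   with norm [2 * B], a contradiction. *)
exists fs, nD, (B + B)^-1; split => //.
- move=> t t0.
  have h : (L (t * r) / L r) * t `^ (- p) @[r --> +oo] --> t `^ (- p).
    rewrite -[X in _ --> X]mul1r; apply: cvgM; last exact: cvg_cst.
    by have := hL t t0; rewrite powRr0.
  apply: cvg_trans h; apply: near_eq_cvg; near=> r.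
  have r0 : 0 < r by near: r; exact: nbhs_pinfty_gt.
  have Ar : A < r by near: r; apply: nbhs_pinfty_gt; exact: num_real.
  have Lr : 0 < L r by exact: L0.
  rewrite !fsL ?mulr_gt0// powRM ?ltW// powRN; field.
  by rewrite !gt_eqF// powR_gt0.
- split => //; first by rewrite invr_gt0 addr_gt0.
  move=> z; have [->|z0] := eqVneq z 0.
    by rewrite normr0 mulr0 -(scale0r (0 : 'rV[R]_d)) nDZ// mul0r.
  have nz : 0 < `|z| by rewrite normr_gt0.
  rewrite leNgt; apply/negP => h.
  have /DB : D (((B + B) / `|z|) *: z).
    rewrite DE /= nDZ; last by rewrite divr_ge0 ?addr_ge0// ltW.
    have BB : 0 < B + B by rewrite addr_gt0.
    have hh : (B + B) * nD z < `|z| by rewrite -ltr_pdivlMl.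
    by rewrite mulrAC ltr_pdivrMr// mul1r.
  have BB0 : 0 <= (B + B) / `|z| by rewrite divr_ge0 ?addr_ge0// ltW.
  rewrite normrZ (ger0_norm BB0) divfK ?gt_eqF//; lra.
- move=> eps eps0; have [M' M'0 hM'] := near_pinfty_ge (lim _ eps0).
  exists M' => // z Mz; apply: (hM' _ (lexx _)).
  by rewrite (le_trans Mz)// le_norm_enorm.
Unshelve. all: by end_near. Qed.

Lemma const1_neq0 : (0 < d)%N -> e1 != 0.
Proof.
case: d => // n _; apply/eqP => /matrixP/(_ ord0 ord0); rewrite !mxE => /eqP.
by rewrite oner_eq0.
Qed.

Lemma cvgy_scale_norm (w : 'rV[R]_d) (M : R) : w != 0 ->
  \forall r \near +oo, M <= `|r *: w|.
Proof.
move=> w0; have nw : 0 < `|w| by rewrite normr_gt0.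
near=> r; have r0 : 0 < r by near: r; exact: nbhs_pinfty_gt.
rewrite normrZ gtr0_norm// -ler_pdivrMr//.
Unshelve. all: by end_near. Qed.

(** On both rays [f] is asymptotic to [fs] of the gauge, so the limit is the power [- p] of
    [nD w / nD e1], which is positive. *)
Lemma tail_limit_cvg (w : 'rV[R]_d) : (0 < d)%N -> w != 0 ->
  0 < tail_limit f w /\ f (r *: w) / f (r *: e1) @[r --> +oo] --> tail_limit f w.
Proof.
move=> d0 w0; have e0 := const1_neq0 d0.
have [pf f0 cf _] := Ff.
have [fs [nD [c [fs0 fsd fsreg [c0 nDc nD0 nDZ] hlim]]]] := class_F_profile.
pose l := (nD w / nD e1) `^ (- p).
suff h : f (r *: w) / f (r *: e1) @[r --> +oo] --> l.
  by rewrite /tail_limit (cvg_lim _ h)//; split => //; rewrite powR_gt0 ?divr_gt0 ?nD0.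
have lim1 z : z != 0 -> f (r *: z) / fs (nD (r *: z)) @[r --> +oo] --> (1 : R).
  move=> z0; apply/cvgrPdist_lt => eps /hlim[M _ hM].
  have := cvgy_scale_norm M z0; apply: filterS => r /hM.
  by rewrite distrC.
have lim2 : fs (nD w / nD e1 * (nD e1 * r)) / fs (nD e1 * r) @[r --> +oo] --> l.
  have := fsreg (nD w / nD e1) (divr_gt0 (nD0 _ w0) (nD0 _ e0)).
  move=> h A /h; rewrite !near_simpl => hA.
  exact: (near_pinfty_scale (nD0 _ e0) (P := fun s => A (fs (nD w / nD e1 * s) / fs s))).
have h : (f (r *: w) / fs (nD (r *: w))) / (f (r *: e1) / fs (nD (r *: e1))) *
   (fs (nD w / nD e1 * (nD e1 * r)) / fs (nD e1 * r)) @[r --> +oo] --> 1 / 1 * l.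
  apply: cvgM => //; apply: cvgM; first exact: lim1.
  by apply: cvgV; [exact: oner_neq0|exact: lim1].
rewrite divr1 mul1r in h; apply: cvg_trans h; apply: near_eq_cvg; near=> r.
have r0 : 0 < r by near: r; exact: nbhs_pinfty_gt.
have nDe := nD0 _ e0; have nDw := nD0 _ w0.
have -> : nD w / nD e1 * (nD e1 * r) = r * nD w.
  by rewrite mulrA divfK ?gt_eqF// mulrC.
rewrite !nDZ ?ltW// [nD e1 * r]mulrC.
have h1 : fs (r * nD w) != 0 by rewrite gt_eqF// fs0// mulr_ge0// ltW.
have h2 : fs (r * nD e1) != 0 by rewrite gt_eqF// fs0// mulr_ge0// ltW.
have h3 : f (r *: e1) != 0 by rewrite gt_eqF.
by field; rewrite h1 h2 h3.
Unshelve. all: by end_near. Qed.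

(* The shell [2 ^+ j * rho <= `|w| < 2 ^+ j.+1 * rho] has volume of order
   [2 ^+ (j * d)], so [q * 2 ^+ d < 1] makes the bound integrable. *)
Lemma density_ratio_bound (rho : R) : (0 < d)%N -> 0 < rho ->
  exists C q T, [/\ 0 < C, 0 < q, q * 2 ^+ d < 1, 0 < T & forall t w j, T <= t ->
    2 ^+ j * rho <= `|w| -> f (t *: w) / f (t *: e1) <= C * q ^+ j].
Proof.
move=> d0 rho0; have e0 := const1_neq0 d0.
have [pf f0 cf _] := Ff.
have [fs [nD [c [fs0 fsd fsreg [c0 nDc nD0 nDZ] hlim]]]] := class_F_profile.
have nDe := nD0 _ e0.
have p2 : 2 `^ (- p) < 2 `^ (- d%:R).
  rewrite /powR gt_eqF// ltr_expR ltr_pM2r ?ltrN2 ?ltrDr//.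
  by rewrite ln_gt0// ltr1n.
(* Above the limit of [fs (2 * s) / fs s], so that doubling costs at most [q]; below [2 ^ (- d)], so
   that [q * 2 ^+ d < 1]. The gap exists because [lambda > 0]. *)
pose q := (2 `^ (- p) + 2 `^ (- d%:R)) / 2.
have q0 : 0 < q by rewrite divr_gt0// addr_gt0// powR_gt0.
have q1 : q * 2 ^+ d < 1.
  rewrite -powR_mulrn// -ltr_pdivlMr ?powR_gt0// mul1r -powRN /q; lra.
have pq : 2 `^ (- p) < q by rewrite /q; lra.
clearbody q.
have [s0 s00 hs0] : exists2 s0, 0 < s0 & forall s, s0 <= s -> fs (2 * s) <= q * fs s.
  have : \forall s \near +oo, fs (2 * s) / fs s < q.
    by apply: (cvgr_lt _ (fsreg 2 _)).
  move=> /near_pinfty_ge[s0 s00 h]; exists s0 => // s hs.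
  rewrite -ler_pdivrMr; first exact/ltW/h.
  by rewrite fs0// (le_trans _ hs)// ltW.
have hpow j s : s0 <= s -> fs (2 ^+ j * s) <= q ^+ j * fs s.
  move=> hs; elim: j => [|j IH]; first by rewrite !expr0 !mul1r.
  rewrite !exprS -!mulrA; apply: (@le_trans _ _ (q * fs (2 ^+ j * s))).
    apply: hs0; rewrite (le_trans hs)// ler_peMl//; first by rewrite (le_trans _ hs)// ltW.
    by rewrite exprn_ege1// ler1n.
  by rewrite ler_pM2l.
have h2 : (0 : R) < 2^-1 by rewrite invr_gt0.
have [M M0 hM] := hlim _ h2.
(* Converts the scale [t * (c * rho)], the lower bound for the gauge on the first shell, into the
   scale [t * nD e1] of the denominator. *)
pose K := c * rho / nD e1.
have K0 : 0 < K by rewrite divr_gt0// mulr_gt0.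
have [T1 T10 hT1] : exists2 T1, 0 < T1 & forall t, T1 <= t ->
    fs (t * (c * rho)) <= (K `^ (- p) + 1) * fs (t * nD e1).
  have : \forall s \near +oo, fs (K * s) / fs s < K `^ (- p) + 1.
    by apply: (cvgr_lt _ (fsreg K _)) => //; rewrite ltrDl.
  move=> /near_pinfty_ge[s1 s10 h]; exists (s1 / nD e1); first by rewrite divr_gt0.
  move=> t ht; have tn : s1 <= t * nD e1 by rewrite -ler_pdivrMr.
  have := h _ tn; rewrite ltr_pdivrMr; last by rewrite fs0// (le_trans _ tn)// ltW.
  by rewrite (_ : K * _ = t * (c * rho)); [exact: ltW|rewrite /K; field; rewrite gt_eqF].
have ne : 0 < `|e1| by rewrite normr_gt0.
(* A sum of positive thresholds exceeds each of them. *)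
pose T := T1 + s0 / (c * rho) + M / rho + M / `|e1|.
have crho : 0 < c * rho by rewrite mulr_gt0.
have a1 : 0 < s0 / (c * rho) by rewrite divr_gt0.
have a2 : 0 < M / rho by rewrite divr_gt0.
have a3 : 0 < M / `|e1| by rewrite divr_gt0.
(* The 4 covers the two replacements of [f] by [fs], each within a factor 2. *)
exists (4 * (K `^ (- p) + 1)), q, T; split => //.
- by rewrite mulr_gt0// ltr_wpDl// powR_ge0.
- by rewrite /T; lra.
move=> t w j Tt jw.
have t0 : 0 < t by rewrite (lt_le_trans _ Tt)// /T; lra.
have tM : M <= `|t *: w|.
  rewrite normrZ gtr0_norm//; apply: (@le_trans _ _ (t * rho)).
    by rewrite -ler_pdivrMr//; apply: le_trans Tt; rewrite /T; lra.
  rewrite ler_pM2l//; apply: le_trans jw; rewrite ler_peMl ?(ltW rho0)//.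
  by rewrite exprn_ege1// ler1n.
have tMe : M <= `|t *: e1|.
  rewrite normrZ gtr0_norm// -ler_pdivrMr//; apply: le_trans Tt; rewrite /T; lra.
have fsw : 0 < fs (nD (t *: w)).
  by rewrite fs0// (le_trans _ (nDc _))// mulr_ge0// ltW.
have fse : 0 < fs (nD (t *: e1)).
  by rewrite fs0// (le_trans _ (nDc _))// mulr_ge0// ltW.
have : f (t *: w) <= 2 * fs (nD (t *: w)).
  have := hM _ tM; rewrite ltr_distl => /andP[_ hh].
  by rewrite -ler_pdivrMr//; lra.
have : fs (nD (t *: e1)) <= 2 * f (t *: e1).
  have := hM _ tMe; rewrite ltr_distl => /andP[hh _].
  have : 2^-1 <= f (t *: e1) / fs (nD (t *: e1)) by lra.
  by rewrite ler_pdivlMr// => ?; lra.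
rewrite (nDZ _ e1 (ltW t0)) => h3 h4.
have h5 : fs (nD (t *: w)) <= q ^+ j * fs (t * (c * rho)).
  apply: (@le_trans _ _ (fs (2 ^+ j * (t * (c * rho))))); last first.
    by apply: hpow; rewrite -ler_pdivrMr//; apply: le_trans Tt; rewrite /T; lra.
  apply: fsd; first by rewrite mulr_ge0 ?exprn_ge0// mulr_ge0// ltW.
  rewrite (nDZ _ _ (ltW t0)); apply: (@le_trans _ _ (t * (c * `|w|))); last by rewrite ler_pM2l.
  rewrite (_ : 2 ^+ j * _ = t * (c * (2 ^+ j * rho))); last by ring.
  by rewrite ler_pM2l// ler_pM2l.
have h6 : fs (t * (c * rho)) <= (K `^ (- p) + 1) * fs (t * nD e1).
  by apply: hT1; apply: le_trans Tt; rewrite /T; lra.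
rewrite ler_pdivrMr//.
apply: (le_trans h4); apply: (@le_trans _ _ (2 * (q ^+ j * ((K `^ (- p) + 1) * (2 * f (t *: e1)))))).
  rewrite ler_pM2l//; apply: (le_trans h5); rewrite ler_pM2l ?exprn_gt0//.
  apply: (le_trans h6); rewrite ler_pM2l//.
  by rewrite ltr_wpDl// powR_ge0.
by rewrite le_eqVlt; apply/orP; left; apply/eqP; ring.
Qed.

Lemma density_scale_ge (A : R) : 0 < A -> exists c M, [/\ 0 < c, 0 < M &
  forall z, M <= `|z| -> c * f z <= f (A *: z)].
Proof.
move=> A0; have [pf f0 cf _] := Ff.
have [fs [nD [c [fs0 fsd fsreg [c0 nDc nD0 nDZ] hlim]]]] := class_F_profile.
have h2 : (0 : R) < 2^-1 by rewrite invr_gt0.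
have [M M0 hM] := hlim _ h2.
have Ap : 0 < A `^ (- p) by rewrite powR_gt0.
have : \forall s \near +oo, A `^ (- p) / 2 < fs (A * s) / fs s.
  apply: (cvgr_gt _ (fsreg A A0)); lra.
move=> /near_pinfty_ge[s0 s00 hs0].
have a1 : 0 < s0 / c by rewrite divr_gt0.
have a2 : 0 < M / A by rewrite divr_gt0.
(* One factor 2 for the limit of [fs (A * s) / fs s] and one for each of the two comparisons of [f]
   with [fs]. *)
exists (A `^ (- p) / 8), (M + M / A + s0 / c); split; [lra|lra|].
move=> z Mz.
have zM : M <= `|z| by lra.
have AzM : M <= `|A *: z|.
  by rewrite normrZ gtr0_norm// mulrC -ler_pdivrMr//; lra.
have nz : s0 <= nD z.
  apply: le_trans (nDc z); rewrite mulrC -ler_pdivrMr//; lra.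
have fsz : 0 < fs (nD z) by rewrite fs0//; lra.
have fsAz : 0 < fs (nD (A *: z)) by rewrite nDZ ?ltW// fs0// mulr_ge0//; lra.
have h3 : f z <= 2 * fs (nD z).
  have := hM _ zM; rewrite ltr_distl => /andP[_ hh].
  by rewrite -ler_pdivrMr//; lra.
have h4 : fs (nD (A *: z)) <= 2 * f (A *: z).
  have := hM _ AzM; rewrite ltr_distl => /andP[hh _].
  have : 2^-1 <= f (A *: z) / fs (nD (A *: z)) by lra.
  by rewrite ler_pdivlMr// => ?; lra.
have h5 : A `^ (- p) / 2 * fs (nD z) < fs (nD (A *: z)).
  by rewrite nDZ ?(ltW A0)// -ltr_pdivlMr// hs0.
have h6 : A `^ (- p) / 8 * f z <= A `^ (- p) / 8 * (2 * fs (nD z)).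
  by rewrite ler_pM2l//; lra.
by lra.
Qed.

End regular_variation.

Definition coord_planes (R : realType) (d : nat) : set 'rV[R]_d :=
  [set z | exists i, z ord0 i = 0].

(** * Dominated convergence for the rescaled density *)

Section regular_variation_limit.
Variables (R : realType) (d : nat) (f : 'rV[R]_d -> R) (lambda : R).
Hypotheses (d0 : (0 < d)%N) (lambda0 : 0 < lambda) (Ff : class_F lambda f).
Local Notation e1 := (const_mx 1 : 'rV[R]_d).
Local Notation mu := (lebesgue_rV R d).

Let f_gt0 z : 0 < f z. Proof. by case: Ff. Qed.
Let mf : measurable_fun setT f. Proof. by case: Ff => -[]. Qed.

Lemma lebesgue_coord_planes : mu (@coord_planes R d) = 0.
Proof.
have mh i : measurable [set z : 'rV[R]_d | z ord0 i = 0].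
  exact: (measurable_coord_preimage i (measurable_set1 0)).
rewrite (_ : @coord_planes R d = \big[setU/set0]_(i < d) [set z : 'rV[R]_d | z ord0 i = 0]).
  suff [] : measurable (\big[setU/set0]_(i < d) [set z : 'rV[R]_d | z ord0 i = 0]) /\
    mu (\big[setU/set0]_(i < d) [set z : 'rV[R]_d | z ord0 i = 0]) = 0 by [].
  apply: (big_ind (fun B : set 'rV[R]_d => measurable B /\ mu B = 0)).
  - by split => //; exact: measure0.
  - move=> B B' [mB B0] [mB' B'0]; split; first exact: measurableU.
    exact: null_set_setU.
  - by move=> i _; split; [exact: mh|exact: lebesgue_rV_hyperplane].
by rewrite -bigcup_ord; apply/seteqP; split => z [i]; [exists i|move=> _ ?; exists i].
Qed.

Lemma measurable_coord_planes : measurable (@coord_planes R d).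
Proof.
rewrite (_ : @coord_planes R d = \bigcup_i [set z : 'rV[R]_d | z ord0 i = 0]).
  apply: countable_bigcupT_measurable => // i.
  exact: (measurable_coord_preimage i (measurable_set1 0)).
by apply/seteqP; split => z [i]; [exists i|move=> _ ?; exists i].
Qed.

(** Off the origin it is a limit of measurable functions along the integers; at the origin its
    unspecified value sits on a single measurable point. *)
Lemma measurable_tail_limit : measurable_fun setT (tail_limit f).
Proof.
have m0 : measurable [set 0 : 'rV[R]_d].
  rewrite (_ : [set 0] = rect (fun=> [set 0])).
    by apply: measurable_rect => i; exact: measurable_set1.
  apply/seteqP; split => z /=; first by move=> -> i; rewrite mxE.
  by move=> h; apply/matrixP => i j; rewrite (ord1 i) mxE; exact: h.
have h : measurable_fun (~` [set (0 : 'rV[R]_d)]) (tail_limit f).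
  apply: (@measurable_fun_cvg _ _ R (~` [set (0 : 'rV[R]_d)])
    (fun n w => f (n%:R *: w) / f (n%:R *: e1))) => [n|w /eqP w0].
    apply: measurable_funTS; apply: measurable_funM => //.
    by apply: (measurableT_comp mf); exact: measurable_scale.
  have [_ hw] := tail_limit_cvg lambda0 Ff d0 w0.
  exact: (cvg_comp _ _ (@cvgr_idn R) hw).
rewrite -(setvU [set (0 : 'rV[R]_d)]); apply/measurable_funU => //.
  exact: measurableC.
split=> //; apply: (@eq_measurable_fun _ _ _ _ _ (cst (tail_limit f 0))) => //.
by move=> x; rewrite inE => ->.
Qed.

Variables (A : set 'rV[R]_d) (rho : R).
Hypotheses (mA : measurable A) (rho0 : 0 < rho) (Arho : forall w, A w -> rho <= `|w|).

(** The dominator sums [C * q ^+ j] over balls rather than shells. This only enlarges it, and the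
    integrals of its terms still form a geometric series of ratio [q * 2 ^+ d]. *)
Lemma exists_dominator (C q : R) : 0 < C -> 0 < q -> q * 2 ^+ d < 1 ->
  exists g : 'rV[R]_d -> \bar R, mu.-integrable A g /\
    forall w x, A w -> (forall j, 2 ^+ j * rho <= `|w| -> x <= C * q ^+ j) ->
      (x%:E <= g w)%E.
Proof.
move=> C0 q0 q1; pose B j := [set w : 'rV[R]_d | `|w - 0| < 2 ^+ j.+1 * rho].
have mB j : measurable (B j) by exact: measurable_rV_ball.
pose g w := (\sum_(0 <= j <oo) (C * q ^+ j * \1_(B j) w)%:E)%E.
have t0 j w : (0 <= (C * q ^+ j * \1_(B j) w)%:E)%E.
  by rewrite lee_fin !mulr_ge0// ?exprn_ge0// ltW.
have mt j : measurable_fun A (fun w => (C * q ^+ j * \1_(B j) w)%:E).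
  apply/measurable_EFinP; apply: measurable_funTS; exact: measurable_funM.
have mg : measurable_fun A g by apply: ge0_emeasurable_sum => // *.
exists g; split.
  apply/integrableP; split => //.
  under eq_integral do rewrite gee0_abs ?nneseries_ge0//.
  rewrite integral_nneseries//.
  (* The ball of index [j] lies in a cube of side [2 * (2 ^+ j.+1 * rho)]; this is [C] times its
     volume at [j = 0]. *)
  pose K := C * (2 * (2 * rho)) ^+ d.
  have K0 : 0 <= K by rewrite mulr_ge0 ?exprn_ge0 ?mulr_ge0// ltW.
  have hle j : (\int[mu]_(w in A) (C * q ^+ j * \1_(B j) w)%:E <=
      (K * (q * 2 ^+ d) ^+ j)%:E)%E.
    under eq_integral do rewrite EFinM.
    rewrite ge0_integralZl//; last 2 first.
    - by apply/measurable_EFinP.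
    - by rewrite lee_fin mulr_ge0 ?exprn_ge0// ltW.
    rewrite integral_indic//.
    have hB : (mu (B j `&` A) <= ((2 * (2 ^+ j.+1 * rho)) ^+ d)%:E)%E.
      rewrite -lebesgue_rV_box; last by rewrite mulr_ge0 ?exprn_ge0// ltW.
      apply: le_measure; rewrite ?inE; [exact: measurableI| |].
        by apply: measurable_rect => i; exact: measurable_itv.
      move=> w [wB _] i; rewrite /B/= subr0 in wB; rewrite /= in_itv/= -ler_norml.
      by rewrite (le_trans (rV_norm_coord _ _))// ltW.
    apply: (le_trans (lee_wpmul2l _ hB)).
      by rewrite lee_fin mulr_ge0 ?exprn_ge0// ltW.
    rewrite -EFinM lee_fin le_eqVlt; apply/orP; left; apply/eqP.
    rewrite /K exprS -[2 * 2 ^+ j * rho]mulrA [2 * (2 * _)]mulrA.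
    rewrite !exprMn -!exprM [(j * d)%N]mulnC; ring.
  apply: (@le_lt_trans _ _ (\sum_(0 <= j <oo) (K * (q * 2 ^+ d) ^+ j)%:E)%E).
    apply: lee_nneseries => j *; last exact: hle.
    by apply: integral_ge0 => *; exact: t0.
  have q2 : 0 < q * 2 ^+ d by rewrite mulr_gt0// exprn_gt0.
  have := @cvg_geometric_series R K (q * 2 ^+ d).
  rewrite gtr0_norm// => /(_ q1) hg.
  rewrite (_ : (\sum_(0 <= j <oo) _)%E = (K * (1 - q * 2 ^+ d)^-1)%:E) ?ltry//.
  apply/cvg_lim => //; apply: cvg_EFin.
    by apply: nearW => n; rewrite sumEFin.
  apply: cvg_trans hg; apply: near_eq_cvg; apply: nearW => n.
  by rewrite /= sumEFin.
move=> w x Aw hx.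
(* The least [j] with the first inequality is the shell index of [w]; for [j = 0] the second one is
   [Arho]. *)
have [j hj hmin] : exists2 j, `|w| < 2 ^+ j.+1 * rho & 2 ^+ j * rho <= `|w|.
  have ex : exists j, `|w| < 2 ^+ j.+1 * rho.
    exists (Num.truncn (`|w| / rho)); rewrite -ltr_pdivrMr//.
    apply: (lt_le_trans (truncnS_gt _)).
    by rewrite -natrX ler_nat ltnW// ltn_expl.
  have := ex_minnP ex; case=> j hj hmin; exists j => //.
  case: j hj hmin => [|j] hj hmin; first by rewrite expr0 mul1r; exact: Arho.
  by rewrite leNgt; apply/negP => /hmin; rewrite ltnn.
apply: (@le_trans _ _ (C * q ^+ j * \1_(B j) w)%:E).
  by rewrite indicE mem_set ?mulr1 ?lee_fin ?hx// /B/= subr0.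
rewrite /g; apply: (@le_trans _ _ (\sum_(0 <= i < j.+1) (C * q ^+ i * \1_(B i) w)%:E)%E).
  by rewrite big_nat_recr//= leeDr// sume_ge0.
by apply: nneseries_lim_ge => *.
Qed.

(** The modification is invisible in the limit: off the coordinate planes, a null set, [ft] and [f]
    eventually agree along each ray, and outside the unit ball [ft] inherits the domination of
    [f]. *)
Lemma tail_density_cvg (ft : 'rV[R]_d -> R) (t : nat -> R) :
  measurable_fun setT ft -> (forall z, 0 <= ft z) ->
  (forall z, 1 <= enorm z -> ft z <= f z) ->
  t n @[n --> \oo] --> +oo ->
  (forall w : 'rV[R]_d, (forall i, w ord0 i != 0) -> \forall n \near \oo, ft (t n *: w) = f (t n *: w)) ->
  mu.-integrable A (fun w => (tail_limit f w)%:E) /\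
  (\int[mu]_(w in A) (ft (t n *: w) / f (t n *: e1))%:E)%E @[n --> \oo] -->
    (\int[mu]_(w in A) (tail_limit f w)%:E)%E.
Proof.
move=> mft ft0 ftf ty fteq.
have [C [q [T [C0 q0 q1 T0 hT]]]] := density_ratio_bound lambda0 Ff d0 rho0.
have [g [ig hg]] := exists_dominator C0 q0 q1.
(* Domination starts only at [T], and [rho^-1] pushes [t n *: w] out of the unit ball; the sequence
   is shifted by [N] accordingly. *)
have [N hN] : exists N, forall n, (N <= n)%N -> Num.max T rho^-1 <= t n.
  have [N _ hN] : \forall n \near \oo, Num.max T rho^-1 <= t n.
    by move/cvgryPge : ty.
  by exists N => n Nn; exact: (hN n).
have [|||||ih _ hc] := @dominated_convergence _ _ R mu A mA
  (fun n w => (ft (t (n + N)%N *: w) / f (t (n + N)%N *: e1))%:E)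
  (fun w => (tail_limit f w)%:E) g.
- move=> n; apply/measurable_EFinP; apply: measurable_funTS; apply: measurable_funM => //.
  by apply: (measurableT_comp mft); exact: measurable_scale.
- apply/measurable_EFinP; apply: measurable_funTS; exact: measurable_tail_limit.
- exists (@coord_planes R d); split.
  + exact: measurable_coord_planes.
  + exact: lebesgue_coord_planes.
  move=> w /=; apply: contra_notP => w0 Aw.
  have wi i : w ord0 i != 0 by apply/eqP => wi; apply: w0; exists i.
  have wn0 : w != 0.
    by apply/eqP => wz; have := Arho Aw; rewrite wz normr0 leNgt rho0.
  have [_ hw] := tail_limit_cvg lambda0 Ff d0 wn0.
  apply: cvg_EFin; first exact: nearW.
  rewrite (cvg_shiftn N (fun n => ft (t n *: w) / f (t n *: e1))).
  have htw : f (t n *: w) / f (t n *: e1) @[n --> \oo] --> tail_limit f w.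
    exact: (cvg_comp _ _ ty hw).
  apply: cvg_trans htw; apply: near_eq_cvg; have := fteq w wi.
  by apply: filterS => n ->.
- exact: ig.
- apply: aeW => w n Aw.
  have := hN (n + N)%N (leq_addl _ _); set s := t _; rewrite ge_max => /andP[Ts rhos].
  rewrite gee0_abs ?lee_fin ?divr_ge0// ?(ltW (f_gt0 _))//.
  apply: hg => // j jw; apply: le_trans (hT s w j Ts jw).
  rewrite ler_pM2r ?invr_gt0//; apply: ftf.
  apply: le_trans (le_norm_enorm _); have s0 : 0 < s by exact: lt_le_trans Ts.
  rewrite normrZ gtr0_norm// -ler_pdivrMr ?mul1r; last first.
    by rewrite (lt_le_trans rho0)// Arho.
  by apply: le_trans rhos; rewrite lef_pV2 ?posrE// ?Arho// (lt_le_trans rho0)// Arho.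
split=> //.
by move: hc => /=; rewrite (cvg_shiftn N (fun n => \int[mu]_(w in A) (ft (t n *: w) / f (t n *: e1))%:E)%E).
Qed.

End regular_variation_limit.

(** * Margins and meta densities *)

Section densities_rV.
Variables (R : realType) (d : nat).
Local Notation mu := (lebesgue_rV R d).

Lemma iid_sample_law dT (T : measurableType dT) (P : probability T R)
    (F f : 'rV[R]_d -> R) (Z : nat -> {RV P >-> 'rV[R]_d}) :
  has_density F f -> iid_sample F Z ->
  forall i A, measurable A ->
    P [set w | A (Z i w)] = (fine (\int[mu]_(z in A) (f z)%:E))%:E.
Proof.
move=> [[mf f0 f1] Ff] [ZF _] i A mA.
pose nu := density_measure mu mf f0.
have mZ : measurable_fun setT (Z i) by exact: measurable_funPT.
pose m := measure_function_pushforward__canonical__measure_function_Measure P mZ.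
have nu1 B : measurable B -> (nu B <= 1)%E.
  by move=> mB; rewrite -f1; apply: (@le_measure _ _ _ nu); rewrite ?inE.
rewrite fineK; last first.
  by rewrite ge0_fin_numE ?(le_lt_trans (nu1 A mA)) ?ltry//; apply: (measure_ge0 nu).
suff h : m A = nu A by exact: h.
apply: measure_eq_orthant => // [x|x]; first by rewrite -[LHS]/(P _) ZF -Ff.
rewrite -[X in (X < _)%E]/(P _) (le_lt_trans (probability_le1 P _)) ?ltry//.
exact: (@measurable_RV_preimage _ _ _ P _ _ Z i _ (measurable_orthant x)).
Qed.

Lemma weighted_integral (f : 'rV[R]_d -> R) (W1 W2 A : set 'rV[R]_d) (k : R) :
  measurable_fun setT f -> (forall z, 0 <= f z) -> 0 <= k ->
  measurable W1 -> measurable W2 -> measurable A ->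
  (\int[mu]_(z in A) (f z * (\1_W1 z + k * \1_W2 z))%:E =
   \int[mu]_(z in A `&` W1) (f z)%:E + k%:E * \int[mu]_(z in A `&` W2) (f z)%:E)%E.
Proof.
move=> mf f0 k0 mW1 mW2 mA.
have hi W : measurable W -> (\int[mu]_(z in A) (f z * \1_W z)%:E =
    \int[mu]_(z in A `&` W) (f z)%:E)%E.
  move=> mW; rewrite [RHS]integral_mkcondr; apply: eq_integral => z _.
  rewrite /patch indicE; case: (z \in W); first by rewrite mulr1.
  by rewrite mulr0.
have mfW W : measurable W -> measurable_fun A (fun z => (f z * \1_W z)%:E).
  by move=> mW; apply/measurable_EFinP; apply: measurable_funTS; exact: measurable_funM.
have fW W z : (0 <= (f z * \1_W z)%:E)%E by rewrite lee_fin mulr_ge0.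
transitivity (\int[mu]_(z in A) ((f z * \1_W1 z)%:E + k%:E * (f z * \1_W2 z)%:E))%E.
  by apply: eq_integral => z _; rewrite -EFinM -EFinD; congr EFin; ring.
rewrite ge0_integralD//.
- by rewrite hi// ge0_integralZl ?hi//; exact: mfW.
- exact: mfW.
- by move=> z _; rewrite mule_ge0.
- by apply: emeasurable_funM => //; exact: mfW.
Qed.

End densities_rV.

Section margins.
Variables (R : realType) (d : nat) (f : 'rV[R]_d -> R) (F0 f0 : R -> R).
Hypotheses (pf : is_pdf f) (f_gt0 : forall z, 0 < f z) (mF0 : has_margins f F0)
  (rF : regular_cdf F0 f0).
Local Notation mu := (lebesgue_rV R d).

Let mf : measurable_fun setT f. Proof. by case: pf. Qed.
Let f_ge0 z : 0 <= f z. Proof. by case: pf. Qed.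
Let nu := density_measure mu mf f_ge0.

Lemma margin_gt (i : 'I_d) (t : R) :
  (\int[mu]_(z in [set z : 'rV[R]_d | (t < z ord0 i)%R]) (f z)%:E = (1 - F0 t)%:E)%E.
Proof.
have nuT : nu setT = 1%E by case: pf.
pose A : set 'rV[R]_d := [set z | z ord0 i <= t].
have mA : measurable A.
  rewrite (_ : A = [set z | `]-oo, t]%classic (z ord0 i)]).
    exact: measurable_coord_preimage.
  by apply/seteqP; split => z /=; rewrite in_itv.
have nuA : nu A = (F0 t)%:E by exact: mF0.
have -> : [set z : 'rV[R]_d | t < z ord0 i] = ~` A.
  by apply/seteqP; split => z /=; rewrite /A/= ltNge => /negP.
rewrite -[LHS]/(nu (~` A)) EFinB -nuT -nuA.
have hU : nu setT = (nu A + nu (~` A))%E.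
  rewrite -measureU//; first by rewrite setUv.
  - exact: measurableC.
  - by rewrite setICr.
by rewrite hU addeAC subee ?add0e// nuA.
Qed.

Lemma margin_ge (i : 'I_d) (t : R) :
  (\int[mu]_(z in [set z : 'rV[R]_d | (t <= z ord0 i)%R]) (f z)%:E = (1 - F0 t)%:E)%E.
Proof.
rewrite -(margin_gt i).
have mgt : measurable [set z : 'rV[R]_d | t < z ord0 i].
  rewrite [X in measurable X](_ : _ = [set z : 'rV[R]_d | `]t, +oo[%classic (z ord0 i)]).
    exact: measurable_coord_preimage.
  by apply/seteqP; split => z /=; rewrite in_itv/= andbT.
have meq : measurable [set z : 'rV[R]_d | z ord0 i = t].
  exact: (measurable_coord_preimage i (measurable_set1 t)).
rewrite (_ : [set z : 'rV[R]_d | t <= z ord0 i] =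
    [set z : 'rV[R]_d | t < z ord0 i] `|` [set z : 'rV[R]_d | z ord0 i = t]); last first.
  apply/seteqP; split => z /=; first by rewrite le_eqVlt => /predU1P[|]; [right|left].
  by move=> [/ltW//|->].
rewrite ge0_integral_setU//.
- rewrite [X in (_ + X)%E](_ : _ = 0%E) ?adde0//.
  have h := integral_abs_eq0 (f := EFin \o f) meq _ (lebesgue_rV_hyperplane i t).
  rewrite -[RHS]h; first by apply: eq_integral => z _ /=; rewrite ger0_norm.
  by apply/measurable_EFinP; exact: measurable_funTS.
- by apply/measurable_EFinP; exact: measurable_funTS.
- by move=> z _; rewrite lee_fin.
- by apply/disj_setPS => z [/= h zt]; rewrite zt ltxx in h.
Qed.

Lemma margin_le (i : 'I_d) (t : R) :
  (\int[mu]_(z in [set z : 'rV[R]_d | (z ord0 i <= - t)%R]) (f z)%:E = (1 - F0 t)%:E)%E.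
Proof. by rewrite mF0; case: rF => Ff _ _ fs; rewrite (cdfN Ff fs). Qed.

Lemma margin_norm_le (i : 'I_d) (t : R) :
  (\int[mu]_(z in [set z : 'rV[R]_d | (t <= `|z ord0 i|)%R]) (f z)%:E <= (2 * (1 - F0 t))%:E)%E.
Proof.
have mge : measurable [set z : 'rV[R]_d | t <= z ord0 i].
  rewrite [X in measurable X](_ : _ = [set z : 'rV[R]_d | `[t, +oo[%classic (z ord0 i)]).
    exact: measurable_coord_preimage.
  by apply/seteqP; split => z /=; rewrite in_itv/= andbT.
have mle : measurable [set z : 'rV[R]_d | z ord0 i <= - t].
  rewrite [X in measurable X](_ : _ = [set z : 'rV[R]_d | `]-oo, - t]%classic (z ord0 i)]).
    exact: measurable_coord_preimage.
  by apply/seteqP; split => z /=; rewrite in_itv.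
rewrite (_ : [set z : 'rV[R]_d | t <= `|z ord0 i|] =
    [set z : 'rV[R]_d | t <= z ord0 i] `|` [set z : 'rV[R]_d | z ord0 i <= - t]); last first.
  apply/seteqP; split => z /=; rewrite ler_normr.
    by move=> /orP[|h]; [left|right; rewrite lerNr].
  by move=> [->//|h]; rewrite [X in _ || X]lerNr h orbT.
apply: (@le_trans _ _ (nu [set z : 'rV[R]_d | (t <= z ord0 i)%R] +
    nu [set z : 'rV[R]_d | (z ord0 i <= - t)%R])%E).
  exact: (@measureU2 _ _ _ nu).
by rewrite /nu !density_measureE margin_ge margin_le -EFinD mulr2n mulrDl mul1r.
Qed.

End margins.

Section meta_density.
Variables (R : realType) (d : nat) (F f G g : 'rV[R]_d -> R) (F0 f0 G0 g0 : R -> R).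
Hypothesis Hsetup : standard_setup F f F0 f0 G0 g0 G g.
Local Notation mu := (lebesgue_rV R d).

Lemma setup_regular_F : regular_cdf F0 f0.
Proof. by split; case: Hsetup. Qed.

Lemma setup_regular_G : regular_cdf G0 g0.
Proof. by split; case: Hsetup. Qed.

Let rF := setup_regular_F.
Let rG := setup_regular_G.

Lemma metaK : cancel (meta F0 G0 : 'rV[R]_d -> _) (meta G0 F0).
Proof.
by move=> x; apply/matrixP => i j; rewrite !mxE (meta_marginalK rF rG).
Qed.

Lemma metaKV : cancel (meta G0 F0 : 'rV[R]_d -> _) (meta F0 G0).
Proof.
by move=> x; apply/matrixP => i j; rewrite !mxE (meta_marginalK rG rF).
Qed.

Lemma measurable_meta : measurable_fun setT (meta F0 G0 : 'rV[R]_d -> 'rV[R]_d).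
Proof.
apply: measurable_fun_rV => i; under eq_fun do rewrite mxE.
by apply: measurableT_comp (measurable_coord i); exact: measurable_meta_marginal rF rG.
Qed.

Lemma measurable_meta_inv : measurable_fun setT (meta G0 F0 : 'rV[R]_d -> 'rV[R]_d).
Proof.
apply: measurable_fun_rV => i; under eq_fun do rewrite mxE.
by apply: measurableT_comp (measurable_coord i); exact: measurable_meta_marginal rG rF.
Qed.

Lemma measurable_meta_preimage (A : set 'rV[R]_d) : measurable A ->
  measurable [set x | A (meta F0 G0 x)].
Proof. by move=> mA; rewrite -[X in measurable X]setTI; exact: measurable_meta. Qed.

Lemma meta_preimage_orthant (y : 'rV[R]_d) :
  [set x | orthant y (meta F0 G0 x)] = orthant (meta G0 F0 y).
Proof.
have E a b : (meta_marginal F0 G0 a <= b) = (a <= meta_marginal G0 F0 b).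
  by rewrite -{1}(meta_marginalK rG rF b) (meta_marginal_le rF rG).
by apply/seteqP; split => x h i; have := h i; rewrite !mxE E.
Qed.

(** Since [G] is [F] composed with the transformation, both measures give orthants the same mass;
    this replaces a change of variables for [g]. *)
Lemma meta_integral (A : set 'rV[R]_d) : measurable A ->
  (\int[mu]_(x in [set x | A (meta F0 G0 x)]) (g x)%:E = \int[mu]_(z in A) (f z)%:E)%E.
Proof.
move=> mA; have [[mf f0' f1] Ff] := F_density Hsetup.
have [[mg g0' g1] Gg] := G_density Hsetup.
pose nug := density_measure mu mg g0'.
pose nuf := density_measure mu mf f0'.
pose m := measure_function_pushforward__canonical__measure_function_Measure nug measurable_meta.
suff h : m A = nuf A by exact: h.
have E y : m (orthant y) = nuf (orthant y).
  transitivity (nug (orthant (meta G0 F0 y))).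
    by rewrite -meta_preimage_orthant.
  by rewrite /nug /nuf !density_measureE Gg Ff (G_meta Hsetup) metaKV.
apply: measure_eq_orthant => // y; rewrite E /nuf.
by rewrite [X in (X < _)%E](_ : _ = (F y)%:E) ?ltry//; exact: Ff.
Qed.

Variables (W1 W2 : set 'rV[R]_d) (k : R).
Hypotheses (mW1 : measurable W1) (mW2 : measurable W2) (k0 : 0 <= k).
Let w z := \1_W1 z + k * \1_W2 z.
Let ft z := f z * w z.
Let gt x := g x * (ft (meta F0 G0 x) / f (meta F0 G0 x)).
Let f_gt0 z : 0 < f z.
Proof. by have [l _ []] := F_class Hsetup. Qed.

Let mw : measurable_fun setT w.
Proof. by apply: measurable_funD => //; exact: measurable_funM. Qed.

Let w0 z : 0 <= w z.
Proof. by rewrite addr_ge0// mulr_ge0. Qed.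

Let gtE x : gt x = g x * w (meta F0 G0 x).
Proof. by rewrite /gt /ft mulrAC divff ?mul1r// gt_eqF. Qed.

Let gtE2 x : gt x = g x * (\1_[set x | W1 (meta F0 G0 x)] x + k * \1_[set x | W2 (meta F0 G0 x)] x).
Proof.
by rewrite gtE /w !indicE; congr (_ * (_%:R + _ * _%:R)); apply/idP/idP => /set_mem h; exact: mem_set.
Qed.

(** The quotient in [gt] is the weight [w] evaluated at the transformed point, so the claim splits
    into [meta_integral] on [A] intersected with [W1] and with [W2]. *)
Lemma reweighted_meta_integral (A : set 'rV[R]_d) : measurable A ->
  (\int[mu]_(x in [set x | A (meta F0 G0 x)]) (gt x)%:E = \int[mu]_(z in A) (ft z)%:E)%E.
Proof.
move=> mA; have [[mf f0' _] _] := F_density Hsetup.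
have [[mg g0' _] _] := G_density Hsetup.
under eq_integral do rewrite gtE2.
rewrite (weighted_integral mg)//; [|exact: measurable_meta_preimage..].
rewrite /ft /w (weighted_integral mf)//.
rewrite -!meta_integral//; exact: measurableI.
Qed.

Hypothesis ft1 : (\int[mu]_z (ft z)%:E = 1)%E.
Let Ft x := fine (\int[mu]_(z in orthant x) (ft z)%:E)%E.

Lemma reweighted_density : has_density Ft ft.
Proof.
have [[mf f0' _] _] := F_density Hsetup.
have mft : measurable_fun setT ft by exact: measurable_funM.
have ft0 z : 0 <= ft z by rewrite mulr_ge0.
split; first by split.
move=> x; rewrite /Ft fineK// ge0_fin_numE; last first.
  by apply: integral_ge0 => z _; rewrite lee_fin.
rewrite (@le_lt_trans _ _ 1%E) ?ltry// -ft1; apply: ge0_subset_integral => //.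
- exact: measurable_orthant.
- exact/measurable_EFinP.
- by move=> z _; rewrite lee_fin.
Qed.

Lemma reweighted_meta_density : has_density (fun x => Ft (meta F0 G0 x)) gt.
Proof.
have [[mg g0' _] _] := G_density Hsetup.
have [[mft ft0 _] Fft] := reweighted_density.
split.
  split.
  - rewrite (_ : gt = (fun x => g x * w (meta F0 G0 x))); last exact/funext.
    by apply: measurable_funM => //; exact: (measurableT_comp mw measurable_meta).
  - by move=> x; rewrite gtE mulr_ge0.
  - rewrite -ft1 -(reweighted_meta_integral measurableT).
    by rewrite (_ : [set x | _] = setT)//; apply/seteqP; split.
move=> x; rewrite -Fft -reweighted_meta_integral; last exact: measurable_orthant.
by rewrite meta_preimage_orthant metaK.
Qed.

End meta_density.

(** * Thin cones around the diagonals *)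

Section thin_cone.
Variable R : realType.

(** The offset 2 keeps the tolerance strictly inside the unit interval from [m = 0] on. *)
Definition shrink (m : nat) : R := 1 - m.+2%:R^-1.

Lemma shrink_itv m : 0 < shrink m < 1.
Proof.
rewrite /shrink subr_gt0 invf_lt1 ?ltr1n//= ltrBlDr ltrDl invr_gt0.
Qed.

Lemma le_shrink m n : (m <= n)%N -> shrink m <= shrink n.
Proof. by move=> mn; rewrite lerD2l lerN2 lef_pV2 ?posrE// ler_nat. Qed.

(* Points whose coordinates have nearly the same modulus as soon as one is large:
   the ratio tolerance [shrink m] applies from [a m] on. *)
Definition thin_cone d (a : nat -> R) : set 'rV[R]_d :=
  [set x | forall m i j, a m <= `|x ord0 i| -> shrink m * `|x ord0 i| <= `|x ord0 j|].

Lemma measurable_thin_cone d a : measurable (@thin_cone d a).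
Proof.
rewrite (_ : @thin_cone d a = \bigcap_m [set x : 'rV[R]_d | forall i, forall j,
    a m <= `|x ord0 i| -> shrink m * `|x ord0 i| <= `|x ord0 j|]); last first.
  apply/seteqP; split => x /=; first by move=> h m _ i j; exact: h.
  by move=> h m i j; exact: (h m I i j).
apply: bigcapT_measurable => m.
apply: measurable_forall_ord => i; apply: measurable_forall_ord => j.
have mc (l : 'I_d) : measurable_fun setT (fun x : 'rV[R]_d => `|x ord0 l|).
  by apply: measurableT_comp => //; exact: measurable_coord.
have m1 : measurable [set x : 'rV[R]_d | a m <= `|x ord0 i|].
  rewrite [X in measurable X](_ : _ = setT `&` (fun x : 'rV[R]_d => `|x ord0 i|) @^-1` `[a m, +oo[).
    by apply: mc => //; exact: measurable_itv.
  by apply/seteqP; split => x /=; rewrite in_itv/= andbT; [split|case].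
have m2 : measurable [set x : 'rV[R]_d | shrink m * `|x ord0 i| <= `|x ord0 j|].
  rewrite [X in measurable X](_ : _ = setT `&`
    (fun x : 'rV[R]_d => `|x ord0 j| - shrink m * `|x ord0 i|) @^-1` `[0, +oo[).
    have mb : measurable_fun setT (fun x : 'rV[R]_d => `|x ord0 j| - shrink m * `|x ord0 i|).
      by apply: measurable_funB => //; exact: measurable_funM.
    exact: (mb measurableT _ (measurable_itv `[0, +oo[)).
  by apply/seteqP; split => x /=; rewrite in_itv/= andbT subr_ge0; [split|case].
rewrite [X in measurable X](_ : _ = ~` [set x : 'rV[R]_d | a m <= `|x ord0 i|] `|`
   [set x : 'rV[R]_d | shrink m * `|x ord0 i| <= `|x ord0 j|]).
  by apply: measurableU => //; exact: measurableC.
apply/seteqP; split => x /=.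
  by move=> h; have [/h|] := pselect (a m <= `|x ord0 i|); [right|left].
by move=> [nh /nh|].
Qed.

Variables (F f G g : R -> R).
Hypotheses (rF : regular_cdf F f) (rG : regular_cdf G g).
Local Notation K := (meta_marginal F G).
Variable a : nat -> R.
Hypothesis aP : forall m s, a m <= s -> m.+1%:R * K (shrink m * s) <= K s.

(** If [1 / m.+1 <= k], then [K (shrink m * |x_i|)] is at most [|z_i| / m.+1], hence at most
    [k * |z_i|] and at most [|z_j| = K |x_j|]; monotonicity of [K] concludes. *)
Lemma thin_cone_large d (k : R) : 0 < k -> exists2 T, 1 <= T &
  forall z : 'rV[R]_d, (forall i, T <= `|z ord0 i|) ->
    (forall i j, k * `|z ord0 i| <= `|z ord0 j|) -> thin_cone a (meta G F z).
Proof.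
move=> k0; pose m0 := Num.truncn k^-1.
have km m : (m0 <= m)%N -> m.+1%:R^-1 <= k.
  move=> m0m; rewrite invf_ple ?posrE//; apply: (le_trans (ltW (truncnS_gt _))).
  by rewrite ler_nat ltnS.
exists (Num.max 1 (K (a m0))); first by rewrite le_max lexx.
move=> z Tz kz; have zx i : `|z ord0 i| = K `|(meta G F z) ord0 i|.
  by rewrite mxE (meta_marginal_norm rG rF) (meta_marginalK rG rF).
have xa i : a m0 <= `|(meta G F z) ord0 i|.
  by rewrite -(meta_marginal_le rF rG) -zx; have := Tz i; rewrite ge_max => /andP[].
move: zx xa; set x := meta G F z => zx xa.
have key m i j : (m0 <= m)%N -> a m <= `|x ord0 i| -> shrink m * `|x ord0 i| <= `|x ord0 j|.
  move=> m0m /aP h; rewrite -(meta_marginal_le rF rG) -zx.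
  apply: le_trans (kz i j); apply: (@le_trans _ _ (m.+1%:R^-1 * `|z ord0 i|)).
    by rewrite ler_pdivlMl// zx.
  by rewrite ler_wpM2r ?km.
move=> m i j am; have [m0m|mm0] := leqP m0 m; first exact: key.
(* Small indices need no separate bound: all moduli are beyond [a m0], and the tolerance of index
   [m0] is stricter. *)
apply: le_trans (key m0 i j (leqnn _) (xa i)).
by rewrite ler_wpM2r// le_shrink// ltnW.
Qed.

End thin_cone.

(** * Geometry of the diagonal cross *)

Section cross.
Variables (R : realType) (d : nat).

(** A tube of uniform radius, by compactness of the parameter interval. *)
Lemma segment_neighbourhood (U : set 'rV[R]_d) (v : 'rV[R]_d) : open U ->
  (forall r, 0 <= r <= 1 -> U (r *: v)) ->
  exists2 e, 0 < e & forall r y, 0 <= r <= 1 -> `|y - r *: v| < e -> U y.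
Proof.
move=> oU Uv.
have := @segment_compact R 0 1; rewrite compact_near_coveringP => /(_ R
  (0^'+) (fun e r => forall y, `|y - r *: v| < e -> U y) _).
case.
  move=> r r01; have /nbhs_ballP[e /= e0 he] : nbhs (r *: v) U.
    by apply: open_nbhs_nbhs; split => //; apply: Uv; rewrite /= in_itv/= in r01.
  have v0 : 0 < `|v| + 1 by rewrite ltr_wpDl.
  exists (ball r (e / 2 / (`|v| + 1)), [set t | t < e / 2]).
    split => /=; first by apply: nbhsx_ballx; rewrite !divr_gt0.
    by apply: nbhs_right_lt; rewrite divr_gt0.
  move=> [r' t] /= [rr' te] y yt; apply: he; rewrite -ball_normE /ball_/=.
  rewrite (_ : r *: v - y = (r - r') *: v - (y - r' *: v)); last first.
    by rewrite scalerBl opprB addrA subrK.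
  apply: (le_lt_trans (ler_normB _ _)); rewrite normrZ.
  have : `|r - r'| * (`|v| + 1) < e / 2 by rewrite -ltr_pdivlMr.
  have : `|r - r'| * `|v| <= `|r - r'| * (`|v| + 1) by rewrite ler_wpM2l// lerDl.
  by lra.
move=> e /= e0 he; exists (e / 2); first by rewrite divr_gt0.
move=> r y r01 yr; apply: (he (e / 2) _ _ r) => //=.
- by rewrite sub0r normrN gtr0_norm ?divr_gt0//; lra.
- by rewrite divr_gt0.
Qed.

Definition signs (s : {ffun 'I_d -> bool}) : 'rV[R]_d := \row_i (-1) ^+ (s i).

Lemma sign_vector_signs s : sign_vector (signs s).
Proof. by move=> i; rewrite mxE; case: (s i); [right|left]; rewrite ?expr1 ?expr0. Qed.

Lemma cross_neighbourhood (U : set 'rV[R]_d) : open U -> @diagonal_cross R d `<=` U ->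
  exists2 e, 0 < e & forall s r y, 0 <= r <= 1 -> `|y - r *: signs s| < e -> U y.
Proof.
move=> oU EU.
have /choice[e he] s : exists e, 0 < e /\
    forall r y, 0 <= r <= 1 -> `|y - r *: signs s| < e -> U y.
  have [e e0 he] := @segment_neighbourhood U (signs s) oU (fun r r01 => EU _
    (ex_intro _ r (ex_intro _ (signs s) (And3 r01 (sign_vector_signs s) erefl)))).
  by exists e.
exists (\big[Num.min/1]_s e s).
  by apply/bigmin_gtP; split => // s _; have [] := he s.
move=> s r y r01 yr; have [_ h] := he s; apply: (h r) => //.
by rewrite (lt_le_trans yr)// bigmin_le_cond.
Qed.

(** If all moduli of [y] were nearly equal, the signs of its coordinates together with its norm
    clipped at 1 would give a point of the cross closer to [y] than the tube radius. *)
Lemma cross_separation (U : set 'rV[R]_d) : open U -> @diagonal_cross R d `<=` U ->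
  exists e m, [/\ 0 < e, e < 1 & forall y, ~ U y -> `|y| <= 1 + e ->
    exists i j, `|y ord0 j| < shrink R m * `|y ord0 i| /\ e <= `|y ord0 i|].
Proof.
move=> oU EU; have [del del0 hdel] := cross_neighbourhood oU EU.
(* Clipping the norm costs at most [e <= del / 4], and [e < 1] bounds the norm of [y] by 2. *)
pose e := Num.min (del / 4) (2^-1).
have e0 : 0 < e by rewrite lt_min divr_gt0//= invr_gt0.
have e1 : e < 1 by rewrite gt_min; apply/orP; right; lra.
have edel : e <= del / 4 by rewrite ge_min lexx.
(* Makes the spread [1 / m.+2] of the moduli, times a norm of at most 2, no more than [del / 4]. *)
pose m := Num.truncn (8 / del).
have mdel : 2 * m.+2%:R^-1 <= del / 4.
  have : 8 / del < m.+2%:R.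
    by apply: (lt_le_trans (truncnS_gt _)); rewrite ler_nat.
  rewrite ltr_pdivrMr// => h; rewrite ler_pdivrMr//; lra.
exists e, m; split => // y nUy y1.
have My : del <= `|y|.
  rewrite leNgt; apply/negP => yd; apply: nUy; apply: (hdel [ffun=> true] 0) => //.
    by rewrite lexx ler01.
  by rewrite scale0r subr0.
have y0 : 0 < `|y| by exact: lt_le_trans My.
have [i hi] : exists i, `|y| <= `|y ord0 i|.
  apply/not_existsP => h; have : `|y| < `|y|; last by rewrite ltxx.
  by apply/(rV_norm_ltP _ y0) => i; rewrite ltNge; apply/negP; exact: h.
have {}hi : `|y ord0 i| = `|y| by apply/eqP; rewrite eq_le hi rV_norm_coord.
have [[j hj]|h] := pselect (exists j, `|y ord0 j| < shrink R m * `|y ord0 i|).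
  by exists i, j; split => //; rewrite hi (le_trans _ My)//; lra.
exfalso; apply: nUy.
pose r := Num.min `|y| 1.
have r01 : 0 <= r <= 1 by rewrite le_min ltW//= ler01 /= ge_min lexx orbT.
apply: (hdel [ffun i => y ord0 i < 0] r) => //.
apply/(rV_norm_ltP _ del0) => j; rewrite !mxE ffunE.
have yj : y ord0 j = (-1) ^+ (y ord0 j < 0)%R * `|y ord0 j| by exact: numEsign.
rewrite {1}yj [r * _]mulrC -mulrBr normrM normrX normrN1 expr1n mul1r.
have h1 : shrink R m * `|y| <= `|y ord0 j|.
  by rewrite leNgt; apply/negP => hj; apply: h; exists j; rewrite hi.
have h2 : `|y ord0 j| <= `|y| by exact: rV_norm_coord.
have h3 : r <= `|y| by rewrite ge_min lexx.
have h4 : `|y| - e <= r by rewrite le_min; apply/andP; split; lra.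
have h5 : m.+2%:R^-1 * `|y| <= del / 4.
  apply: le_trans mdel; rewrite mulrC; rewrite ler_wpM2r ?invr_ge0//; lra.
have h6 : shrink R m * `|y| = `|y| - m.+2%:R^-1 * `|y| by rewrite /shrink mulrBl mul1r.
have h7 : `|y| - del / 4 <= `|y ord0 j| by apply: le_trans h1; rewrite h6 lerD2l lerN2.
clearbody r; clear -h2 h3 h4 h7 edel del0; move: (`|y|) (`|y ord0 j|) h2 h3 h4 h7 => u v *.
by rewrite ltr_norml; apply/andP; split; lra.
Qed.

End cross.

Section marginal_tail.
Variables (R : realType) (d : nat) (f : 'rV[R]_d.+1 -> R) (F0 f0 : R -> R) (lambda : R).
Hypotheses (lambda0 : 0 < lambda) (Ff : class_F lambda f) (mF0 : has_margins f F0)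
  (rF : regular_cdf F0 f0).

(** Integrates [density_scale_ge] over a half-space: dilation by [A] maps the half-space of level
    [s] to that of level [A * s], with constant Jacobian. *)
Lemma margin_dominated_variation (A : R) : 0 < A ->
  exists2 c, 0 < c & \forall s \near +oo, c * (1 - F0 s) <= 1 - F0 (A * s).
Proof.
move=> A0; have [pf f_gt0 _ _] := Ff; have [mf f_ge0 _] := pf.
have [c [M [c0 M0 hM]]] := density_scale_ge lambda0 Ff A0.
exists (A ^+ d.+1 * c); first by rewrite mulr_gt0// exprn_gt0.
near=> s; have sM : M <= s by near: s; apply: nbhs_pinfty_ge; exact: num_real.
pose H t := [set z : 'rV[R]_d.+1 | t < z ord0 ord0].
have mH t : measurable (H t).
  rewrite [X in measurable X](_ : _ = [set z : 'rV[R]_d.+1 | `]t, +oo[%classic (z ord0 ord0)]).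
    exact: measurable_coord_preimage.
  by apply/seteqP; split => z /=; rewrite in_itv/= andbT.
rewrite -lee_fin EFinM -!(margin_gt pf mF0 ord0).
rewrite (@integral_rV_scale R d.+1 A (H (A * s)) (EFin \o f))//; last exact/measurable_EFinP.
have E : [set w : 'rV[R]_d.+1 | H (A * s) (A *: w)] = H s.
  by apply/seteqP; split => w; rewrite /H/= mxE ltr_pM2l.
rewrite E EFinM -muleA; apply: lee_wpmul2l; first by rewrite lee_fin exprn_ge0// ltW.
rewrite -(ge0_integralZl _ (mH s))//; last 3 first.
- by apply/measurable_EFinP; exact: measurable_funTS.
- by move=> z _; rewrite lee_fin.
- by rewrite lee_fin ltW.
apply: ge0_le_integral => //.
- by move=> z _; rewrite mule_ge0// lee_fin// ltW.
- apply: emeasurable_funM => //; apply/measurable_EFinP; exact: measurable_funTS.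
- apply/measurable_EFinP; apply: measurable_funTS.
  by apply: (measurableT_comp mf); exact: measurable_scale.
move=> z Hz /=; rewrite -EFinM lee_fin; apply: hM.
apply: le_trans (rV_norm_coord z ord0); apply: le_trans (ler_norm _).
by apply: ltW; apply: le_lt_trans Hz.
Unshelve. all: by end_near. Qed.

End marginal_tail.

(** * The modified density *)

Section construction.
Variables (R : realType) (d : nat) (F f G g : 'rV[R]_d.+1 -> R) (F0 f0 G0 g0 : R -> R).
Hypothesis Hsetup : standard_setup F f F0 f0 G0 g0 G g.
Local Notation mu := (lebesgue_rV R d.+1).
Local Notation K := (meta_marginal F0 G0).
Local Notation L := (meta_marginal G0 F0).
Local Notation e1 := (const_mx 1 : 'rV[R]_d.+1).

Let rF := setup_regular_F Hsetup.
Let rG := setup_regular_G Hsetup.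
Let f_gt0 z : 0 < f z. Proof. by have [l _ []] := F_class Hsetup. Qed.
Let pf : is_pdf f. Proof. by case: (F_density Hsetup). Qed.
Let mf : measurable_fun setT f. Proof. by case: pf. Qed.

Lemma setup_rapid (A t : R) : 0 < A -> 0 < t < 1 ->
  exists2 s0, 0 < s0 & forall s, s0 <= s -> A * K (t * s) <= K s.
Proof.
move=> A0 t01; have [l l0 Ff] := F_class Hsetup.
apply: near_pinfty_ge; apply: (meta_marginal_rapid rF rG (g0_tail Hsetup) t01).
exact: (margin_dominated_variation l0 Ff (F_margins Hsetup) A0).
Qed.

Lemma quantile_cvgy (H h : R -> R) (c : nat -> R) : regular_cdf H h ->
  (forall n, (1 < n)%N -> 1 - H (c n) = n%:R^-1) -> c n @[n --> \oo] --> +oo.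
Proof.
move=> [Hh ch h0 _] Hc; apply/cvgryPge => A.
have HA : 0 < 1 - H A by rewrite subr_gt0 (cdf_lt1 Hh h0).
near=> n; have n1 : (1 < n)%N by near: n; exact: nbhs_infty_gt.
rewrite ltW// -(cdf_lt Hh h0) -(ltrD2l 1) -[X in _ < X]opprK.
have : n%:R^-1 < 1 - H A by near: n; apply: (cvgr_lt _ (@cvgn_inv R)).
by rewrite -(Hc n n1); lra.
Unshelve. all: by end_near. Qed.

Section mass_ratio.
Variable c0 : R.
Hypothesis Hc0 : (c0%:E * \int[mu]_(w in
               [set w : 'rV[R]_d.+1 | (1 <= w ord0 ord_max)%R])
               (tail_limit f w)%:E = 1)%E.
Variable ft : 'rV[R]_d.+1 -> R.
Hypotheses (mft : measurable_fun setT ft) (ft0 : forall z, 0 <= ft z)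
  (ftf : forall z, 1 <= enorm z -> ft z <= f z)
  (fteq : forall (w : 'rV[R]_d.+1) (r : nat -> R), (forall i, w ord0 i != 0) ->
     r n @[n --> \oo] --> +oo -> \forall n \near \oo, ft (r n *: w) = f (r n *: w)).

Lemma scaled_integral (h : 'rV[R]_d.+1 -> R) (t : R) (A : set 'rV[R]_d.+1) :
  0 < t -> measurable_fun setT h -> (forall z, 0 <= h z) -> measurable A ->
  (\int[mu]_(z in [set z | A (t^-1 *: z)]) (h z)%:E =
   (t ^+ d.+1 * f (t *: e1))%:E * \int[mu]_(w in A) (h (t *: w) / f (t *: e1))%:E)%E.
Proof.
move=> t0 mh h0 mA.
rewrite (@integral_rV_scale R d.+1 t _ (EFin \o h))//; last 2 first.
- exact: measurable_scale_set.
- exact/measurable_EFinP.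
have E : [set w | [set z | A (t^-1 *: z)] (t *: w)] = A.
  by apply/seteqP; split => w /=; rewrite scalerA mulVf ?gt_eqF// scale1r.
rewrite E EFinM -muleA; congr (_ * _)%E; rewrite -ge0_integralZl//.
- by apply: eq_integral => w _ /=; rewrite -EFinM mulrC divfK// gt_eqF.
- apply/measurable_EFinP; apply: measurable_funTS; apply: measurable_funM => //.
  by apply: (measurableT_comp mh); exact: measurable_scale.
- by move=> w _; rewrite lee_fin divr_ge0// ltW.
- by rewrite lee_fin ltW.
Qed.

(** The tail [1 - F0 (t n)] is the mass under [f] of the half-space [H] scaled by [t n]. Rescaling
    pulls the same factor out of both masses, and [c0] is the inverse of the limiting integral over
    [H]. *)
Lemma mass_ratio_cvg (t : nat -> R) (A : set 'rV[R]_d.+1) (rho : R) :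
  t n @[n --> \oo] --> +oo -> measurable A -> 0 < rho ->
  (forall w, A w -> rho <= `|w|) ->
  [/\ (\int[mu]_(w in A) (tail_limit f w)%:E)%E \is a fin_num &
  fine (\int[mu]_(z in [set z | A ((t n)^-1 *: z)]) (ft z)%:E)%E / (1 - F0 (t n))
    @[n --> \oo] --> c0 * fine (\int[mu]_(w in A) (tail_limit f w)%:E)%E].
Proof.
move=> ty mA rho0 Arho; have [l l0 Ff] := F_class Hsetup.
have d0 : (0 < d.+1)%N by [].
pose H : set 'rV[R]_d.+1 := [set w | 1 <= w ord0 ord_max].
have mH : measurable H.
  rewrite [X in measurable X](_ : _ = [set z : 'rV[R]_d.+1 | `[1, +oo[%classic (z ord0 ord_max)]).
    exact: measurable_coord_preimage.
  by apply/seteqP; split => z; rewrite /H/= in_itv/= andbT.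
have Hfar w : H w -> 1 <= `|w|.
  by move=> /le_trans; apply; apply: le_trans (ler_norm _) (rV_norm_coord _ _).
have [iA hA] := tail_density_cvg d0 l0 Ff mA rho0 Arho mft ft0 ftf ty (fun w hw => fteq hw ty).
have feq (w : 'rV[R]_d.+1) : (forall i, w ord0 i != 0) ->
    \forall n \near \oo, f (t n *: w) = f (t n *: w) by move=> _; exact: nearW.
have [iH hH] := tail_density_cvg d0 l0 Ff mH ltr01 Hfar mf
  (fun z => ltW (f_gt0 z)) (fun z _ => lexx _) ty feq.
have fA := integrable_fin_num mA iA.
have fH := integrable_fin_num mH iH.
split => //.
move/fineK: (fA) => EA; move/fineK: (fH) => EH.
rewrite -EA in hA; rewrite -EH in hH.
have /fine_cvgP[finA cA] := hA; have /fine_cvgP[finH cH] := hH.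
set IA := fine _ in cA; set IH := fine _ in cH.
have cIH : c0 * IH = 1.
  by apply: EFin_inj; rewrite EFinM EH.
have IH0 : IH != 0.
  by apply/eqP => h; move: cIH; rewrite h mulr0 => /esym/eqP; rewrite oner_eq0.
have hq : fine (\int[mu]_(w in A) (ft (t n *: w) / f (t n *: e1))%:E)%E /
    fine (\int[mu]_(w in H) (f (t n *: w) / f (t n *: e1))%:E)%E @[n --> \oo] --> IA / IH.
  by apply: cvgM; [exact: cA|exact: cvgV].
rewrite (_ : c0 * IA = IA * IH^-1); last first.
  by rewrite mulrC; congr (_ * _); apply: (mulIf IH0); rewrite cIH mulVf.
apply: cvg_trans hq; apply: near_eq_cvg; near=> n => /=.
have t0 : 0 < t n by near: n; move/cvgryPgt : ty; exact.
rewrite (scaled_integral t0 mft ft0 mA).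
have -> : 1 - F0 (t n) = fine (\int[mu]_(z in [set z | H ((t n)^-1 *: z)]) (f z)%:E)%E.
  rewrite (_ : [set z | _] = [set z : 'rV[R]_d.+1 | t n <= z ord0 ord_max]).
    by rewrite (margin_ge pf (F_margins Hsetup)).
  by apply/seteqP; split => z; rewrite /H/= mxE ler_pdivlMl// mulr1.
rewrite (scaled_integral t0 mf (fun z => ltW (f_gt0 z)) mH).
have fa : (\int[mu]_(w in A) (ft (t n *: w) / f (t n *: e1))%:E)%E \is a fin_num.
  by near: n.
have fh : (\int[mu]_(w in H) (f (t n *: w) / f (t n *: e1))%:E)%E \is a fin_num.
  by near: n.
rewrite !fineM//= invfM mulrACA divff ?mul1r//.
by rewrite mulf_neq0 ?expf_neq0 ?gt_eqF.
Unshelve. all: by end_near. Qed.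

End mass_ratio.

Variable a : nat -> R.
Hypothesis aP : forall m s, a m <= s -> m.+1%:R * K (shrink R m * s) <= K s.

(** The planes are kept everywhere, including inside the unit ball, and are removed from [boosted],
    so that the weight on them is exactly 1. *)
Definition kept : set 'rV[R]_d.+1 := @coord_planes R d.+1 `|`
  ([set z | 1 <= enorm z] `&` [set z | thin_cone a (meta G0 F0 z)]).
Definition boosted : set 'rV[R]_d.+1 := [set z | enorm z < 1] `\` @coord_planes R d.+1.

Lemma measurable_enorm_ball (p : 'rV[R]_d.+1) r : measurable [set z | enorm (z - p) < r].
Proof.
pose h (z : 'rV[R]_d.+1) := enorm (z - p).
have mh : measurable_fun setT h.
  rewrite (_ : h = Num.sqrt \o (fun z => \sum_i (z ord0 i - p ord0 i) ^+ 2)).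
    apply: measurableT_comp; first by apply: continuous_measurable_fun; exact: sqrt_continuous.
    apply: measurable_sum => i; apply: measurable_funX; apply: measurable_funB => //.
    exact: measurable_coord.
  apply/funext => z; rewrite /h /enorm/=; congr Num.sqrt.
  by apply: eq_bigr => i _; rewrite !mxE.
rewrite [X in measurable X](_ : _ = setT `&` h @^-1` `]-oo, r[).
  by apply: mh => //; exact: measurable_itv.
by apply/seteqP; split => z /=; rewrite in_itv/=; [split|case].
Qed.

Let measurable_unit_ball : measurable [set z : 'rV[R]_d.+1 | enorm z < 1].
Proof. by have := measurable_enorm_ball 0 1; under eq_set do rewrite subr0. Qed.

Lemma measurable_kept : measurable kept.
Proof.
apply: measurableU; first exact: measurable_coord_planes.
apply: measurableI.
  rewrite [X in measurable X](_ : _ = ~` [set z : 'rV[R]_d.+1 | enorm z < 1]).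
    by apply: measurableC; exact: measurable_unit_ball.
  by apply/seteqP; split => z /=; rewrite leNgt => /negP.
rewrite -[X in measurable X]setTI.
by apply: (measurable_meta_inv Hsetup) => //; exact: measurable_thin_cone.
Qed.

Lemma measurable_boosted : measurable boosted.
Proof.
by apply: measurableD; [exact: measurable_unit_ball|exact: measurable_coord_planes].
Qed.

Lemma boosted_mass : (0 < \int[mu]_(z in boosted) (f z)%:E)%E.
Proof.
(* The open cube of side [r] in the positive orthant misses the planes, and its Euclidean norms are
   below 1 because [d.+1 < d.+2]. *)
pose r : R := d.+2%:R^-1.
have r0 : 0 < r by rewrite invr_gt0.
pose B := rect (fun _ : 'I_d.+1 => `]0, r[%classic).
have mB : measurable B by apply: measurable_rect => i; exact: measurable_itv.
apply: (@lt_le_trans _ _ (\int[mu]_(z in B) (f z)%:E)%E).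
  apply: integral_EFin_gt0 => //; first exact: measurable_funTS.
  rewrite lebesgue_rV_rect => [|i]; last exact: measurable_itv.
  rewrite (eq_bigr (fun=> r%:E)); last first.
    by move=> i _; rewrite lebesgue_measure_itv/= lte_fin r0 oppr0 adde0.
  by rewrite prodEFin lte_fin prodr_const exprn_gt0.
apply: ge0_subset_integral => //.
- exact: measurable_boosted.
- by apply/measurable_EFinP; exact: measurable_funTS.
- by move=> z _; rewrite lee_fin ltW.
move=> z Bz; split => /=.
  have zr : `|z| <= r.
    apply/(rV_norm_leP _ (ltW r0)) => i; have := Bz i; rewrite /= in_itv/= => /andP[h1 h2].
    by rewrite gtr0_norm// ltW.
  apply: (le_lt_trans (le_enorm_norm z)).
  apply: (@le_lt_trans _ _ (d.+1%:R * r)); first by rewrite ler_wpM2l.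
  by rewrite /r ltr_pdivrMr// mul1r ltr_nat.
by move=> [i zi]; have := Bz i; rewrite /= zi in_itv/= ltxx.
Qed.

(** The mass missing from [kept] is spread over [boosted]: [k] is the quotient of [1 - p1] by the
    positive mass [p2]. *)
Lemma exists_boost : exists2 k, 0 <= k &
  (\int[mu]_z (f z * (\1_kept z + k * \1_boosted z))%:E = 1)%E.
Proof.
have [_ f_ge0 f1] := pf.
pose nu := density_measure mu mf f_ge0.
have nu1 B : measurable B -> (nu B <= 1)%E.
  by move=> mB; rewrite -f1; apply: (@le_measure _ _ _ nu); rewrite ?inE.
have fin B : measurable B -> nu B \is a fin_num.
  move=> mB; rewrite ge0_fin_numE ?(le_lt_trans (nu1 _ mB)) ?ltry//.
have mk := measurable_kept; have mb := measurable_boosted.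
pose p1 := fine (nu kept); pose p2 := fine (nu boosted).
have p20 : 0 < p2 by rewrite -lte_fin fineK ?fin//; exact: boosted_mass.
have p11 : p1 <= 1 by rewrite -lee_fin fineK ?fin// nu1.
exists ((1 - p1) / p2); first by rewrite divr_ge0 ?subr_ge0// ltW.
rewrite (weighted_integral mf)//; last by rewrite divr_ge0 ?subr_ge0// ltW.
rewrite !setTI -[X in (X + _)%E]/(nu kept) -[X in (_ + _ * X)%E]/(nu boosted).
rewrite -(fineK (fin _ mk)) -(fineK (fin _ mb)) -/p1 -/p2 -EFinM -EFinD.
by rewrite divfK ?gt_eqF// addrC subrK.
Qed.

Variable k : R.
Let w z := \1_kept z + k * \1_boosted z.

Lemma weight_planes z : coord_planes z -> w z = 1.
Proof.
move=> cz; rewrite /w !indicE mem_set; last by left.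
by rewrite memNset ?mulr0 ?addr0// => -[].
Qed.

Lemma weight_out z : 1 <= enorm z -> w z = \1_kept z.
Proof.
by move=> z1; rewrite /w [\1_boosted z]indicE memNset ?mulr0 ?addr0// => -[/=]; rewrite ltNge z1.
Qed.

Lemma weight_le1 z : 1 <= enorm z -> w z <= 1.
Proof. by move=> z1; rewrite weight_out// indicE lern1; case: (_ \in _). Qed.

Lemma weight_cone z : 1 <= enorm z -> thin_cone a (meta G0 F0 z) -> w z = 1.
Proof. by move=> z1 cz; rewrite weight_out// indicE mem_set//; right. Qed.

Lemma weight_eq0 z : 1 <= enorm z -> ~ coord_planes z -> ~ thin_cone a (meta G0 F0 z) -> w z = 0.
Proof. by move=> z1 pz cz; rewrite weight_out// indicE memNset// => -[|[]]. Qed.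

Lemma weight_eventually1 (zeta : 'rV[R]_d.+1) (r : nat -> R) (zetas : nat -> 'rV[R]_d.+1) :
  (forall i, zeta ord0 i != 0) -> r n @[n --> \oo] --> +oo ->
  zetas n @[n --> \oo] --> zeta -> \forall n \near \oo, w (r n *: zetas n) = 1.
Proof.
move=> zi ry zz.
pose del := \big[Num.min/1]_i `|zeta ord0 i|.
have del0 : 0 < del by apply/bigmin_gtP; split => // i _; rewrite normr_gt0.
have deli i : del <= `|zeta ord0 i| by exact: bigmin_le_cond.
pose M := `|zeta| + 1.
have M0 : 0 < M by rewrite ltr_wpDl.
(* Eventually the moduli of the coordinates of [zetas n] lie between [del / 2] and [M], so this
   bounds their ratios from below. *)
pose q := del / 2 / M.
have q0 : 0 < q by rewrite !divr_gt0.
have [T T1 hT] := thin_cone_large rF rG aP d.+1 q0.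
have d1 : 0 < Num.min (del / 2) 1 by rewrite lt_min divr_gt0/=.
near=> n.
have zn : `|zeta - zetas n| < Num.min (del / 2) 1.
  by near: n; move/cvgrPdist_lt : zz; exact.
have rn : T / (del / 2) <= r n by near: n; move/cvgryPge : ry; exact.
have r0 : 0 < r n by apply: lt_le_trans rn; rewrite !divr_gt0//; lra.
move: zn; rewrite lt_min => /andP[zn1 zn2].
have hl i : del / 2 <= `|zetas n ord0 i|.
  have := rV_norm_coord (zeta - zetas n) i; rewrite !mxE => h.
  have := deli i; have := ler_distD (zetas n ord0 i) (zeta ord0 i) 0.
  by rewrite !subr0; lra.
have hu i : `|zetas n ord0 i| <= M.
  have := rV_norm_coord (zeta - zetas n) i; rewrite !mxE distrC => h.
  have := rV_norm_coord zeta i; have := ler_distD (zeta ord0 i) (zetas n ord0 i) 0.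
  by rewrite !subr0 /M; lra.
have hT' i : T <= `|(r n *: zetas n) ord0 i|.
  rewrite mxE normrM gtr0_norm//; apply: (@le_trans _ _ (r n * (del / 2))).
    by rewrite -ler_pdivrMr// divr_gt0.
  by rewrite ler_pM2l.
apply: weight_cone.
  apply: le_trans T1 _; apply: le_trans (hT' ord0) _.
  exact: le_trans (rV_norm_coord _ _) (le_norm_enorm _).
apply: hT => // i j; rewrite !mxE !normrM mulrCA ler_pM2l ?normr_gt0 ?gt_eqF//.
apply: le_trans (hl j); rewrite /q -[leRHS](divfK (lt0r_neq0 M0)).
by rewrite ler_wpM2l// ltW// !divr_gt0.
Unshelve. all: by end_near. Qed.

(** Off the diagonal rays two coordinates of [xi] have different moduli. The relative gap survives
    the approximation and the scaling by [r n], and far out it violates some fixed tolerance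
    [shrink m]. *)
Lemma weight_meta_eventually0 (xi : 'rV[R]_d.+1) (r : nat -> R) (xis : nat -> 'rV[R]_d.+1) :
  (forall i, xi ord0 i != 0) ->
  (forall (t : R) (delta : 'rV[R]_d.+1), 0 < t -> sign_vector delta -> xi <> t *: delta) ->
  r n @[n --> \oo] --> +oo -> xis n @[n --> \oo] --> xi ->
  \forall n \near \oo, w (meta F0 G0 (r n *: xis n)) = 0.
Proof.
move=> xi0 xid ry xx.
have [i [j hij]] : exists i j, `|xi ord0 i| < `|xi ord0 j|.
  apply/not_existsP => h; apply: (xid `|xi ord0 ord0| (\row_i Num.sg (xi ord0 i))).
  - by rewrite normr_gt0.
  - by move=> i; rewrite mxE; case: sgrP (xi0 i) => // _ _; [left|right].
  apply/matrixP => o i; rewrite ord1 !mxE.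
  have -> : `|xi ord0 ord0| = `|xi ord0 i|.
    apply/eqP; rewrite eq_le !leNgt; apply/andP; split; apply/negP => hh.
      by apply: (h i); exists ord0.
    by apply: (h ord0); exists i.
  by rewrite mulrC -numEsg.
pose e := `|xi ord0 j| - `|xi ord0 i|.
have e0 : 0 < e by rewrite subr_gt0.
pose M := `|xi| + 1.
have M0 : 0 < M by rewrite ltr_wpDl.
have [m hm] : exists m, m.+2%:R^-1 * M < e / 2.
  exists (Num.truncn (M / (e / 2))); rewrite mulrC ltr_pdivrMr//.
  rewrite -ltr_pdivrMl ?divr_gt0// mulrC.
  by apply: (lt_le_trans (truncnS_gt _)); rewrite ler_nat.
pose del := \big[Num.min/1]_i `|xi ord0 i|.
have del0 : 0 < del by apply/bigmin_gtP; split => // l _; rewrite normr_gt0.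
have deli l : del <= `|xi ord0 l| by exact: bigmin_le_cond.
(* The three bounds preserve the gap [e], keep the coordinates away from 0, and keep them below
   [M]. *)
pose eta := Num.min (Num.min (e / 8) (del / 2)) 1.
have eta0 : 0 < eta by rewrite !lt_min !divr_gt0/=.
near=> n.
have xn : `|xi - xis n| < eta by near: n; move/cvgrPdist_lt : xx; exact.
(* Beyond [a m] the tolerance [m] is in force; beyond [L 1] the transformed point is outside the
   unit ball. *)
have rn : Num.max (a m) (L 1) / (del / 2) <= r n by near: n; move/cvgryPge : ry; exact.
have r0 : 0 < r n by near: n; move/cvgryPgt : ry; exact.
have xl l : `|(`|xi ord0 l| - `|xis n ord0 l|)| < eta.
  apply: le_lt_trans (ler_dist_dist _ _) _; apply: le_lt_trans xn.
  by have := rV_norm_coord (xi - xis n) l; rewrite !mxE.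
have etae : eta <= e / 8 by rewrite !ge_min lexx.
have etad : eta <= del / 2 by rewrite !ge_min lexx orbT.
have eta1 : eta <= 1 by rewrite !ge_min lexx orbT.
have hl l : del / 2 <= `|xis n ord0 l|.
  by have := xl l; have := deli l; rewrite ltr_norml => ? /andP[? ?]; lra.
have hr l : Num.max (a m) (L 1) <= `|(r n *: xis n) ord0 l|.
  rewrite mxE normrM (gtr0_norm r0); apply: (@le_trans _ _ (r n * (del / 2))).
    by rewrite -ler_pdivrMr// divr_gt0.
  by rewrite ler_pM2l.
have L1 : 0 < L 1 by rewrite -(meta_marginal0 rG rF) (meta_marginal_lt rG rF).
set x := r n *: xis n in hr *.
have xnz l : x ord0 l != 0.
  rewrite -normr_gt0; apply: lt_le_trans (hr l); by rewrite lt_max L1 orbT.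
apply: weight_eq0.
- apply: le_trans (le_norm_enorm _); apply: le_trans (rV_norm_coord _ ord0).
  rewrite mxE (meta_marginal_norm rF rG) -[leLHS](meta_marginalK rG rF).
  rewrite (meta_marginal_le rF rG); apply: le_trans (hr ord0).
  by rewrite le_max lexx orbT.
- move=> [l]; rewrite mxE => h; have := xnz l.
  by rewrite -(meta_marginalK rF rG (x ord0 l)) h (meta_marginal0 rG rF) eqxx.
rewrite (metaK Hsetup) => /(_ m j i).
have -> : a m <= `|x ord0 j| by apply: le_trans (hr j); rewrite le_max lexx.
move=> /(_ isT); apply/negP; rewrite -ltNge /x !mxE !normrM mulrCA ltr_pM2l ?normr_gt0 ?gt_eqF//.
have hj := xl j; have hi := xl i.
have xjM : `|xis n ord0 j| <= M.
  have := rV_norm_coord xi j; move: hj; rewrite /M ltr_norml => /andP[h1 h2] h3; lra.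
have : m.+2%:R^-1 * `|xis n ord0 j| <= m.+2%:R^-1 * M by rewrite ler_wpM2l// invr_ge0.
rewrite /shrink mulrBl mul1r => hM; rewrite /e in etae hm.
move: hm; have {hM} := hM; set q := m.+2%:R^-1; move: (q * _) (q * _) => u v huv hv.
by move/ltr_normlP : hi => [? ?]; move/ltr_normlP : hj => [? ?]; lra.
Unshelve. all: by end_near. Qed.

End construction.

(** * Limits of the sample clouds *)

Section clouds_limits.
Variables (R : realType) (d : nat) (F f G g : 'rV[R]_d.+1 -> R) (F0 f0 G0 g0 : R -> R).
Hypothesis Hsetup : standard_setup F f F0 f0 G0 g0 G g.
Local Notation mu := (lebesgue_rV R d.+1).
Local Notation K := (meta_marginal F0 G0).
Local Notation L := (meta_marginal G0 F0).
Variables (b c : nat -> R).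
Hypotheses (Hc : forall n, (1 < n)%N -> 1 - F0 (c n) = n%:R^-1)
  (Hb : forall n, (1 < n)%N -> 1 - G0 (b n) = n%:R^-1).
Variable c0 : R.
Hypothesis c0_gt0 : 0 < c0.
Hypothesis Hc0 : (c0%:E * \int[mu]_(w in
               [set w : 'rV[R]_d.+1 | (1 <= w ord0 ord_max)%R])
               (tail_limit f w)%:E = 1)%E.
Variables (Ft ft Gt gt : 'rV[R]_d.+1 -> R).
Hypotheses (Dft : has_density Ft ft) (Dgt : has_density Gt gt).
Hypothesis ftf : forall z, 1 <= enorm z -> ft z <= f z.
Hypothesis fteq : forall (w : 'rV[R]_d.+1) (r : nat -> R), (forall i, w ord0 i != 0) ->
     r n @[n --> \oo] --> +oo -> \forall n \near \oo, ft (r n *: w) = f (r n *: w).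

Let rF := setup_regular_F Hsetup.
Let rG := setup_regular_G Hsetup.
Let f_gt0 z : 0 < f z. Proof. by have [l _ []] := F_class Hsetup. Qed.
Let pf : is_pdf f. Proof. by case: (F_density Hsetup). Qed.
Let mft : measurable_fun setT ft. Proof. by case: Dft => -[]. Qed.
Let ft0 z : 0 <= ft z. Proof. by case: Dft => -[]. Qed.

(** As [n] is the inverse of [1 - F0 (c n)] for [n > 1], [mass_ratio_cvg] at the scale [c n] is
    exactly the convergence of intensities. *)
Lemma density_clouds_cvg : clouds_cvg_to_poisson Ft c (fun w => c0 * tail_limit f w).
Proof.
move=> dT T P Z iidZ dT' T' Q N ppN phi [cphi [M phiM]] phi_near0.
have cy := quantile_cvgy rF Hc.
have law := iid_sample_law Dft iidZ.
have [r r0 hr] : exists2 r, 0 < r & forall x, `|x| < r -> phi x = 0.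
  have /nbhs_ballP[r /= r0 hr] := phi_near0; exists r => // x xr; apply: hr.
  by rewrite -ball_normE /ball_/= sub0r normrN.
apply: (cloud_cvg_in_distribution law iidZ.2 _ ppN cphi phiM r0 hr).
move=> A mA /nbhs_ballP[rho /= rho0 hrho].
have Arho w : A w -> rho <= `|w|.
  move=> Aw; rewrite leNgt; apply/negP => wr.
  by apply: (hrho w) => //; rewrite -ball_normE /ball_/= sub0r normrN.
have [fA hA] := mass_ratio_cvg Hsetup Hc0 mft ft0 ftf fteq cy mA rho0 Arho.
have [l l0 Ff] := F_class Hsetup.
rewrite (_ : fine _ = c0 * fine (\int[mu]_(z in A) (tail_limit f z)%:E)%E); last first.
  rewrite (_ : (\int[mu]_(z in A) (c0 * tail_limit f z)%:E)%E =
      (c0%:E * \int[mu]_(z in A) (tail_limit f z)%:E)%E).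
    by rewrite fineM.
  rewrite -ge0_integralZl//.
  - apply/measurable_EFinP; apply: measurable_funTS.
    exact: (measurable_tail_limit (ltn0Sn d) l0 Ff).
  - move=> w Aw; rewrite lee_fin ltW//.
    have [|//] := @tail_limit_cvg _ _ _ _ l0 Ff w (ltn0Sn d).
    by apply/eqP => w0; have := Arho w Aw; rewrite w0 normr0 leNgt rho0.
  - by rewrite lee_fin ltW.
apply: cvg_trans hA; apply: near_eq_cvg; near=> n.
rewrite Hc ?invrK 1?mulrC//.
by near: n; exact: nbhs_infty_gt.
Unshelve. all: by end_near. Qed.

Hypothesis gt_integral : forall A : set 'rV[R]_d.+1, measurable A ->
  (\int[mu]_(x in [set x | A (meta F0 G0 x)]) (gt x)%:E = \int[mu]_(z in A) (ft z)%:E)%E.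

Let mgt : measurable_fun setT gt. Proof. by case: Dgt => -[]. Qed.
Let gt0 z : 0 <= gt z. Proof. by case: Dgt => -[]. Qed.
Let mass A := fine (\int[mu]_(x in A) (gt x)%:E)%E.

Let mass_fin A : measurable A -> (\int[mu]_(x in A) (gt x)%:E)%E \is a fin_num.
Proof.
move=> mA; rewrite ge0_fin_numE; last by apply: integral_ge0 => x _; rewrite lee_fin.
have [_ _ gt1] := Dgt.1; rewrite (@le_lt_trans _ _ 1%E) ?ltry// -gt1.
apply: ge0_subset_integral => //; first exact/measurable_EFinP.
by move=> x _; rewrite lee_fin.
Qed.

Let by_ : b n @[n --> \oo] --> +oo. Proof. exact: quantile_cvgy rG Hb. Qed.

(** The tail comparison with [t = (1 + e)^-1] at [(1 + e) * b n], whose reference point is then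
    [b n] with tail [1 / n]. *)
Lemma outer_mass_cvg0 (e : R) : 0 < e ->
  n%:R * (1 - G0 ((1 + e) * b n)) @[n --> \oo] --> (0 : R).
Proof.
move=> e0; have [Gg _ g0' _] := rG.
have t01 : 0 < (1 + e)^-1 < 1 by rewrite invr_gt0 invf_lt1 ?ltrDl ?addr_gt0.
have e1 : 0 < 1 + e by rewrite addr_gt0.
apply/cvgrPdist_le => eps eps0.
have [s0 s00 hs0] := near_pinfty_ge (light_tailed_ccdf Gg (g0_tail Hsetup) t01 eps0).
near=> n; have bn : s0 <= b n by near: n; move/cvgryPge : by_; exact.
have n1 : (1 < n)%N by near: n; exact: nbhs_infty_gt.
have n0 : 0 < n%:R :> R by rewrite ltr0n (ltn_trans _ n1).
have := hs0 ((1 + e) * b n); rewrite mulKf ?gt_eqF// (Hb n1) => h.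
have {}h : 1 - G0 ((1 + e) * b n) <= eps / n%:R.
  by apply: h; apply: (le_trans bn); rewrite ler_peMl ?lerDl ?ltW// (lt_le_trans s00).
have h0 : 0 <= 1 - G0 ((1 + e) * b n) by rewrite subr_ge0 ltW// (cdf_lt1 Gg g0').
by rewrite sub0r normrN ger0_norm ?mulr_ge0// mulrC -ler_pdivlMr.
Unshelve. all: by end_near. Qed.

Lemma inner_mass_cvgy (r : R) : 0 < r < 1 ->
  n%:R * (1 - G0 (r * b n)) @[n --> \oo] --> +oo.
Proof.
move=> r01; have [Gg _ g0' _] := rG.
apply/cvgryPge => A; pose B := `|A| + 1.
have B0 : 0 < B by rewrite ltr_wpDl.
have Bi : 0 < B^-1 by rewrite invr_gt0.
have [s0 s00 hs0] := near_pinfty_ge (light_tailed_ccdf Gg (g0_tail Hsetup) r01 Bi).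
near=> n; have bn : s0 <= b n by near: n; move/cvgryPge : by_; exact.
have n1 : (1 < n)%N by near: n; exact: nbhs_infty_gt.
have n0 : 0 < n%:R :> R by rewrite ltr0n (ltn_trans _ n1).
have := hs0 _ bn; rewrite (Hb n1) ler_pdivlMl// ler_pdivrMr// mulrC => h.
by apply: (le_trans _ h); rewrite (le_trans (ler_norm A))// lerDl.
Unshelve. all: by end_near. Qed.

(** A point outside [b n * U] either has a coordinate of modulus at least [(1 + e) * b n], which the
    margins of [f] control, or by [cross_separation] lies off the thin cone, where [ft] vanishes
    except on the null coordinate planes. *)
Lemma outside_mass_cvg0 (U : set 'rV[R]_d.+1) (a : nat -> R) :
  open U -> @diagonal_cross R d.+1 `<=` U ->
  (forall z, 1 <= enorm z -> ~ coord_planes z -> ~ thin_cone a (meta G0 F0 z) -> ft z = 0) ->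
  n%:R * mass [set x | (~` U) ((b n)^-1 *: x)] @[n --> \oo] --> (0 : R).
Proof.
move=> oU EU ft_eq0; have [e [m [e0 e1 hsep]]] := cross_separation oU EU.
have mU : measurable U by exact: open_measurable_rV.
have h0 : (d.+1%:R * 2) * (n%:R * (1 - G0 ((1 + e) * b n))) @[n --> \oo] --> (0 : R).
  by rewrite -(mulr0 (d.+1%:R * 2)); apply: cvgM; [exact: cvg_cst|exact: outer_mass_cvg0].
apply: (squeeze_cvgr _ (cvg_cst 0) h0); near=> n.
(* The coordinate found by [cross_separation] has modulus at least [e * b n], hence beyond [a m],
   where the tolerance applies, and beyond [L 1], outside the unit ball of z-space. *)
have bn : Num.max 1 (Num.max (a m / e) (L 1 / e)) <= b n by near: n; move/cvgryPge : by_; exact.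
move: bn; rewrite !ge_max => /andP[b1 /andP[ba bL]].
have b0 : 0 < b n by exact: lt_le_trans b1.
have L1 : 0 < L 1 by rewrite -(meta_marginal0 rG rF) (meta_marginal_lt rG rF).
pose A := [set x | (~` U) ((b n)^-1 *: x)].
have mA : measurable A by apply: measurable_scale_set; exact: measurableC.
pose A' := [set z | A (meta G0 F0 z)].
have mA' : measurable A'.
  by rewrite -[X in measurable X]setTI; apply: (measurable_meta_inv Hsetup).
have AE : A = [set x | A' (meta F0 G0 x)].
  by apply/seteqP; split => x; rewrite /A'/= (metaK Hsetup).
rewrite /mass -/A AE gt_integral//.
apply/andP; split.
  apply: mulr_ge0 => //; apply: fine_ge0; apply: integral_ge0 => z _.
  by rewrite lee_fin.
rewrite mulrCA ler_wpM2l// -lee_fin fineK; last by rewrite -gt_integral// -AE mass_fin.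
pose s := K ((1 + e) * b n).
pose T i := [set z : 'rV[R]_d.+1 | s <= `|z ord0 i|].
have mT i : measurable (T i).
  have mc : measurable_fun setT (fun z : 'rV[R]_d.+1 => `|z ord0 i|).
    by apply: measurableT_comp => //; exact: measurable_coord.
  rewrite [X in measurable X](_ : _ = setT `&`
      (fun z : 'rV[R]_d.+1 => `|z ord0 i|) @^-1` `[s, +oo[).
    by apply: mc => //; exact: measurable_itv.
  by apply/seteqP; split => z; rewrite /T/= in_itv/= andbT; [split|case].
have mTU : measurable (\bigcup_i T i) by rewrite bigcup_ord; exact: bigsetU_measurable.
have mP := @measurable_coord_planes R d.+1.
have s1 : 1 <= s.
  rewrite /s -[leLHS](meta_marginalK rG rF) (meta_marginal_le rF rG).
  apply: (@le_trans _ _ (b n)); last by rewrite ler_peMl ?lerDl ?ltW.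
  by apply: le_trans bL; rewrite ler_pdivlMr// ler_piMr ?ltW.
have far z i : T i z -> 1 <= enorm z.
  move=> Tz; apply: (le_trans s1); apply: (le_trans Tz).
  exact: le_trans (rV_norm_coord _ _) (le_norm_enorm _).
have hzero z : A' z -> ~ (\bigcup_i T i) z -> ~ coord_planes z -> ft z = 0.
  move=> Az nTz nPz; set x := meta G0 F0 z in Az *.
  have xK i : K `|x ord0 i| = `|z ord0 i|.
    by rewrite /x mxE -(meta_marginal_norm rF rG) (meta_marginalK rG rF).
  have y1 : `|(b n)^-1 *: x| <= 1 + e.
    apply/rV_norm_leP => [|i]; first by rewrite addr_ge0// ltW.
    rewrite mxE normrM gtr0_norm ?invr_gt0// ler_pdivrMl// mulrC.
    rewrite leNgt; apply/negP => h; apply: nTz; exists i => //.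
    by rewrite /T/= /s -xK (meta_marginal_le rF rG) ltW.
  have [i [j [hij hei]]] := hsep _ Az y1.
  have xE l : `|((b n)^-1 *: x) ord0 l| = (b n)^-1 * `|x ord0 l|.
    by rewrite mxE normrM gtr0_norm ?invr_gt0.
  move: hij hei; rewrite !xE mulrCA ltr_pM2l ?invr_gt0// ler_pdivlMl// => hij hei.
  have e_x (u : R) : u / e <= b n -> u <= `|x ord0 i|.
    by rewrite ler_pdivrMr// => h; exact: le_trans h hei.
  apply: ft_eq0 => //.
    apply: le_trans (le_norm_enorm _); apply: le_trans (rV_norm_coord _ i).
    rewrite -xK -[leLHS](meta_marginalK rG rF) (meta_marginal_le rF rG).
    exact: e_x.
  move=> /(_ m i j (e_x _ ba)); apply/negP; rewrite -ltNge.
  exact: hij.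
have [mf _ _] := pf.
have emf D (h : 'rV[R]_d.+1 -> R) : measurable_fun setT h ->
    measurable_fun D (fun z : 'rV[R]_d.+1 => (h z)%:E).
  by move=> mh; apply/measurable_EFinP; exact: measurable_funTS.
have hP : (\int[mu]_(z in @coord_planes R d.+1) (ft z)%:E)%E = 0%E.
  exact: null_set_integral mP (emf _ ft mft) (lebesgue_coord_planes R d.+1).
pose nuft := density_measure mu mft ft0.
pose nuf := density_measure mu mf (fun z => ltW (f_gt0 z)).
have hsub : (nuft A' <= nuft ((\bigcup_i T i) `|` @coord_planes R d.+1))%E.
  have -> : nuft A' = nuft (A' `&` ((\bigcup_i T i) `|` @coord_planes R d.+1)).
    rewrite /nuft !density_measureE [RHS]integral_mkcondr; apply: eq_integral => z.
    rewrite inE => Az; rewrite /patch; case: ifPn => //.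
    rewrite notin_setE => /not_orP[h1 h2]; by rewrite hzero.
  apply: le_measure; rewrite ?inE//; last exact: measurableU.
  by apply: measurableI => //; exact: measurableU.
rewrite -[X in (X <= _)%E]/(nuft A'); apply: (le_trans hsub).
apply: (le_trans (measureU2 _ _ _)) => //.
rewrite [X in (_ + X)%E](_ : _ = 0%E) ?adde0//.
apply: (@le_trans _ _ (nuf (\bigcup_i T i))).
  apply: ge0_le_integral => //.
  - by move=> z _; rewrite lee_fin.
  - exact: emf.
  - exact: emf.
  - by move=> z [i _ Tz]; rewrite lee_fin ftf//; exact: far Tz.
rewrite bigcup_ord.
apply: (@le_trans _ _ (\sum_i nuf (T i))%E).
  suff [_] : measurable (\big[setU/set0]_i T i) /\
    (nuf (\big[setU/set0]_i T i) <= \sum_i nuf (T i))%E by [].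
  apply: (big_ind2 (fun A s => measurable A /\ (nuf A <= s)%E)) => //.
  - by split; [exact: measurable0|rewrite /nuf density_measureE integral_set0].
  - move=> A1 s1' A2 s2' [mA1 h1] [mA2 h2]; split; first exact: measurableU.
    exact: le_trans (measureU2 _ mA1 mA2) (leeD h1 h2).
apply: (@le_trans _ _ (\sum_(i < d.+1) (2 * (1 - F0 s))%:E)%E).
  apply: lee_sum => i _; exact: margin_norm_le pf (F_margins Hsetup) rF i s.
rewrite sumEFin lee_fin sumr_const card_ord /s (meta_marginal_cdf _ rF rG).
by rewrite -[leLHS]mulr_natl mulrA.
Unshelve. all: by end_near. Qed.

(** Take the box with the signs of the diagonal and moduli between [t n] and [2 * t n], where
    [t n = K (r * b n)]. Rapid variation squeezes its preimage into the ball around [p], while its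
    mass is of the order of [1 - G0 (r * b n)]. *)
Lemma near_point_mass_cvgy (p : 'rV[R]_d.+1) (eps : R) :
  @diagonal_cross R d.+1 p -> 0 < eps ->
  n%:R * mass [set x | enorm ((b n)^-1 *: x - p) < eps] @[n --> \oo] --> +oo.
Proof.
move=> [r0 [sg [r01 sgP ->]]] eps0.
pose e := eps / d.+1%:R; have e0 : 0 < e by rewrite divr_gt0.
(* The endpoints 0 and 1 of the cross are moved inwards: [r > 0] makes [r * b n] tend to infinity,
   and [r < 1] makes the mass exceed [1 / n] by any factor. *)
have [r [r_gt0 r_lt1 rr0]] : exists r, [/\ 0 < r, r < 1 & `|r - r0| <= e / 4].
  pose u := Num.min (e / 4) (1 / 4).
  have u0 : 0 < u by rewrite lt_min !divr_gt0.
  have ue : u <= e / 4 by rewrite ge_min lexx.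
  have u4 : u <= 1 / 4 by rewrite ge_min lexx orbT.
  have [h|h] := leP r0 (1 / 2).
    exists (r0 + u); split; [lra|lra|].
    by rewrite addrAC subrr add0r gtr0_norm.
  exists (r0 - u); split; [lra|lra|].
  by rewrite addrAC subrr add0r normrN gtr0_norm.
have rb : r * b n @[n --> \oo] --> +oo.
  apply/cvgryPge => A; move/cvgryPge : by_ => /(_ (r^-1 * A)).
  by apply: filterS => n; rewrite ler_pdivrMl.
pose t n := K (r * b n).
have ty : t n @[n --> \oo] --> +oo.
  exact: (cvg_comp _ _ rb (meta_marginal_cvgy rF rG)).
pose J i : set R := if sg ord0 i == 1 then `[1, 2]%classic else `[-2, -1]%classic.
have mJ i : measurable (J i) by rewrite /J; case: ifP => _; exact: measurable_itv.
pose Box := rect J; have mBox : measurable Box by exact: measurable_rect.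
have JE i s : J i s -> 1 <= sg ord0 i * s <= 2.
  rewrite /J; have [->|->] := sgP i; first by rewrite eqxx/= in_itv/= mul1r.
  have /negPf-> : (-1 : R) != 1 by apply/eqP; lra.
  by rewrite /= in_itv/= mulN1r; lra.
have Box1 w : Box w -> 1 <= `|w|.
  move=> /(_ ord0)/JE /andP[h _]; apply: le_trans (rV_norm_coord w ord0).
  have : `|sg ord0 ord0 * w ord0 ord0| <= `|w ord0 ord0|.
    by rewrite normrM; have [->|->] := sgP ord0; rewrite ?normrN normr1 mul1r.
  by apply: le_trans; apply: le_trans h (ler_norm _).
have muBox : (0 < mu Box)%E.
  rewrite lebesgue_rV_rect// (eq_bigr (fun=> 1%:E)).
    by rewrite prodEFin lte_fin prodr_const expr1n.
  move=> i _; rewrite /J; case: ifP => _; rewrite lebesgue_measure_itv/= lte_fin.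
    by rewrite ifT -?EFinD; [congr EFin; lra|lra].
  by rewrite ifT -?EFinD; [congr EFin; lra|lra].
have [l l0 Ff] := F_class Hsetup.
have [fB hB] := mass_ratio_cvg Hsetup Hc0 mft ft0 ftf fteq ty mBox ltr01 Box1.
pose c1 := c0 * fine (\int[mu]_(w in Box) (tail_limit f w)%:E)%E.
have h_gt0 w : Box w -> 0 < tail_limit f w.
  move=> /Box1 w1; have [|//] := @tail_limit_cvg _ _ _ _ l0 Ff w (ltn0Sn d).
  by apply/eqP => w0; move: w1; rewrite w0 normr0 leNgt ltr01.
have c1_gt0 : 0 < c1.
  rewrite mulr_gt0// -lte_fin fineK//; apply: (integral_EFin_gt0 mBox _ h_gt0 muBox).
  by apply: measurable_funTS; exact: (measurable_tail_limit (ltn0Sn d) l0 Ff).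
have eta01 : 0 < (1 + e / 2)^-1 < 1.
  by rewrite invr_gt0 invf_lt1 ?ltrDl ?addr_gt0 ?divr_gt0.
(* The case [A = 2]: doubling in z-space costs at most a factor [1 + e / 2] in x-space. *)
have [s0 s00 hs0] := setup_rapid Hsetup (ltr0Sn R 1) eta01.
have r01' : 0 < r < 1 by rewrite r_gt0.
apply/cvgryPge => A; pose A' := `|A| / (c1 / 2).
near=> n.
have bn : s0 / r <= b n by near: n; move/cvgryPge : by_; exact.
have b0 : 0 < b n by apply: lt_le_trans bn; rewrite divr_gt0.
pose Dn := [set z | Box ((t n)^-1 *: z)].
have mDn : measurable Dn by exact: measurable_scale_set.
have mDn' : measurable [set x | Dn (meta F0 G0 x)].
  by rewrite -[X in measurable X]setTI; apply: (measurable_meta Hsetup).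
have tn : 0 < t n by rewrite /t -(meta_marginal0 rF rG) (meta_marginal_lt rF rG) mulr_gt0.
have sub : [set x | Dn (meta F0 G0 x)] `<=` [set x | enorm ((b n)^-1 *: x - r0 *: sg) < eps].
  move=> x Dx /=; apply: (le_lt_trans (le_enorm_norm _)).
  (* Per coordinate, [e / 4] from moving [r0] to [r] and [e / 2] from the width of the box. *)
  apply: (@le_lt_trans _ _ (d.+1%:R * (3 / 4 * e))); last first.
    by rewrite mulrCA /e [d.+1%:R * _]mulrC divfK//; lra.
  rewrite ler_wpM2l//; apply/rV_norm_leP => [|i]; first by rewrite mulr_ge0// ltW.
  have := JE i _ (Dx i); rewrite !mxE mulrCA.
  set y := sg ord0 i * x ord0 i.
  have -> : sg ord0 i * K (x ord0 i) = K y.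
    by rewrite /y; have [->|->] := sgP i; rewrite ?mul1r// !mulN1r (meta_marginalN rF rG).
  rewrite ler_pdivlMl// ler_pdivrMl// mulr1 => /andP[y1 y2].
  have {}y1 : r * b n <= y by rewrite -(meta_marginal_le rF rG).
  have {}y2 : y <= (1 + e / 2) * (r * b n).
    rewrite -(meta_marginal_le rF rG); apply: (le_trans y2).
    rewrite mulrC; have := hs0 ((1 + e / 2) * (r * b n)).
    rewrite mulKf; last by rewrite gt_eqF// addr_gt0// divr_gt0.
    apply; rewrite ler_pdivrMr// in bn; rewrite (le_trans bn)// mulrC.
    by rewrite ler_peMl ?lerDl ?mulr_ge0 ?divr_ge0// ltW.
  have -> : `|(b n)^-1 * x ord0 i - r0 * sg ord0 i| = `|y / b n - r0|.
    rewrite /y; have [->|->] := sgP i; first by rewrite mul1r mulr1 mulrC.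
    by rewrite mulrN1 mulN1r opprK mulNr -opprD normrN mulrC.
  have {}y1 : r <= y / b n by rewrite ler_pdivlMr.
  have {}y2 : y / b n <= r + r * (e / 2) by rewrite ler_pdivrMr//; lra.
  have re : r * (e / 2) <= e / 2 by rewrite ler_piMl ?divr_ge0// ltW.
  move: rr0; rewrite !ler_norml => /andP[h1 h2]; apply/andP; split; lra.
have hq : c1 / 2 <= fine (\int[mu]_(z in Dn) (ft z)%:E)%E / (1 - F0 (t n)).
  by rewrite /Dn; near: n; apply: (cvgr_ge _ hB); rewrite -/c1; lra.
have hG : A' <= n%:R * (1 - G0 (r * b n)).
  by near: n; move/cvgryPge : (inner_mass_cvgy r01'); exact.
have G1 : 0 < 1 - G0 (r * b n).
  by have [Gg _ g0' _] := rG; rewrite subr_gt0 (cdf_lt1 Gg g0').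
rewrite /t (meta_marginal_cdf _ rF rG) ler_pdivlMr// in hq.
apply: (@le_trans _ _ (n%:R * (c1 / 2 * (1 - G0 (r * b n))))).
  rewrite mulrCA mulrC -ler_pdivrMr ?divr_gt0//.
  by apply: le_trans hG; rewrite ler_pM2r ?invr_gt0 ?divr_gt0// ler_norm.
rewrite ler_wpM2l//; apply: (le_trans hq).
have mS : measurable [set x : 'rV[R]_d.+1 | enorm ((b n)^-1 *: x - r0 *: sg) < eps].
  exact: (measurable_scale_set _ (measurable_enorm_ball (r0 *: sg) eps)).
rewrite /mass -lee_fin !fineK.
- rewrite -[X in (X <= _)%E]gt_integral//; apply: ge0_subset_integral => //.
    by apply/measurable_EFinP; exact: measurable_funTS.
  by move=> z _; rewrite lee_fin.
- exact: mass_fin.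
- by rewrite -gt_integral//; exact: mass_fin.
Unshelve. all: by end_near. Qed.

(** Vanishing expected counts empty the complement of [U]; expected counts tending to infinity make
    the binomial probability of at most [m] points vanish. *)
Lemma density_clouds_cvg_onto (a : nat -> R) :
  (forall z, 1 <= enorm z -> ~ coord_planes z -> ~ thin_cone a (meta G0 F0 z) -> ft z = 0) ->
  clouds_cvg_onto Gt b (@diagonal_cross R d.+1).
Proof.
move=> ft_eq0 dT T P Z iidZ; have law := iid_sample_law Dgt iidZ.
split=> [U oU EU|m eps p _ eps0 Ep].
  have h := outside_mass_cvg0 oU EU ft_eq0.
  have mU : measurable (~` U) by apply: measurableC; exact: open_measurable_rV.
  have mUn n : measurable [set x | (~` U) ((b n)^-1 *: x)] by exact: measurable_scale_set.
  apply: (@squeeze_cvge _ _ _ _ (fun=> 0%E) _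
    (fun n => (n%:R * mass [set x | (~` U) ((b n)^-1 *: x)])%:E)).
  - near=> n; rewrite measure_ge0/=.
    under eq_set do rewrite num_points_counts.
    exact: (counts_gt0_le law).
  - exact: cvg_cst.
  - by apply: cvg_EFin h; exact: nearW.
pose S n := [set x : 'rV[R]_d.+1 | enorm ((b n)^-1 *: x - p) < eps].
have mS n : measurable (S n).
  exact: (measurable_scale_set _ (measurable_enorm_ball p eps)).
have h := @binomial_cvg0 _ _ _ _ _ _ _ law iidZ.2 _ m mS (near_point_mass_cvgy Ep eps0).
pose C n := [set w | (counts Z (S n) n w <= m)%N].
have mC n : measurable (C n).
  rewrite [X in measurable X](_ : _ =
      \bigcup_(k in [set k | (k <= m)%N]) [set w | counts Z (S n) n w = k]).
    by apply: bigcup_measurable => k _; exact: measurable_counts.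
  by apply/seteqP; split => [w hw|w [k km /= kE]]; [exists (counts Z (S n) n w)|rewrite /C/= kE].
have -> : (fun n => P [set w | (m < num_points (sample_cloud Z b n w)
    [set x | (enorm (x - p) < eps)%R])%N]) = fun n => (1 - fine (P (C n)))%:E.
  apply/funext => n; rewrite EFinB fineK ?fin_num_measure//.
  rewrite -probability_setC//; congr (P _); apply/seteqP.
  by split => w; rewrite /= num_points_counts -/(S n) ltnNge => /negP.
apply: cvg_EFin; first exact: nearW.
by rewrite -[X in _ --> X]subr0; apply: cvgB; [exact: cvg_cst|exact: h].
Unshelve. all: by end_near. Qed.

End clouds_limits.

(** * Assembly of the modified distribution *)

Theorem proposition3p8 (R : realType) (d : nat)
    (F f G g : 'rV[R]_d.+1 -> R) (F0 f0 G0 g0 : R -> R)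
    (Hsetup : standard_setup F f F0 f0 G0 g0 G g)
    (b c : nat -> R)
    (Hc : forall n, (1 < n)%N -> 1 - F0 (c n) = n%:R^-1)
    (Hb : forall n, (1 < n)%N -> 1 - G0 (b n) = n%:R^-1)
    (c0 : R) (c0_gt0 : 0 < c0)
    (Hc0 : (c0%:E * \int[lebesgue_rV R d.+1]_(w in
               [set w : 'rV[R]_d.+1 | (1 <= w ord0 ord_max)%R])
               (tail_limit f w)%:E = 1)%E) :
  exists Ft ft Gt gt : 'rV[R]_d.+1 -> R,
    has_density Ft ft /\
    (forall x, Gt x = Ft (meta F0 G0 x)) /\
    has_density Gt gt /\
    (forall x, gt x = g x * (ft (meta F0 G0 x) / f (meta F0 G0 x))) /\
    ((forall z, 1 <= enorm z -> ft z <= f z) /\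
     (exists B : set 'rV[R]_d.+1, bounded_set B /\
        forall x, ~ B x -> gt x <= g x)) /\
    (forall i : 'I_d.+1,
       (forall z : 'rV[R]_d.+1, z ord0 i = 0 -> ft z = f z) /\
       (forall x : 'rV[R]_d.+1, x ord0 i = 0 -> gt x = g x)) /\
    (forall (zeta : 'rV[R]_d.+1) (r : nat -> R) (zetas : nat -> 'rV[R]_d.+1),
       enorm zeta = 1 -> (forall i, zeta ord0 i != 0) ->
       r n @[n --> \oo] --> +oo -> zetas n @[n --> \oo] --> zeta ->
       \forall n \near \oo, ft (r n *: zetas n) = f (r n *: zetas n)) /\
    (forall (xi : 'rV[R]_d.+1) (r : nat -> R) (xis : nat -> 'rV[R]_d.+1),
       enorm xi = 1 -> (forall i, xi ord0 i != 0) ->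
       (forall (t : R) (delta : 'rV[R]_d.+1), 0 < t -> sign_vector delta ->
          xi <> t *: delta) ->
       r n @[n --> \oo] --> +oo -> xis n @[n --> \oo] --> xi ->
       \forall n \near \oo, gt (r n *: xis n) = 0) /\
    clouds_cvg_to_poisson Ft c (fun w => c0 * tail_limit f w) /\
    clouds_cvg_onto Gt b (@diagonal_cross R d.+1).
Proof.
have rF := setup_regular_F Hsetup; have rG := setup_regular_G Hsetup.
have f_gt0 z : 0 < f z by have [l _ []] := F_class Hsetup.
have [pf _] := F_density Hsetup; have [[_ g_ge0 _] _] := G_density Hsetup.
(* Rapid variation for each [m] separately, with ratio [m.+1] and contraction [shrink R m]; [choice]
   gathers the thresholds into the sequence defining the cone. *)
have /choice[a aP] (m : nat) : exists x : R, forall s, x <= s ->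
    m.+1%:R * meta_marginal F0 G0 (shrink R m * s) <= meta_marginal F0 G0 s.
  have [s0 _ h] := setup_rapid Hsetup (ltr0Sn R m) (shrink_itv R m).
  by exists s0.
have [k k0 ft1] := exists_boost Hsetup a.
have mk := measurable_kept Hsetup a; have mb := @measurable_boosted R d.
pose w z := \1_(kept F0 G0 a) z + k * \1_(@boosted R d) z.
pose ft z := f z * w z.
pose Ft x := fine (\int[lebesgue_rV R d.+1]_(z in orthant x) (ft z)%:E)%E.
pose gt x := g x * (ft (meta F0 G0 x) / f (meta F0 G0 x)).
have gtE x : gt x = g x * w (meta F0 G0 x) by rewrite /gt /ft mulrAC divff ?mul1r// gt_eqF.
have Dft : has_density Ft ft := reweighted_density Hsetup mk mb k0 ft1.
have Dgt : has_density (Ft \o meta F0 G0) gt := reweighted_meta_density Hsetup mk mb k0 ft1.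
have ftf z : 1 <= enorm z -> ft z <= f z.
  by move=> z1; rewrite /ft ler_piMr ?(ltW (f_gt0 z))//; exact: weight_le1.
have ftz (zeta : 'rV[R]_d.+1) (r : nat -> R) (zetas : nat -> 'rV[R]_d.+1) :
    (forall i, zeta ord0 i != 0) -> r n @[n --> \oo] --> +oo ->
    zetas n @[n --> \oo] --> zeta ->
    \forall n \near \oo, ft (r n *: zetas n) = f (r n *: zetas n).
  move=> zi ry zz; near=> n; rewrite /ft (_ : w _ = 1) ?mulr1//; near: n.
  exact: (weight_eventually1 Hsetup aP k zi ry zz).
have fteq (z : 'rV[R]_d.+1) (r : nat -> R) : (forall i, z ord0 i != 0) ->
    r n @[n --> \oo] --> +oo -> \forall n \near \oo, ft (r n *: z) = f (r n *: z).
  by move=> zi ry; apply: (ftz z r (fun=> z)) => //; exact: cvg_cst.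
exists Ft, ft, (Ft \o meta F0 G0), gt; split=> //; split=> //; split=> //; split=> //.
split; [split=> //|split; [|split; [|split; [|split]]]].
(* The preimage of the unit ball is bounded by [meta_marginal G0 F0 1] in every coordinate. *)
- exists [set x | enorm (meta F0 G0 x) < 1]; split.
    exists (meta_marginal G0 F0 1); split; first exact: num_real.
    move=> M hM x /= x1; apply/rV_norm_leP => [|i].
      apply: le_trans (ltW hM).
      by rewrite -(meta_marginal0 rG rF) (meta_marginal_le rG rF).
    apply: le_trans (ltW hM).
    rewrite -(meta_marginal_le rF rG) (meta_marginalK rG rF) -(meta_marginal_norm rF rG).
    have := rV_norm_coord (meta F0 G0 x) i; rewrite mxE => /le_trans; apply.
    exact: le_trans (le_norm_enorm _) (ltW x1).
  move=> x /negP; rewrite -leNgt => x1.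
  by rewrite gtE ler_piMr//; exact: weight_le1.
- move=> i; split=> [z zi|x xi].
    by rewrite /ft (_ : w z = 1) ?mulr1//; apply: weight_planes; exists i.
  rewrite gtE (_ : w _ = 1) ?mulr1//; apply: weight_planes; exists i.
  by rewrite mxE xi (meta_marginal0 rF rG).
- by move=> zeta r zetas _; exact: ftz.
- move=> xi r xis _ xi0 xid ry xx; near=> n.
  rewrite gtE (_ : w _ = 0) ?mulr0//; near: n.
  exact: (weight_meta_eventually0 Hsetup a k xi0 xid ry xx).
- exact: (density_clouds_cvg Hsetup Hc c0_gt0 Hc0 Dft ftf fteq).
- apply: (density_clouds_cvg_onto Hsetup Hb c0_gt0 Hc0 Dft Dgt ftf fteq _ (a := a)).
    by move=> A mA; exact: (reweighted_meta_integral Hsetup mk mb k0 mA).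
  move=> z z1 zp zc; rewrite /ft (_ : w z = 0) ?mulr0//; exact: weight_eq0.
Unshelve. all: by end_near. Qed.
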